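(* Let $c\in\mathbb{N}$ and let $m:\widehat\Gamma\to\{0,1,\dots,c\}$ be a Borel function which satisfies the consistency inequality $$m(\omega)\le\sum_{\alpha^*(\zeta)=\omega}m(\zeta)\qquad\text{for all }\omega\in\widehat\Gamma,$$ and define a nonnegative-integer-valued function $\widetilde m$ on $\widehat\Gamma$ by $$\widetilde m(\omega)=\sum_{\alpha^*(\zeta)=\omega}m(\zeta)-m(\omega).$$ Suppose that there is a positive integer $a$ such that $m(\omega)-\widetilde m(\omega)\le a\le m(\omega)$ for all $\omega$ near the identity $1$ of $\widehat\Gamma$ (that is, for all $\omega$ in some neighborhood of $1$). Then there is a generalized multiresolution analysis which has $m$ and $\widetilde m$ as the associated multiplicity and complementary multiplicity functions. That is, there exist a separable Hilbert space $\mathcal{H}$, a unitary representation $\pi:\Gamma\to U(\mathcal{H})$, a unitary operator $\delta$ on $\mathcal{H}$ with $\delta^{-1}\pi_\gamma\delta=\pi_{\alpha(\gamma)}$ for all $\gamma\in\Gamma$, and a generalized multiresolution analysis $\{V_n:n\in\mathbb{Z}\}$ of $\mathcal{H}$ relative to $\pi$ and $\delta$ which has $m$ as its multiplicity function and $\widetilde m$ as its complementary multiplicity function.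
   Context: Standing assumptions: $\Gamma$ is a countable (discrete) abelian group with compact dual group $\widehat\Gamma$, whose identity is denoted $1$, and $\lambda$ is normalised Haar measure on $\widehat\Gamma$. $\alpha$ is an injective endomorphism of $\Gamma$ such that $\alpha(\Gamma)$ has finite index $N$ in $\Gamma$. $\alpha^*$ is the surjective endomorphism of $\widehat\Gamma$ given by $\alpha^*(\omega)=\omega\circ\alpha$; one has $|\ker\alpha^*|=N$. It is assumed that $\bigcup_{n\ge1}\ker\alpha^{*n}$ is dense in $\widehat\Gamma$ (equivalently $\bigcap_{n\ge1}\alpha^n(\Gamma)=\{0\}$). All Hilbert spaces are separable. Given a unitary representation $\pi:\Gamma\to U(\mathcal{H})$ and a unitary $\delta$ on $\mathcal{H}$ with $\delta^{-1}\pi_\gamma\delta=\pi_{\alpha(\gamma)}$ for all $\gamma\in\Gamma$, a generalized multiresolution analysis (GMRA) relative to $\pi$ and $\delta$ is a sequence $\{V_n:n\in\mathbb{Z}\}$ of closed subspaces of $\mathcal{H}$ such that: (a) $V_n\subset V_{n+1}$ for all $n$; (b) $V_{n+1}=\delta(V_n)$ for all $n$; (c) $\bigcup_{n=0}^\infty V_n$ is dense in $\mathcal{H}$ and $\bigcap_{n=-\infty}^0V_n=\{0\}$; (d) $V_0$ is invariant under $\pi$. Then $W_0:=V_1\ominus V_0$ is also invariant under $\pi$. Multiplicity functions: for a unitary representation $\rho$ of $\Gamma$ on a Hilbert space $V$, Stone's theorem and multiplicity theory give a Borel measure $\mu$ on $\widehat\Gamma$, Borel sets $\sigma_1\supseteq\sigma_2\supseteq\cdots$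 in $\widehat\Gamma$ and a unitary $J:V\to\bigoplus_iL^2(\sigma_i,\mu)$ with $[J(\rho_\gamma v)]_i(\omega)=\omega(\gamma)[J(v)]_i(\omega)$ for $v\in V$, $\gamma\in\Gamma$ and $\mu$-almost all $\omega$; the multiplicity function is $\sum_i\chi_{\sigma_i}$. Only measures $\mu$ absolutely continuous with respect to $\lambda$ are considered, and then (intersecting the $\sigma_i$ with $\{d\mu/d\lambda>0\}$) one normalises to $\mu=\lambda$. Thus a Borel function $m$ with values in $\{0,1,2,\dots\}$ is the multiplicity function of $\rho$ if, with $\sigma_i=\{\omega:m(\omega)\ge i\}$ for $i\ge1$, there is a unitary $J:V\to\bigoplus_{i\ge1}L^2(\sigma_i,\lambda)$ with $[J(\rho_\gamma v)]_i(\omega)=\omega(\gamma)[J(v)]_i(\omega)$ for $\lambda$-almost all $\omega$. The multiplicity function of the GMRA is that of $\pi|_{V_0}$, and its complementary multiplicity function is that of $\pi|_{W_0}$.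
   Formalization: The group Γ is assumed nontrivial: for Γ = {0}, α = id, m = a = 1 all hypotheses hold but m̃ = 0 forces all V_n equal, hence V_0 = {0}, contradicting m = 1. *)

(* Defs.v *)
From HB Require Import structures.
From mathcomp Require Import all_boot all_order all_algebra.
From mathcomp Require Import all_classical all_reals all_analysis.
From mathcomp Require Import complex.
Set Implicit Arguments.
Unset Strict Implicit.
Unset Printing Implicit Defensive.
Import Order.TTheory GRing.Theory Num.Theory.
Import numFieldNormedType.Exports.
Local Open Scope classical_set_scope.
Local Open Scope ring_scope.

(* R[i] is not reached by the generic instances of numFieldNormedType, so its
   norm topology is declared here. *)
HB.instance Definition _ (R : realType) := NormedModule.copy R[i] R[i]^o.

(* The dual group of a discrete abelian group: unitary characters, under
   pointwise multiplication and with the topology of pointwise convergence. *)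
Record dual (R : realType) (Gamma : zmodType) := Dual {
  dual_fun :> Gamma -> R[i];
  dual_unit : forall g, `|dual_fun g| = 1;
  dualD : forall g h, dual_fun (g + h) = dual_fun g * dual_fun h }.

Section dual_structure.
Context (R : realType) (Gamma : zmodType).
Implicit Types (w z : dual R Gamma) (g h : Gamma).

Lemma dual_eq w z : w =1 z -> w = z.
Proof.
case: w z => [f f1 fD] [k k1 kD] /= /funext fk; case: _ / fk in k1 kD *.
by congr Dual; exact: Prop_irrelevance.
Qed.

Lemma dual_neq0 w g : w g != 0.
Proof. by rewrite -normr_eq0 dual_unit oner_neq0. Qed.

Lemma dual_one_unit g : `|1 : R[i]| = 1. Proof. exact: normr1. Qed.
Lemma dual_one_D g h : (1 : R[i]) = 1 * 1. Proof. by rewrite mulr1. Qed.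
Definition dual_one : dual R Gamma := @Dual R Gamma (fun=> 1) dual_one_unit dual_one_D.

Lemma dual_mul_unit w z g : `|w g * z g| = 1.
Proof. by rewrite normrM !dual_unit mulr1. Qed.
Lemma dual_mul_D w z g h : w (g + h) * z (g + h) = w g * z g * (w h * z h).
Proof. by rewrite !dualD mulrACA. Qed.
Definition dual_mul w z : dual R Gamma := Dual (dual_mul_unit w z) (dual_mul_D w z).

Lemma dual_inv_unit w g : `|(w g)^-1| = 1.
Proof. by rewrite normfV dual_unit invr1. Qed.
Lemma dual_inv_D w g h : (w (g + h))^-1 = (w g)^-1 * (w h)^-1.
Proof. by rewrite dualD invfM. Qed.
Definition dual_inv w : dual R Gamma := Dual (dual_inv_unit w) (dual_inv_D w).

HB.instance Definition _ := gen_eqMixin (dual R Gamma).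
HB.instance Definition _ := gen_choiceMixin (dual R Gamma).

Lemma dual_mulA : associative dual_mul.
Proof. by move=> x y z; apply: dual_eq => g /=; rewrite mulrA. Qed.
Lemma dual_mul1 : left_id dual_one dual_mul.
Proof. by move=> x; apply: dual_eq => g /=; rewrite mul1r. Qed.
Lemma dual_mulr1 : right_id dual_one dual_mul.
Proof. by move=> x; apply: dual_eq => g /=; rewrite mulr1. Qed.
Lemma dual_mulV : left_inverse dual_one dual_inv dual_mul.
Proof. by move=> x; apply: dual_eq => g /=; rewrite mulVf ?dual_neq0. Qed.
Lemma dual_mulrV : right_inverse dual_one dual_inv dual_mul.
Proof. by move=> x; apply: dual_eq => g /=; rewrite mulfV ?dual_neq0. Qed.

HB.instance Definition _ := isGroup.Build (dual R Gamma)
  dual_mulA dual_mul1 dual_mulr1 dual_mulV dual_mulrV.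
HB.instance Definition _ := isPointed.Build (dual R Gamma) 1%g.
HB.instance Definition _ := Topological.copy (dual R Gamma)
  (initial_topology (@dual_fun R Gamma : dual R Gamma -> {ptws Gamma -> R[i]})).

End dual_structure.

(* The dual group with its Borel sigma-algebra. *)
Definition borel_dual (R : realType) (Gamma : zmodType) :=
  g_sigma_algebraType (@open (dual R Gamma)).
HB.instance Definition _ (R : realType) (Gamma : zmodType) :=
  Measurable.on (borel_dual R Gamma).

(* Being a probability is part of the type of lambda; on this compact
   metrizable group (Gamma is countable) regularity is automatic. *)
Definition normalized_haar (R : realType) (Gamma : zmodType)
    (lambda : probability (borel_dual R Gamma) R) :=
  forall (z : dual R Gamma) (A : set (borel_dual R Gamma)),
    measurable A -> lambda [set (z * w)%g | w in A] = lambda A.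

Section dual_endomorphism.
Context (R : realType) (Gamma : zmodType) (alpha : {additive Gamma -> Gamma}).
Implicit Types (w : dual R Gamma) (m : dual R Gamma -> nat).

Lemma adjoint_unit w g : `|(w \o alpha) g| = 1.
Proof. exact: dual_unit. Qed.
Lemma adjoint_D w g h : (w \o alpha) (g + h) = (w \o alpha) g * (w \o alpha) h.
Proof. by rewrite /= raddfD dualD. Qed.
Definition adjoint w : dual R Gamma := Dual (adjoint_unit w) (adjoint_D w).

(* The set of cosets of the range has exactly N elements. *)
Definition range_index (N : nat) :=
  (range (fun g : Gamma => [set g + alpha h | h in [set: Gamma]]) #= `I_N)%card.

(* The fibres of [adjoint] are finite when the range of alpha has finite
   index, so this finitely supported sum is the genuine sum. *)
Definition fiber_sum m w : nat :=
  \big[addn/0%N]_(z \in [set z | adjoint z = w]) m z.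

Definition complementary m w : nat := (fiber_sum m w - m w)%N.

End dual_endomorphism.

Definition separable (T : topologicalType) :=
  exists D : set T, countable D /\ dense D.

Record hilbert (R : realType) := Hilbert {
  hilbert_carrier :> completeNormedModType R[i];
  hdot : {dot hilbert_carrier for Num.conj};
  hdotE : forall v, hdot v v = `|v| ^+ 2 }.

Section hilbert_operators.
Context (R : realType) (H : hilbert R).

Record unitary := Unitary {
  unitary_fun :> {linear H -> H};
  unitary_inv : H -> H;
  unitary_funK : cancel unitary_fun unitary_inv;
  unitary_invK : cancel unitary_inv unitary_fun;
  unitary_isometry : isometry (hdot H) (hdot H) unitary_fun }.

Definition closed_subspace (V : set H) :=
  [/\ closed V, V 0 & forall (a : R[i]) u v, V u -> V v -> V (a *: u + v)].

(* V `-` W : the orthogonal complement of W within V. *)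
Definition ominus (V W : set H) : set H :=
  [set v | V v /\ forall w, W w -> hdot H v w = 0].

Definition unitary_representation (Gamma : zmodType) (pi : Gamma -> unitary) :=
  (forall v, pi 0 v = v) /\ (forall g h v, pi (g + h) v = pi g (pi h v)).

Definition invariant (Gamma : zmodType) (pi : Gamma -> unitary) (V : set H) :=
  forall g v, V v -> V (pi g v).

Record gmra (Gamma : zmodType) (pi : Gamma -> unitary) (delta : unitary)
    (V : int -> set H) : Prop := Gmra {
  gmra_closed : forall n, closed_subspace (V n);
  gmra_sub : forall n, V n `<=` V (n + 1);
  gmra_dilate : forall n, V (n + 1) = delta @` V n;
  gmra_dense : dense (\bigcup_(n in [set n : int | 0 <= n]) V n);
  gmra_cap : \bigcap_(n in [set n : int | n <= 0]) V n = [set 0];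
  gmra_invariant : invariant pi (V 0) }.

End hilbert_operators.

Section l2_direct_sum.
Context d (T : measurableType d) (R : realType) (mu : {measure set T -> \bar R}).
Context (sigma : nat -> set T).
Implicit Types f : nat -> T -> R[i].

(* The Hilbert space direct sum of the L^2(sigma i, mu), by representatives:
   families f are compared modulo a.e. equality of f i on sigma i. *)
Definition l2_norm_sq f : \bar R :=
  (\sum_(0 <= i <oo) \int[mu]_(w in sigma i) ((Normc.normc (f i w)) ^+ 2)%:E)%E.

Definition in_l2 f :=
  (forall i, measurable_fun (sigma i) (fun w => complex.Re (f i w)) /\
             measurable_fun (sigma i) (fun w => complex.Im (f i w))) /\
  (l2_norm_sq f < +oo)%E.

Definition eq_l2 f h :=
  forall i, {ae mu, forall w, sigma i w -> f i w = h i w}.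

(* J represents a unitary from the subspace V of H onto this direct sum, i.e.,
   a surjective linear isometry. *)
Record unitary_onto_l2 (H : hilbert R) (V : set H)
    (J : H -> nat -> T -> R[i]) : Prop := UnitaryOntoL2 {
  onto_l2_in : forall v, V v -> in_l2 (J v);
  onto_l2_linear : forall (a : R[i]) u v, V u -> V v ->
    eq_l2 (J (a *: u + v)) (fun i w => a * J u i w + J v i w);
  onto_l2_isometry : forall v, V v ->
    l2_norm_sq (J v) = (complex.Re (hdot H v v))%:E;
  onto_l2_surjective : forall f, in_l2 f -> exists2 v, V v & eq_l2 (J v) f }.

End l2_direct_sum.

(* Summands are numbered from 0: number i is L^2({m >= i + 1}). *)
Definition multiplicity_function (R : realType) (Gamma : zmodType)
    (lambda : probability (borel_dual R Gamma) R) (H : hilbert R)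
    (pi : Gamma -> unitary H) (V : set H) (m : borel_dual R Gamma -> nat) :=
  let sigma i := [set w | (i.+1 <= m w)%N] in
  measurable_fun [set: borel_dual R Gamma] m /\
  exists2 J : H -> nat -> borel_dual R Gamma -> R[i],
    unitary_onto_l2 lambda sigma V J &
    forall (g : Gamma) v, V v ->
      eq_l2 lambda sigma (J (pi g v))
        (fun i w => (w : dual R Gamma) g * J v i w).

(* Main.v *)
Require Import Defs.
From HB Require Import structures.
From mathcomp Require Import all_boot all_order all_algebra.
From mathcomp Require Import all_classical all_reals all_analysis.
From mathcomp Require Import measurable_realfun complex.
From mathcomp Require Import ring lra zify.

(** The representation is realised by multiplication operators on the L^2 space
    of an explicit measure space, the tower, and the dilation by composition
    with a bijection of the tower.

    Write A for the adjoint of alpha, K for its kernel, M for the number of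
    elements of K, and m~ for the complementary function. Slab 0 of the tower is
    the set of pairs (i, z) with [i < m z], and every slab n + 1 is a copy of the
    set of pairs (j, w) with [j < m~ w]. By the consistency inequality, the
    slabs 0 and 1 have together as many layers over each point w as slab 0 has
    over the whole fibre of A above w. Numbering these layers therefore gives a
    bijection of slab 0 onto the union of slabs 0 and 1 that covers A; completed
    by the shift of slab n + 1 onto slab n + 2 it becomes a bijection tau of the
    tower ([tower_up], with inverse [tower_down]). Haar measure disintegrates
    uniformly over the fibres of A ([fiber_integral]); hence, if the slabs carry
    the weights 1, 1, M, M^2, and so on, preimages under tau have measure
    divided by M ([tower_scale]), and u |-> sqrt M * (u o tau) is unitary. The
    dilation delta is its inverse.

    An element g of Gamma acts by multiplication by z |-> z g on slabs 0 and 1,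
    and by z |-> (A^(n+1) z) g on slab n + 2; the exponents are chosen so that
    the multiplier of g at tau y is the multiplier of [alpha g] at y
    ([tower_char_up]), which is the commutation relation between delta and the
    representation. V_n consists of the functions supported on a set E_n, where
    E_0 is slab 0 and E_n is the preimage of E_(n+1) under tau. For [n >= 0] it
    is the union of the slabs 0, ..., n, so the V_n have a dense union. The
    measure of E_(-n) is M^(-n) times that of slab 0, which is at most c, and
    [M >= 2] because the kernels of the iterates of A are dense
    ([kernel_size_gt1]); so the intersection of the V_n is 0 ([level_cap]). V_0
    and its complement in V_1 are the L^2 spaces of slabs 0 and 1, and
    restricting a function to the layers of a slab is the unitary that exhibits
    the multiplicity functions m and m~ ([slab_unitary]).

    Numbering the layers in a measurable way requires a Borel section of A
    ([adjoint_section]). The measurable maps from the dual group to the unit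
    circle form a divisible group, because n-th roots can be chosen measurably;
    so the homomorphism that sends [alpha h] to the function w |-> w h extends
    to Gamma ([divisible_extension]), and the values at w of its extension form
    a character s w with A (s w) = w. The same extension argument supplies the
    characters that separate the points of Gamma. The invariance of Haar measure
    under A ([haar_adjoint]) comes from Fubini's theorem. *)

Set Implicit Arguments.
Unset Strict Implicit.
Unset Printing Implicit Defensive.
Import Order.TTheory GRing.Theory Num.Theory.
Import numFieldNormedType.Exports.
Local Open Scope classical_set_scope.
Local Open Scope ring_scope.

(** * Complex square-integrable functions *)

Section complex_parts.
Context {R : realType}.
Implicit Types (z y : R[i]) (r : R).

Definition normsq z : R := complex.Re z ^+ 2 + complex.Im z ^+ 2.

Lemma normsq_ge0 z : 0 <= normsq z.
Proof. by rewrite addr_ge0 ?sqr_ge0. Qed.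

Lemma normsqE z : normsq z = (Normc.normc z) ^+ 2.
Proof. by case: z => x y; rewrite sqr_sqrtr // addr_ge0 ?sqr_ge0. Qed.

Lemma normsqC z : (normsq z)%:C%C = `|z| ^+ 2.
Proof. by rewrite add_Re2_Im2. Qed.

Lemma normsqM z y : normsq (z * y) = normsq z * normsq y.
Proof. by case: z y => a b [c d]; rewrite /normsq /=; ring. Qed.

Lemma normsq0 : normsq (0 : R[i]) = 0.
Proof. by rewrite /normsq /= expr0n addr0. Qed.

Lemma normsqr r : normsq (r%:C%C) = r ^+ 2.
Proof. by rewrite /normsq /= expr0n addr0. Qed.

Lemma normsq_eq0 z : normsq z = 0 -> z = 0.
Proof.
case: z => a b /eqP; rewrite /normsq /= paddr_eq0 ?sqr_ge0// !sqrf_eq0.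
by case/andP => /eqP -> /eqP ->.
Qed.

Lemma normsq_unit z : `|z| = 1 -> normsq z = 1.
Proof. by move=> z1; apply: complexI; rewrite normsqC z1 expr1n. Qed.

Lemma normsqD_le z y : normsq (z + y) <= 2 * normsq z + 2 * normsq y.
Proof.
case: z y => a b [c d]; rewrite /normsq /=.
have := sqr_ge0 (a - c); have := sqr_ge0 (b - d).
by rewrite !sqrrB !sqrrD; lra.
Qed.

Lemma ReM z y : complex.Re (z * y) =
  complex.Re z * complex.Re y - complex.Im z * complex.Im y.
Proof. by case: z y => a b [c d]. Qed.

Lemma ImM z y : complex.Im (z * y) =
  complex.Re z * complex.Im y + complex.Im z * complex.Re y.
Proof. by case: z y => a b [c d]. Qed.

Lemma ReD z y : complex.Re (z + y) = complex.Re z + complex.Re y.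
Proof. by case: z y => a b [c d]. Qed.

Lemma ImD z y : complex.Im (z + y) = complex.Im z + complex.Im y.
Proof. by case: z y => a b [c d]. Qed.

Lemma ReN z : complex.Re (- z) = - complex.Re z.
Proof. by case: z. Qed.

Lemma ImN z : complex.Im (- z) = - complex.Im z.
Proof. by case: z. Qed.

Lemma conjCE z : (Num.conj z : R[i]) = conjc z.
Proof. by []. Qed.

Lemma ReJ z : complex.Re (Num.conj z) = complex.Re z.
Proof. by rewrite conjCE; case: z. Qed.

Lemma ImJ z : complex.Im (Num.conj z) = - complex.Im z.
Proof. by rewrite conjCE; case: z. Qed.

Lemma normsqJ z : (normsq z)%:C%C = z * Num.conj z.
Proof. by rewrite normsqC normCK. Qed.

End complex_parts.

Section cmeasurable.
Context d (T : measurableType d) {R : realType}.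
Implicit Types (f g h : T -> R[i]) (D : set T).

(** Measurability of both parts, the form in which [in_l2] states it. *)
Definition cmeasurable D f :=
  measurable_fun D (fun x => complex.Re (f x)) /\
  measurable_fun D (fun x => complex.Im (f x)).

Lemma cmeasurableD D f g : cmeasurable D f -> cmeasurable D g ->
  cmeasurable D (fun x => f x + g x).
Proof.
move=> [f1 f2] [g1 g2]; split.
  by under eq_fun do rewrite ReD; exact: measurable_funD.
by under eq_fun do rewrite ImD; exact: measurable_funD.
Qed.

Lemma cmeasurableM D f g : cmeasurable D f -> cmeasurable D g ->
  cmeasurable D (fun x => f x * g x).
Proof.
move=> [f1 f2] [g1 g2]; split.
  under eq_fun do rewrite ReM.
  by apply: measurable_funB; exact: measurable_funM.
under eq_fun do rewrite ImM.
by apply: measurable_funD; exact: measurable_funM.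
Qed.

Lemma cmeasurableN D f : cmeasurable D f -> cmeasurable D (fun x => - f x).
Proof.
move=> [f1 f2]; split.
  by under eq_fun do rewrite ReN; exact: measurableT_comp.
by under eq_fun do rewrite ImN; exact: measurableT_comp.
Qed.

Lemma cmeasurableJ D f : cmeasurable D f ->
  cmeasurable D (fun x => Num.conj (f x)).
Proof.
move=> [f1 f2]; split; first by under eq_fun do rewrite ReJ.
by under eq_fun do rewrite ImJ; exact: measurableT_comp.
Qed.

Lemma cmeasurable_cst D (z : R[i]) : cmeasurable D (fun=> z).
Proof. by split; exact: measurable_cst. Qed.

Definition cindic (A : set T) (x : T) : R[i] := (\1_A x : R)%:C%C.

Lemma cindicT A x : A x -> cindic A x = 1.
Proof. by move=> Ax; rewrite /cindic indicE mem_set. Qed.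

Lemma cindicF A x : ~ A x -> cindic A x = 0.
Proof. by move=> Ax; rewrite /cindic indicE memNset. Qed.

Lemma normsq_cindic A x : normsq (cindic A x) <= 1.
Proof.
case: (pselect (A x)) => Ax; first by rewrite cindicT// normsqr expr1n.
by rewrite cindicF// normsq0.
Qed.

Lemma cmeasurable_indic D A : measurable A -> cmeasurable D (cindic A).
Proof.
move=> mA; split => /=; last exact: measurable_cst.
exact: measurable_indic.
Qed.

Lemma measurable_normsq D f : cmeasurable D f ->
  measurable_fun D (fun x => normsq (f x)).
Proof. by move=> [f1 f2]; apply: measurable_funD; apply: measurable_funX. Qed.

End cmeasurable.

Lemma cmeasurable_comp d (T : measurableType d) d' (T' : measurableType d')
  {R : realType} (f : T' -> R[i]) (g : T -> T') :
  cmeasurable setT f -> measurable_fun setT g ->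
  cmeasurable setT (fun x => f (g x)).
Proof.
move=> [f1 f2] mg; split.
  exact: (@measurableT_comp _ _ _ _ _ _ (fun x => complex.Re (f x)) setT g).
exact: (@measurableT_comp _ _ _ _ _ _ (fun x => complex.Im (f x)) setT g).
Qed.

Section square_integrable.
Context d (T : measurableType d) {R : realType}.
Variable mu : {measure set T -> \bar R}.
Implicit Types (f g h : T -> R[i]) (D : set T).
Local Open Scope ereal_scope.

Definition nsq f : \bar R := \int[mu]_x (normsq (f x))%:E.

Definition sqint f := cmeasurable setT f /\ nsq f < +oo.

Lemma nsq_ge0 f : 0 <= nsq f.
Proof. by apply: integral_ge0 => x _; rewrite lee_fin normsq_ge0. Qed.

Lemma sqint_fin f : sqint f -> nsq f \is a fin_num.
Proof. by case=> _ fi; rewrite ge0_fin_numE ?nsq_ge0. Qed.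

Lemma measurable_enormsq f D : cmeasurable D f ->
  measurable_fun D (fun x => (normsq (f x))%:E).
Proof. by move=> mf; apply/measurable_EFinP; exact: measurable_normsq. Qed.

Lemma sqint_le f (h : T -> R) : cmeasurable setT f ->
  (forall x, (normsq (f x) <= h x)%R) ->
  measurable_fun setT h -> \int[mu]_x (h x)%:E < +oo -> sqint f.
Proof.
move=> mf fh mh hi; split=> //; apply: le_lt_trans hi.
apply: ge0_le_integral => //=.
- by move=> x _; rewrite lee_fin normsq_ge0.
- exact: measurable_enormsq.
- exact/measurable_EFinP.
- by move=> x _; rewrite lee_fin.
Qed.

Lemma sqint0 : sqint (fun=> 0%R).
Proof.
split; first exact: cmeasurable_cst.
by rewrite /nsq; under eq_integral do rewrite normsq0; rewrite integral0.
Qed.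

Lemma sqintM_bounded (c : R) f g : cmeasurable setT f ->
  (forall x, (normsq (f x) <= c)%R) -> sqint g -> sqint (fun x => (f x * g x)%R).
Proof.
move=> mf fc [mg gi].
apply: (@sqint_le _ (fun x => (c * normsq (g x))%R)).
- exact: cmeasurableM.
- by move=> x; rewrite normsqM ler_wpM2r ?normsq_ge0.
- by apply: measurable_funM => //; exact: measurable_normsq.
case: (pselect (exists x : T, True)) => [[x _]|T0]; last first.
  rewrite (_ : (fun _ => _) = cst 0) ?integral0//.
  by apply/funext => x; exfalso; apply: T0; exists x.
have c0 : (0 <= c)%R by exact: le_trans (normsq_ge0 _) (fc x).
under eq_integral do rewrite EFinM.
rewrite ge0_integralZl_EFin//.
- by rewrite lte_mul_pinfty.
- by move=> ? _; rewrite lee_fin normsq_ge0.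
- exact: measurable_enormsq.
Qed.

Lemma sqintZ (a : R[i]) f : sqint f -> sqint (fun x => (a * f x)%R).
Proof.
by apply: (@sqintM_bounded (normsq a) (fun=> a)) => //; exact: cmeasurable_cst.
Qed.

Lemma sqintD f g : sqint f -> sqint g -> sqint (fun x => (f x + g x)%R).
Proof.
move=> [mf fi] [mg gi].
apply: (@sqint_le _ (fun x => (2 * normsq (f x) + 2 * normsq (g x))%R)).
- exact: cmeasurableD.
- by move=> x; exact: normsqD_le.
- by apply: measurable_funD; apply: measurable_funM => //; exact: measurable_normsq.
under eq_integral do rewrite EFinD !EFinM.
have m2 h : cmeasurable setT h -> measurable_fun setT
    (fun x => 2%:E * (normsq (h x))%:E).
  by move=> mh; apply: measurable_funeM; exact: measurable_enormsq.
rewrite ge0_integralD//.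
- rewrite !ge0_integralZl_EFin//.
  + by rewrite lte_add_pinfty// lte_mul_pinfty.
  + by move=> ? _; rewrite lee_fin normsq_ge0.
  + exact: measurable_enormsq.
  + by move=> ? _; rewrite lee_fin normsq_ge0.
  + exact: measurable_enormsq.
- by move=> x _; rewrite mule_ge0 ?lee_fin ?normsq_ge0.
- exact: m2.
- by move=> x _; rewrite mule_ge0 ?lee_fin ?normsq_ge0.
- exact: m2.
Qed.

Lemma sqintN f : sqint f -> sqint (fun x => (- f x)%R).
Proof. by move=> /(sqintZ (-1)%R); under eq_fun do rewrite mulN1r. Qed.

Lemma sqintB f g : sqint f -> sqint g -> sqint (fun x => (f x - g x)%R).
Proof. by move=> sf /sqintN sg; exact: sqintD. Qed.

Lemma nsq_ae f g : cmeasurable setT f -> cmeasurable setT g ->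
  {ae mu, forall x, f x = g x} -> nsq f = nsq g.
Proof.
move=> mf mg fg; apply: ge0_ae_eq_integral => //.
- exact: measurable_enormsq.
- exact: measurable_enormsq.
- by move=> x _; rewrite lee_fin normsq_ge0.
- by move=> x _; rewrite lee_fin normsq_ge0.
- by apply: filterS fg => x /= -> _.
Qed.

Lemma nsq_eq0 f : cmeasurable setT f -> nsq f = 0 ->
  {ae mu, forall x, f x = 0%R}.
Proof.
move=> mf f0.
have /ae_eq_integral_abs : measurable_fun setT (fun x => (normsq (f x))%:E).
  exact: measurable_enormsq.
move=> /(_ mu measurableT)[+ _].
have -> : \int[mu]_x `|(normsq (f x))%:E| = nsq f.
  by apply: eq_integral => x _; rewrite gee0_abs// lee_fin normsq_ge0.
move=> /(_ f0); apply: filterS => x /= /(_ I) [] /normsq_eq0.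
by [].
Qed.

(** [p] and [q] stand for the real or the imaginary part; integrability comes
    from the bound of 2 |x y| by x^2 + y^2. *)
Lemma sqint_mul_integrable f g (p q : R[i] -> R) : sqint f -> sqint g ->
  measurable_fun setT (p \o f) -> measurable_fun setT (q \o g) ->
  (forall z, (p z ^+ 2 <= normsq z)%R) -> (forall z, (q z ^+ 2 <= normsq z)%R) ->
  mu.-integrable setT (fun x => (p (f x) * q (g x))%:E).
Proof.
move=> sf sg mp mq hp hq; apply/integrableP; split.
  by apply/measurable_EFinP; exact: measurable_funM.
have [_ fi] := sf; have [_ gi] := sg.
have mf : measurable_fun setT (fun x => (normsq (f x))%:E).
  by apply: measurable_enormsq; case: sf.
have mg : measurable_fun setT (fun x => (normsq (g x))%:E).
  by apply: measurable_enormsq; case: sg.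
apply: (@le_lt_trans _ _ (nsq f + nsq g)); last by rewrite lte_add_pinfty.
rewrite /nsq -ge0_integralD//; last 2 first.
- by move=> x _; rewrite lee_fin normsq_ge0.
- by move=> x _; rewrite lee_fin normsq_ge0.
apply: ge0_le_integral => //.
- by apply: measurableT_comp => //; apply/measurable_EFinP; exact: measurable_funM.
- exact: emeasurable_funD.
move=> x _; rewrite -EFinD /= lee_fin.
have h1 := hp (f x); have h2 := hq (g x).
rewrite normrM -(ler_pM2l (ltr0n R 2)).
apply: (@le_trans _ _ (`|p (f x)| ^+ 2 + `|q (g x)| ^+ 2)%R).
  have := sqr_ge0 (`|p (f x)| - `|q (g x)|); rewrite sqrrB; lra.
rewrite !real_normK ?num_real//.
have := normsq_ge0 (f x); have := normsq_ge0 (g x).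
have := normsq_ge0 (f x); lra.
Qed.

End square_integrable.

(** * Complex integrals and the completeness of L^2 *)

(** The increments are at most sqrt C * 2^-n, hence absolutely summable. *)
Lemma cvgn_sqdiff {R : realType} (u : nat -> R) (C : R) :
  (forall n, 4 ^+ n * (u n.+1 - u n) ^+ 2 <= C) -> cvgn u.
Proof.
move=> uC.
have C0 : 0 <= C by apply: le_trans (uC 0%N); rewrite expr0 mul1r sqr_ge0.
have -> : u = (fun n => u 0%N + series (telescope u) n).
  by apply/funext => n; exact: eq_sum_telescope.
apply: is_cvgD; first exact: is_cvg_cst.
apply: normed_cvg.
apply: (@series_le_cvg _ _ (geometric (Num.sqrt C) 2^-1)).
- by move=> n /=.
- by move=> n /=; rewrite mulr_ge0 ?sqrtr_ge0 ?exprn_ge0.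
- move=> n; rewrite /= /telescope.
  rewrite -sqrtr_sqr -[2^-1 ^+ n]ger0_norm ?exprn_ge0// -sqrtr_sqr -sqrtrM//.
  apply: ler_wsqrtr; rewrite exprAC exprVn exprVn -ler_pdivrMr//.
  by rewrite invrK mulrC -natrX; exact: uC.
- by apply: is_cvg_geometric_series; rewrite gtr0_norm ?invr_gt0// invf_lt1// ltr1n.
Qed.

Lemma limn_einf_le {R : realType} (u : (\bar R)^nat) (c : \bar R) N :
  (forall n, (N <= n)%N -> (u n <= c)%E) -> (limn_einf u <= c)%E.
Proof.
move=> uc; rewrite limn_einf_lim; apply: lime_le; first exact: is_cvg_einfs.
apply: nearW => n; apply: (@le_trans _ _ (u (maxn n N))); last first.
  by apply: uc; rewrite leq_maxr.
by apply: ereal_inf_lbound; exists (maxn n N) => //=; rewrite leq_maxl.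
Qed.

Section complex_integral.
Context d (T : measurableType d) {R : realType}.
Variable mu : {measure set T -> \bar R}.
Implicit Types (f g h : T -> R[i]).

Definition cintegrable h :=
  mu.-integrable setT (EFin \o (fun x => complex.Re (h x))) /\
  mu.-integrable setT (EFin \o (fun x => complex.Im (h x))).

Definition cint h : R[i] :=
  Complex (\int[mu]_x complex.Re (h x)) (\int[mu]_x complex.Im (h x)).

Lemma cintP (a : R[i]) f g : cintegrable f -> cintegrable g ->
  cintegrable (fun x => a * f x + g x) /\
  cint (fun x => a * f x + g x) = a * cint f + cint g.
Proof.
move=> [f1 f2] [g1 g2]; case: a => a b.
have Z (c : R) (k : T -> R) : mu.-integrable setT (EFin \o k) ->
    mu.-integrable setT (EFin \o (fun x => c * k x)).
  by move=> ik; apply: eq_integrable (integrableZl measurableT c ik).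
have D (k l : T -> R) : mu.-integrable setT (EFin \o k) ->
    mu.-integrable setT (EFin \o l) ->
    mu.-integrable setT (EFin \o (fun x => k x + l x)).
  by move=> ik il; apply: eq_integrable (integrableD measurableT ik il).
have reE x : complex.Re (Complex a b * f x + g x) =
    a * complex.Re (f x) + (- b) * complex.Im (f x) + complex.Re (g x).
  by case: (f x) (g x) => p q [r s] /=; ring.
have imE x : complex.Im (Complex a b * f x + g x) =
    a * complex.Im (f x) + b * complex.Re (f x) + complex.Im (g x).
  by case: (f x) (g x) => p q [r s] /=; ring.
split; first by split; [under eq_fun do rewrite reE|under eq_fun do rewrite imE];
  apply: (D) => //; apply: (D); exact: Z.
rewrite /cint; under eq_Rintegral do rewrite reE.
under [in X in Complex _ X]eq_Rintegral do rewrite imE.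
rewrite !RintegralD ?RintegralZl//; try by [exact: Z|apply: (D); exact: Z].
by apply/eqP; rewrite eq_complex /=; apply/andP; split; apply/eqP; ring.
Qed.

Lemma cintJ f : cintegrable f ->
  cint (fun x => Num.conj (f x)) = Num.conj (cint f).
Proof.
move=> [f1 f2]; rewrite /cint conjCE /=; congr Complex.
  by apply: eq_Rintegral => x _; rewrite ReJ.
under eq_Rintegral do rewrite ImJ -mulN1r.
by rewrite RintegralZl// mulN1r.
Qed.

Lemma cint_ae f g : cmeasurable setT f -> cmeasurable setT g ->
  {ae mu, forall x, f x = g x} -> cint f = cint g.
Proof.
move=> [f1 f2] [g1 g2] fg; rewrite /cint /Rintegral; congr (Complex (fine _) (fine _)).
- apply: ae_eq_integral => //; [exact/measurable_EFinP|exact/measurable_EFinP|].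
  by apply: filterS fg => x /= -> _.
- apply: ae_eq_integral => //; [exact/measurable_EFinP|exact/measurable_EFinP|].
  by apply: filterS fg => x /= -> _.
Qed.

Lemma cintegrable_mulJ f g : sqint mu f -> sqint mu g ->
  cintegrable (fun x => f x * Num.conj (g x)).
Proof.
move=> sf sg; have [[f1 f2] _] := sf; have [[g1 g2] _] := sg.
have re (z : R[i]) : complex.Re z ^+ 2 <= normsq z by rewrite lerDl sqr_ge0.
have im (z : R[i]) : complex.Im z ^+ 2 <= normsq z by rewrite lerDr sqr_ge0.
split.
  have reE x : complex.Re (f x * Num.conj (g x)) =
    complex.Re (f x) * complex.Re (g x) + complex.Im (f x) * complex.Im (g x).
    by rewrite ReM ReJ ImJ mulrN opprK.
  under eq_fun do rewrite reE.
  have := integrableD measurableT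
    (sqint_mul_integrable sf sg f1 g1 re re) (sqint_mul_integrable sf sg f2 g2 im im).
  by apply: eq_integrable => //.
have imE x : complex.Im (f x * Num.conj (g x)) =
  complex.Im (f x) * complex.Re (g x) - complex.Re (f x) * complex.Im (g x).
  by rewrite ImM ReJ ImJ mulrN addrC.
under eq_fun do rewrite imE.
have := integrableB measurableT
  (sqint_mul_integrable sf sg f2 g1 im re) (sqint_mul_integrable sf sg f1 g2 re im).
by apply: eq_integrable => //.
Qed.

Definition ip f g := cint (fun x => f x * Num.conj (g x)).

Lemma ipP (a : R[i]) f g h : sqint mu f -> sqint mu g -> sqint mu h ->
  ip (fun x => a * f x + g x) h = a * ip f h + ip g h.
Proof.
move=> sf sg sh; rewrite /ip.
have [_ <-] := cintP a (cintegrable_mulJ sf sh) (cintegrable_mulJ sg sh).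
by congr cint; apply/funext => x; rewrite mulrDl mulrA.
Qed.

Lemma ipC f g : sqint mu f -> sqint mu g -> ip g f = Num.conj (ip f g).
Proof.
move=> sf sg; rewrite -cintJ; last exact: cintegrable_mulJ.
by congr cint; apply/funext => x; rewrite rmorphM /= conjCK mulrC.
Qed.

Lemma ip_nsq f : sqint mu f -> ip f f = (fine (nsq mu f))%:C%C.
Proof.
move=> sf; rewrite /ip /cint.
under eq_Rintegral do rewrite -normsqJ /=.
under [in X in Complex _ X]eq_Rintegral do rewrite -normsqJ /=.
by congr Complex; rewrite /Rintegral integral0.
Qed.

Lemma ip_ae f f' g g' : sqint mu f -> sqint mu f' -> sqint mu g -> sqint mu g' ->
  {ae mu, forall x, f x = f' x} -> {ae mu, forall x, g x = g' x} ->
  ip f g = ip f' g'.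
Proof.
move=> [mf _] [mf' _] [mg _] [mg' _] ff gg; apply: cint_ae.
- by apply: cmeasurableM => //; exact: cmeasurableJ.
- by apply: cmeasurableM => //; exact: cmeasurableJ.
by apply: filterS2 ff gg => x -> ->.
Qed.

Local Open Scope ereal_scope.

(** The sum of the 4^n |f (n+1) - f n|^2 has a finite integral, so it is finite
    almost everywhere, and wherever it is finite the sequence converges by
    [cvgn_sqdiff]; Fatou's lemma bounds the distance to the limit. *)
Lemma sqint_complete (f : nat -> T -> R[i]) : (forall n, sqint mu (f n)) ->
  (forall n k, (n <= k)%N ->
    nsq mu (fun x => f k x - f n x)%R <= ((8^-1 : R) ^+ n)%:E) ->
  exists2 g, sqint mu g &
    forall n, nsq mu (fun x => g x - f n x)%R <= ((8^-1 : R) ^+ n)%:E.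
Proof.
move=> sf fC.
pose dq n x : R := (4 ^+ n * normsq (f n.+1 x - f n x))%R.
have sd n k : sqint mu (fun x => f k x - f n x)%R by exact: sqintB.
have mdq n : measurable_fun setT (fun x => (dq n x)%:E).
  apply/measurable_EFinP; apply: measurable_funM => //.
  by apply: measurable_normsq; have [] := sd n n.+1.
have dq0 n x : 0 <= (dq n x)%:E.
  by rewrite lee_fin mulr_ge0 ?normsq_ge0// exprn_ge0.
pose S x := \sum_(n <oo) (dq n x)%:E.
have mS : measurable_fun setT S by exact: ge0_emeasurable_sum.
have S0 x : 0 <= S x by exact: nneseries_ge0.
have Sfin : \int[mu]_x S x < +oo.
  rewrite integral_nneseries//.
  (* 4^n * 8^-n = 2^-n is summable *)
  apply: (@le_lt_trans _ _ (\sum_(n <oo) (2 / (2 ^ (n + 1))%:R)%:E)); last first.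
    have h := @cvg_geometric_eseries_half R 2%R 0%N.
    by rewrite (cvg_lim _ h)// ltry.
  apply: lee_nneseries => [n _ _|n _]; first exact: integral_ge0.
  rewrite /dq; under eq_integral do rewrite EFinM.
  rewrite ge0_integralZl_EFin//; last 2 first.
  - by move=> x _; rewrite lee_fin normsq_ge0.
  - by apply: measurable_enormsq; have [] := sd n n.+1.
  apply: (@le_trans _ _ ((4 ^+ n)%:E * ((8^-1 : R) ^+ n)%:E)).
    by rewrite lee_wpmul2l ?lee_fin ?exprn_ge0//; exact: fC.
  rewrite -EFinM lee_fin -exprMn addn1 expnS natrM invfM mulVKf ?mulrA//.
  rewrite natrX -exprVn (_ : 4 * 8^-1 = 2^-1 :> R)%R; last by field.
  exact: lexx.
have SaeA : {ae mu, forall x, S x < +oo}.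
  have /(integrable_ae measurableT) : mu.-integrable setT S.
    apply/integrableP; split=> //.
    by under eq_integral do rewrite gee0_abs//.
  by apply: filterS => x /= /(_ I); rewrite ge0_fin_numE.
pose A := [set x | S x < +oo].
have mA : measurable A.
  by rewrite -[A]setTI; exact: emeasurable_fun_infty_o.
(* cut off outside A, so that the limit below exists at every point *)
pose h n x := (cindic A x * f n x)%R.
have hA n x : A x -> h n x = f n x.
  by move=> Ax; rewrite /h cindicT// mul1r.
have hNA n x : ~ A x -> h n x = 0%R.
  by move=> Ax; rewrite /h cindicF// mul0r.
have mh n : cmeasurable setT (h n).
  by apply: cmeasurableM; [exact: cmeasurable_indic|have [] := sf n].
have hdC x : exists C : R, forall n, (4 ^+ n * normsq (h n.+1 x - h n x) <= C)%R.
  case: (pselect (A x)) => Ax; last first.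
    by exists 0%R => n; rewrite !hNA// subrr normsq0 mulr0.
  exists (fine (S x)) => n; rewrite !hA// -lee_fin fineK ?ge0_fin_numE//.
  apply: le_trans (nneseries_lim_ge n.+1 (fun k _ _ => dq0 k x)).
  by rewrite big_nat_recr//= leeDr// sume_ge0.
have cRe x : cvgn (fun n => complex.Re (h n x)).
  have [C hC] := hdC x; apply: (@cvgn_sqdiff _ _ C) => n.
  apply: le_trans (hC n); rewrite ler_wpM2l ?exprn_ge0//.
  by rewrite /normsq ReD ReN lerDl sqr_ge0.
have cIm x : cvgn (fun n => complex.Im (h n x)).
  have [C hC] := hdC x; apply: (@cvgn_sqdiff _ _ C) => n.
  apply: le_trans (hC n); rewrite ler_wpM2l ?exprn_ge0//.
  by rewrite /normsq ImD ImN lerDr sqr_ge0.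
pose g x := Complex (limn (fun n => complex.Re (h n x)))
  (limn (fun n => complex.Im (h n x))).
have mg : cmeasurable setT g.
  split.
    apply: (@measurable_fun_cvg _ _ _ _ (fun n x => complex.Re (h n x))) => //.
    by move=> n; have [] := mh n.
  apply: (@measurable_fun_cvg _ _ _ _ (fun n x => complex.Im (h n x))) => //.
  by move=> n; have [] := mh n.
have gE n : nsq mu (fun x => g x - f n x)%R = nsq mu (fun x => g x - h n x)%R.
  apply: nsq_ae.
  - by apply: cmeasurableD => //; apply: cmeasurableN; have [] := sf n.
  - by apply: cmeasurableD => //; apply: cmeasurableN.
  by apply: filterS SaeA => x Ax; rewrite hA.
have gn n : nsq mu (fun x => g x - f n x)%R <= ((8^-1 : R) ^+ n)%:E.
  rewrite gE /nsq.
  have -> : (fun x => (normsq (g x - h n x))%:E) =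
      (fun x => limn_einf (fun k => (normsq (h k x - h n x))%:E)).
    apply/funext => x; apply/esym.
    apply: (fun u l (c : u @ \oo --> l) => (cvg_limn_einf_sup c).1).
    apply: cvg_EFin; first exact: nearW.
    rewrite /comp /= /normsq.
    under eq_fun do rewrite ReD ReN ImD ImN.
    rewrite ReD ReN ImD ImN.
    apply: cvgD; under eq_fun do rewrite expr2; rewrite expr2;
      by apply: cvgM; (apply: cvgB; [|exact: cvg_cst]).
  have mk k : measurable_fun setT (fun x => (normsq (h k x - h n x))%:E).
    by apply: measurable_enormsq; apply: cmeasurableD => //; exact: cmeasurableN.
  apply: le_trans (fatou _ _ _ _) _ => //.
    by move=> k x _; rewrite lee_fin normsq_ge0.
  apply: (@limn_einf_le _ _ _ n) => k nk; apply: le_trans (fC _ _ nk).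
  apply: ge0_le_integral => //.
  - by move=> x _; rewrite lee_fin normsq_ge0.
  - by apply: measurable_enormsq; have [] := sd n k.
  move=> x _; rewrite lee_fin; case: (pselect (A x)) => Ax.
    by rewrite !hA.
  by rewrite !hNA// subrr normsq0 normsq_ge0.
exists g => //.
have : sqint mu (fun x => g x - f 0%N x)%R.
  split; first by apply: cmeasurableD => //; apply: cmeasurableN; have [] := sf 0%N.
  by apply: le_lt_trans (gn 0%N) _; rewrite ltry.
move=> /sqintD /(_ (sf 0%N)); congr sqint.
by apply/funext => x; rewrite subrK.
Qed.

End complex_integral.

(** * The Hilbert space L^2 *)

Lemma exists_half_lt {R : realType} (e : R) : 0 < e -> exists n, 2^-1 ^+ n < e.
Proof.
move=> e0; have /filter_ex[n] := near_infty_natSinv_expn_lt (PosNum e0).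
by rewrite /= mul1r -exprVn => hn; exists n.
Qed.

Section dot_norm.
Context {R : realType} (V : lmodType R[i]) (f : {dot V for (@Num.conj R[i])}).
Implicit Types u v : V.

(** The norm in [R], where it can be compared and approximated; the norm of a
    [hilbert] takes its values in [R[i]]. *)
Definition dnormr u : R := Num.sqrt (complex.Re (f u u)).

Lemma dot_ge0 u : 0 <= complex.Re (f u u) /\ complex.Im (f u u) = 0.
Proof.
have := @dnorm_ge0 _ _ f u; rewrite lecE => /andP[/eqP/= -> ->].
by [].
Qed.

Lemma dnormr_ge0 u : 0 <= dnormr u. Proof. exact: sqrtr_ge0. Qed.

Lemma dnormr_sqr u : dnormr u ^+ 2 = complex.Re (f u u).
Proof. by rewrite sqr_sqrtr//; have [] := dot_ge0 u. Qed.

Lemma dot_dnormr u : f u u = (dnormr u ^+ 2)%:C%C.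
Proof.
rewrite dnormr_sqr; have [_] := dot_ge0 u.
by case: (f u u) => a b /= ->.
Qed.

Lemma dnormr0_eq0 u : dnormr u = 0 -> u = 0.
Proof.
move=> u0; apply/eqP; rewrite -(@dnorm_eq0 _ _ f) dot_dnormr u0.
by rewrite expr0n.
Qed.

Lemma dnormrD_sqr u v :
  dnormr (u + v) ^+ 2 = dnormr u ^+ 2 + dnormr v ^+ 2 + 2 * complex.Re (f u v).
Proof.
rewrite !dnormr_sqr dnormD !ReD ReJ; ring.
Qed.

Lemma dnormrZ a u : dnormr (a *: u) ^+ 2 = normsq a * dnormr u ^+ 2.
Proof.
apply: complexI; rewrite -dot_dnormr dnormZ rmorphM /= normsqC -dot_dnormr.
by [].
Qed.

(** Cauchy-Schwarz, from the nonnegativity of the squared norm of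
    N v * u - N u * v. *)
Lemma Re_dot_le u v : complex.Re (f u v) <= dnormr u * dnormr v.
Proof.
have [u0|u0] := eqVneq (dnormr u) 0.
  by rewrite (dnormr0_eq0 u0) linear0l /= mulr_ge0 ?dnormr_ge0.
have [v0|v0] := eqVneq (dnormr v) 0.
  by rewrite (dnormr0_eq0 v0) linear0r /= mulr_ge0 ?dnormr_ge0.
have := sqr_ge0 (dnormr ((dnormr v)%:C%C *: u + (- dnormr u)%:C%C *: v)).
rewrite dnormrD_sqr !dnormrZ !normsqr sqrrN.
have -> : complex.Re (f ((dnormr v)%:C%C *: u) ((- dnormr u)%:C%C *: v)) =
    - (dnormr u * dnormr v * complex.Re (f u v)).
  rewrite linearZl_LR linearZr_LR /= conjCE; case: (f u v) => a b /=; ring.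
have uv : 0 < dnormr u * dnormr v.
  by rewrite mulr_gt0 // lt_neqAle eq_sym dnormr_ge0 ?u0 ?v0.
move=> h; rewrite -(ler_pM2l uv).
lra.
Qed.

Lemma dnormrD u v : dnormr (u + v) <= dnormr u + dnormr v.
Proof.
rewrite -ler_sqr ?nnegrE ?addr_ge0 ?dnormr_ge0// dnormrD_sqr.
have := Re_dot_le u v; rewrite sqrrD; lra.
Qed.

End dot_norm.

Section l2_space.
Context d (T : measurableType d) {R : realType}.
Variable mu : {measure set T -> \bar R}.
Implicit Types (f g h : T -> R[i]).

(** Elements of L^2 are the classes themselves, as sets of functions, so that
    almost everywhere equality becomes Leibniz equality. *)
Definition l2class f : set (T -> R[i]) :=
  [set g | sqint mu g /\ {ae mu, forall x, f x = g x}].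

Record l2space := L2space {
  l2space_set : set (T -> R[i]);
  l2spaceP : exists2 f, sqint mu f & l2space_set = l2class f }.

HB.instance Definition _ := gen_eqMixin l2space.
HB.instance Definition _ := gen_choiceMixin l2space.

(** Totality matters: the operations on classes are defined by applying [lp]
    to pointwise operations on representatives. *)
Definition lp f : l2space :=
  match pselect (sqint mu f) with
  | left sf => L2space (ex_intro2 _ _ f sf erefl)
  | right _ => L2space (ex_intro2 _ _ (fun=> 0) (sqint0 mu) erefl)
  end.

(** A representative picked by choice, determined only up to a null set. *)
Definition rp (u : l2space) : T -> R[i] := sval (cid2 (l2spaceP u)).

Lemma rp_sqint u : sqint mu (rp u).
Proof. by rewrite /rp; case: cid2. Qed.

Lemma l2space_eq u v : l2space_set u = l2space_set v -> u = v.
Proof.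
case: u v => [A hA] [B hB] /= AB; case: _ / AB in hB *.
by congr L2space; exact: Prop_irrelevance.
Qed.

Lemma ae_eqC f g : {ae mu, forall x, f x = g x} -> {ae mu, forall x, g x = f x}.
Proof. by apply: filterS => x ->. Qed.

Lemma lp_eq f g : sqint mu f -> sqint mu g ->
  {ae mu, forall x, f x = g x} -> lp f = lp g.
Proof.
move=> sf sg fg; apply: l2space_eq.
rewrite /lp; case: pselect => // {}sf; case: pselect => // {}sg /=.
apply/seteqP; split => h [sh]; rewrite /l2class /=.
  by move=> fh; split=> //; apply: filterS2 fg fh => x -> ->.
by move=> gh; split=> //; apply: filterS2 fg gh => x -> ->.
Qed.

Lemma rpK : cancel rp lp.
Proof.
move=> u; apply: l2space_eq; rewrite /rp; case: cid2 => f sf /= ->.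
by rewrite /lp; case: pselect.
Qed.

Lemma lpK f : sqint mu f -> {ae mu, forall x, rp (lp f) x = f x}.
Proof.
move=> sf; rewrite /rp; case: cid2 => g sg /=.
rewrite /lp; case: pselect => // {}sf /= fg.
have : l2class g f by rewrite -fg; split=> //; exact: aeW.
by case.
Qed.

Lemma l2_eqP u v : u = v <-> {ae mu, forall x, rp u x = rp v x}.
Proof.
split=> [->|uv]; first exact: aeW.
by rewrite -[u]rpK -[v]rpK; apply: lp_eq => //; exact: rp_sqint.
Qed.

Definition l2add u v := lp (fun x => rp u x + rp v x).
Definition l2opp u := lp (fun x => - rp u x).
Definition l2scale (a : R[i]) u := lp (fun x => a * rp u x).

Lemma lpD f g : sqint mu f -> sqint mu g ->
  l2add (lp f) (lp g) = lp (fun x => f x + g x).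
Proof.
move=> sf sg; apply: lp_eq; [by apply: sqintD; exact: rp_sqint|exact: sqintD|].
by apply: filterS2 (lpK sf) (lpK sg) => x -> ->.
Qed.

Lemma lpN f : sqint mu f -> l2opp (lp f) = lp (fun x => - f x).
Proof.
move=> sf; apply: lp_eq; [by apply: sqintN; exact: rp_sqint|exact: sqintN|].
by apply: filterS (lpK sf) => x ->.
Qed.

Lemma lpZ a f : sqint mu f -> l2scale a (lp f) = lp (fun x => a * f x).
Proof.
move=> sf; apply: lp_eq; [by apply: sqintZ; exact: rp_sqint|exact: sqintZ|].
by apply: filterS (lpK sf) => x ->.
Qed.

Let S := rp_sqint.

Lemma l2addA : associative l2add.
Proof.
move=> u v w; rewrite -[u]rpK -[v]rpK -[w]rpK.
rewrite !lpD; try by [exact: S|apply: sqintD; exact: S].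
by congr lp; apply/funext => x; rewrite addrA.
Qed.

Lemma l2addC : commutative l2add.
Proof.
move=> u v; rewrite -[u]rpK -[v]rpK !lpD; try exact: S.
by congr lp; apply/funext => x; rewrite addrC.
Qed.

Lemma l2add0 : left_id (lp (fun=> 0)) l2add.
Proof.
move=> u; rewrite -[u]rpK lpD; [|exact: sqint0|exact: S].
by congr lp; apply/funext => x; rewrite add0r.
Qed.

Lemma l2addN : left_inverse (lp (fun=> 0)) l2opp l2add.
Proof.
move=> u; rewrite -[u]rpK lpN ?lpD; try by [exact: S|apply: sqintN; exact: S].
by congr lp; apply/funext => x; rewrite addNr.
Qed.

HB.instance Definition _ := GRing.isZmodule.Build l2space l2addA l2addC l2add0 l2addN.

Lemma l2scaleA a b v : l2scale a (l2scale b v) = l2scale (a * b) v.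
Proof.
rewrite -[v]rpK !lpZ; try by [exact: S|apply: sqintZ; exact: S].
by congr lp; apply/funext => x; rewrite mulrA.
Qed.

Lemma l2scale1 : left_id 1 l2scale.
Proof.
move=> u; rewrite -[u]rpK lpZ; last exact: S.
by congr lp; apply/funext => x; rewrite mul1r.
Qed.

Lemma l2scaleDr : right_distributive l2scale +%R.
Proof.
move=> a u v; rewrite -[u]rpK -[v]rpK /GRing.add /=.
rewrite ?(lpD, lpZ); try by [exact: S|apply: sqintZ; exact: S|apply: sqintD; exact: S].
by congr lp; apply/funext => x; rewrite mulrDr.
Qed.

Lemma l2scaleDl v : {morph l2scale^~ v : a b / a + b}.
Proof.
move=> a b; rewrite -[v]rpK [in RHS]/GRing.add /=.
rewrite ?(lpD, lpZ); try by [exact: S|apply: sqintZ; exact: S|apply: sqintD; exact: S].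
by congr lp; apply/funext => x; rewrite mulrDl.
Qed.

HB.instance Definition _ := GRing.Zmodule_isLmodule.Build R[i] l2space
  l2scaleA l2scale1 l2scaleDr l2scaleDl.

Lemma lp0 : lp (fun=> 0) = 0. Proof. by []. Qed.

Lemma lpP a f g : sqint mu f -> sqint mu g ->
  a *: lp f + lp g = lp (fun x => a * f x + g x).
Proof.
by move=> sf sg; rewrite /GRing.scale /= /GRing.add /= lpZ// lpD//; exact: sqintZ.
Qed.

Lemma rpP a u v : {ae mu, forall x, rp (a *: u + v) x = a * rp u x + rp v x}.
Proof.
have := lpK (sqintD (sqintZ a (S u)) (S v)).
by rewrite -(lpP a (S u) (S v)) !rpK.
Qed.

Lemma rp0 : {ae mu, forall x, rp 0 x = 0}.
Proof. by rewrite -lp0; apply: lpK; exact: sqint0. Qed.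

Lemma rpB u v : {ae mu, forall x, rp (u - v) x = rp u x - rp v x}.
Proof.
have := rpP (-1) v u; rewrite scaleN1r addrC; apply: filterS => x ->.
by rewrite mulN1r addrC.
Qed.

Definition l2dot (u v : l2space) : R[i] := ip mu (rp u) (rp v).

Lemma l2dotC u v : l2dot u v = (-1) ^+ false * Num.conj (l2dot v u).
Proof. by rewrite expr0 mul1r; apply: ipC; exact: S. Qed.

Lemma l2dotPl a u v w : l2dot (a *: u + v) w = a * l2dot u w + l2dot v w.
Proof.
rewrite /l2dot -ipP; try exact: S.
apply: ip_ae; try exact: S; last exact: aeW; last exact: rpP.
by apply: sqintD; [apply: sqintZ|]; exact: S.
Qed.

Lemma l2dot_bilinear :
  bilinear_for *%R (GRing.Scale.Law.clone _ _ (Num.conj \; *%R) _) l2dot.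
Proof.
split=> [w|w] a u v /=; first exact: l2dotPl.
rewrite l2dotC l2dotPl expr0 mul1r rmorphD rmorphM /=.
by rewrite [l2dot w u]l2dotC [l2dot w v]l2dotC !expr0 !mul1r.
Qed.

HB.instance Definition _ := bilinear_isBilinear.Build R[i] l2space l2space R[i]
  *%R (Num.conj \; *%R) l2dot l2dot_bilinear.
HB.instance Definition _ := isHermitianSesquilinear.Build R[i] l2space false
  Num.conj l2dot l2dotC.

Lemma l2dot_gt0 u : u != 0 -> 0 < l2dot u u.
Proof.
move=> u0; rewrite /l2dot ip_nsq; last exact: S.
rewrite (_ : 0 = 0%:C%C)// ltcR lt_neqAle fine_ge0 ?nsq_ge0// andbT.
apply: contra u0 => /eqP u0; apply/eqP/l2_eqP.
have /nsq_eq0 : nsq mu (rp u) = 0%E.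
  by rewrite -[LHS]fineK -?u0//; exact: sqint_fin (S u).
move=> /(_ (S u).1) h; apply: filterS2 h rp0 => x -> ->.
by [].
Qed.

HB.instance Definition _ := isDotProduct.Build R[i] l2space l2dot l2dot_gt0.

End l2_space.

Section l2_norm.
Context d (T : measurableType d) {R : realType}.
Variable mu : {measure set T -> \bar R}.
Local Notation l2space := (l2space mu).
Local Notation N := (dnormr (l2dot (mu:=mu))).
Implicit Types u v : l2space.

Lemma dnormr_nsq u : (N u ^+ 2)%:E = nsq mu (rp u).
Proof.
rewrite dnormr_sqr -[X in complex.Re X]/(ip mu (rp u) (rp u)).
rewrite ip_nsq; last exact: rp_sqint.
by rewrite fineK//; apply: sqint_fin; exact: rp_sqint.
Qed.

Definition l2norm u : R[i] := (N u)%:C%C.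

Lemma l2normD u v : l2norm (u + v) <= l2norm u + l2norm v.
Proof. by rewrite /l2norm -rmorphD lecR dnormrD. Qed.

Lemma l2normZ a u : l2norm (a *: u) = `|a| * l2norm u.
Proof.
apply/eqP; rewrite -(@eqrXn2 _ 2)//; last 2 first.
- by rewrite ler0c dnormr_ge0.
- by rewrite mulr_ge0 // ler0c dnormr_ge0.
by rewrite exprMn -normsqC -!rmorphXn -rmorphM /= dnormrZ.
Qed.

Lemma l2norm0_eq0 u : l2norm u = 0 -> u = 0.
Proof. by move=> /complexI /dnormr0_eq0. Qed.

HB.instance Definition _ := Lmodule_isNormed.Build R[i] l2space
  l2normD l2normZ l2norm0_eq0.

Lemma l2_normE u : `|u| = (N u)%:C%C. Proof. by []. Qed.

Lemma nsqB u v : nsq mu (fun x => rp u x - rp v x) = (N (u - v) ^+ 2)%:E.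
Proof.
rewrite dnormr_nsq; apply: nsq_ae.
- by have [] := sqintB (rp_sqint u) (rp_sqint v).
- by have [] := rp_sqint (u - v).
by apply: filterS (rpB u v) => x ->.
Qed.

(** A Cauchy filter charges balls of radius 4^-n / 2; their centres form a
    sequence to which [sqint_complete] applies, and its limit is that of the
    filter. *)
Lemma l2_complete (F : set_system l2space) : ProperFilter F -> cauchy F -> cvg F.
Proof.
move=> FF /cauchyP Fc.
pose r n : R := 2^-1 * 4^-1 ^+ n.
have half2 (x : R) : x = 2^-1 * x + 2^-1 * x by lra.
have r0 n : 0 < r n by rewrite mulr_gt0 ?exprn_gt0// invr_gt0.
have hr n : exists u, F (ball u (r n)%:C%C) by apply: Fc; rewrite ltcR.
pose u n := sval (cid (hr n)).
have Fu n : F (ball (u n) (r n)%:C%C) by rewrite /u; case: cid.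
have ballN x y e : ball x e%:C%C y -> N (x - y) < e.
  by rewrite -ball_normE /ball_ /= l2_normE ltcR.
have uC n k : (n <= k)%N -> N (u k - u n) <= 4^-1 ^+ n.
  move=> nk; have /filter_ex[x [/ballN h1 /ballN h2]] :
    F (ball (u n) (r n)%:C%C `&` ball (u k) (r k)%:C%C) by exact: filterI.
  rewrite (_ : u k - u n = (u k - x) + - (u n - x)); last by rewrite opprB addrA subrK.
  apply: le_trans (dnormrD _ _ _) _.
  rewrite [X in _ + X](_ : _ = N (u n - x)); last first.
    by rewrite /dnormr hnormN.
  have rk : r k <= r n.
    by rewrite /r ler_pM2l ?invr_gt0// ler_wiXn2l ?invr_ge0// invf_le1// ler1n.
  apply: le_trans (lerD (ltW h2) (ltW h1)) _.
  rewrite (_ : 4^-1 ^+ n = r n + r n); first by rewrite lerD2r.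
  exact: half2.
have [|n k nk|g sg hg] := @sqint_complete _ _ _ mu (fun n => rp (u n)).
- by move=> n; exact: rp_sqint.
- rewrite nsqB lee_fin.
  apply: (@le_trans _ _ ((4^-1 ^+ n) ^+ 2)).
    by rewrite ler_sqr ?nnegrE ?dnormr_ge0 ?exprn_ge0 ?invr_ge0//; exact: uC.
  rewrite exprAC lerXn2r ?nnegrE ?exprn_ge0 ?invr_ge0//.
  lra.
have hgN n : N (lp mu g - u n) <= 2^-1 ^+ n.
  rewrite -ler_sqr ?nnegrE ?dnormr_ge0 ?exprn_ge0 ?invr_ge0// -lee_fin.
  rewrite -nsqB; apply: (@le_trans _ _ (nsq mu (fun x => g x - rp (u n) x))).
    rewrite (@nsq_ae _ _ _ _ _ (fun x => g x - rp (u n) x))//.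
    - by have [] := sqintB (rp_sqint (lp mu g)) (rp_sqint (u n)).
    - by have [] := sqintB sg (rp_sqint (u n)).
    by apply: filterS (lpK sg) => x ->.
  apply: le_trans (hg n) _; rewrite lee_fin exprAC lerXn2r ?nnegrE ?exprn_ge0 ?invr_ge0//.
  lra.
apply/cvg_ex; exists (lp mu g); apply/cvg_ballP => e e0.
have eR : e = (complex.Re e)%:C%C by rewrite RRe_real// gtr0_real.
have e0' : 0 < complex.Re e by rewrite -ltcR -eR.
have [n hn] : exists n, (2^-1 : R) ^+ n < complex.Re e / 2.
  by apply: exists_half_lt; rewrite divr_gt0.
apply: filterS (Fu n) => y /ballN h.
rewrite eR -ball_normE /ball_ /= l2_normE ltcR.
rewrite (_ : _ - y = (lp mu g - u n) + (u n - y)); last by rewrite addrA subrK.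
apply: le_lt_trans (dnormrD _ _ _) _.
have rn : r n <= 2^-1 ^+ n.
  apply: (@le_trans _ _ (4^-1 ^+ n)).
    by rewrite /r ler_piMl ?exprn_ge0 ?invr_ge0// invf_le1// ler1n.
  by rewrite lerXn2r ?nnegrE ?invr_ge0// lef_pV2 ?posrE// ler_nat.
rewrite [ltRHS]splitr ltrD//; first exact: le_lt_trans (hgN n) hn.
exact: lt_trans h (le_lt_trans rn hn).
Qed.

HB.instance Definition _ := Uniform_isComplete.Build l2space l2_complete.

Lemma l2_dotE u : l2dot u u = `|u| ^+ 2.
Proof.
by rewrite l2_normE -rmorphXn; exact: (dot_dnormr (l2dot (mu:=mu)) u).
Qed.

Definition l2hilbert : hilbert R := @Hilbert R l2space (l2dot (mu:=mu)) l2_dotE.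

End l2_norm.

(** * Orthogonality, density and separability in Hilbert spaces *)

Section hilbert_geometry.
Context {R : realType} (H : hilbert R).
Local Notation N := (dnormr (hdot H)).
Implicit Types (u v w : H) (S : set H).

Lemma hnormE v : `|v| = (N v)%:C%C.
Proof.
apply/eqP; rewrite -(@eqrXn2 _ 2)//; last by rewrite ler0c dnormr_ge0.
by rewrite -hdotE dot_dnormr rmorphXn.
Qed.

Lemma hballE u (e : R) v : ball u e%:C%C v <-> N (u - v) < e.
Proof. by rewrite -ball_normE /ball_ /= hnormE ltcR. Qed.

Lemma gt0_real (e : R[i]) : 0 < e -> exists2 r : R, 0 < r & e = r%:C%C.
Proof.
move=> e0; have eE : e = (complex.Re e)%:C%C by rewrite RRe_real// gtr0_real.
by exists (complex.Re e) => //; rewrite -ltcR -eE.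
Qed.

Lemma dnormrN u : N (- u) = N u.
Proof. by rewrite /dnormr hnormN. Qed.

Lemma dnormr_distC u v : N (u - v) = N (v - u).
Proof. by rewrite -dnormrN opprB. Qed.

Lemma dnormr_triangle u v w : N (u - w) <= N (u - v) + N (v - w).
Proof. by rewrite -[u - w](subrKA v); exact: dnormrD. Qed.

Lemma dense_approx S :
  (forall u (e : R), 0 < e -> exists2 v, S v & N (u - v) < e) -> dense S.
Proof.
move=> hS O [u Ou] oO.
have /nbhs_ballP[e /= /gt0_real[r r0 ->] sub] : nbhs u O by exact: open_nbhs_nbhs.
by have [v Sv uv] := hS u r r0; exists v; split=> //; apply: sub; apply/hballE.
Qed.

(** A small step from v along - <v, w> w decreases the norm unless <v, w> = 0. *)
Lemma orth_shift_eq0 v w : (forall t : R[i], N v ^+ 2 <= N (v + t *: w) ^+ 2) ->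
  hdot H v w = 0.
Proof.
move=> h; set c := hdot H v w; apply: normsq_eq0; apply/eqP.
rewrite eq_le normsq_ge0 andbT.
set b := N w ^+ 2; have b0 : 0 <= b by exact: sqr_ge0.
have b1 : 0 < b + 1 by rewrite ltr_wpDl.
(* the best t is - c / b; b + 1 avoids the case b = 0 and is good enough *)
have := h (- (b + 1)^-1%:C%C * c).
rewrite dnormrD_sqr dnormrZ normsqM -/b.
have -> : complex.Re (hdot H v ((- (b + 1)^-1%:C%C * c) *: w)) =
    - ((b + 1)^-1 * normsq c).
  rewrite linearZr_LR /= -/c conjCE.
  by case: c => p q; rewrite /normsq /=; ring.
have -> : normsq (- (b + 1)^-1%:C%C : R[i]) = (b + 1)^-1 ^+ 2.
  by rewrite /normsq /= oppr0 expr0n addr0 sqrrN.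
set n := normsq c; set i := (b + 1)^-1 => hi.
have i0 : 0 < i by rewrite invr_gt0.
have ib : i * (b + 1) = 1 by rewrite mulVf// gt_eqF.
have hi2 : 0 <= i * n * (i * b - 2) by lra.
have hib : i * b - 2 < 0 by lra.
have : i * n <= 0.
  by rewrite leNgt; apply/negP => hin; move: hi2; rewrite leNgt nmulr_llt0// hin.
by rewrite pmulr_rle0.
Qed.

(** Dot products are continuous, by Cauchy-Schwarz: a point u of the set at
    distance less than |<v, w>|^2 / N (<v, w> w) from v would give
    |<v, w>|^2 < |<v, w>|^2. *)
Lemma closed_orth S : closed [set v : H | forall w, S w -> hdot H v w = 0].
Proof.
move=> v clv /= w Sw; apply: normsq_eq0; apply/eqP.
rewrite eq_le normsq_ge0 andbT leNgt; apply/negP => c0.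
set c := hdot H v w in c0 *.
have [w0|w0] := eqVneq (N w) 0.
  by move: c0; rewrite /c (dnormr0_eq0 w0) linear0r normsq0 ltxx.
have {}w0 : 0 < N w by rewrite lt_neqAle eq_sym w0 dnormr_ge0.
have nc0 : 0 < N (c *: w).
  by rewrite -(ltr_pXn2r (ltn0Sn 1)) ?nnegrE ?dnormr_ge0// expr0n dnormrZ mulr_gt0// exprn_gt0.
have e0 : 0 < normsq c / N (c *: w) by rewrite divr_gt0.
have [|u [/= uS /hballE uv]] := clv (ball v (normsq c / N (c *: w))%:C%C).
  by apply: nbhsx_ballx; rewrite ltcR.
have : complex.Re (hdot H (v - u) (c *: w)) <= N (v - u) * N (c *: w).
  exact: Re_dot_le.
rewrite linearBl /= !linearZr_LR /= (uS _ Sw) mulr0 subr0 -/c mulrC -normsqJ /=.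
by rewrite leNgt -ltr_pdivlMr// uv.
Qed.

Lemma parallelogram u v : N (u - v) ^+ 2 =
  2 * N u ^+ 2 + 2 * N v ^+ 2 - N (u + v) ^+ 2.
Proof. by rewrite !dnormrD_sqr dnormrN linearNr /= ReN; ring. Qed.

(** Best approximation: were [x] at distance [D > 0] from the subspace, a
    minimizing sequence would converge, and the error vector would be
    orthogonal to the subspace. *)
Lemma dense_orth S : S 0 -> (forall (a : R[i]) u v, S u -> S v -> S (a *: u + v)) ->
  (forall v, (forall w, S w -> hdot H v w = 0) -> v = 0) -> dense S.
Proof.
move=> S0 SP Sorth; apply: dense_approx => x e e0.
apply: contrapT => /forall2NP hx.
have {}hx s : S s -> e <= N (x - s).
  by move=> Ss; case: (hx s) => [/(_ Ss)//|/negP]; rewrite -leNgt.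
pose A := [set N (x - s) | s in S]; pose D := inf A.
have hA : has_inf A.
  split; first by exists (N (x - 0)); exists 0.
  by exists e => _ [s Ss <-]; exact: hx.
have DS s : S s -> D <= N (x - s) by move=> Ss; apply: ge_inf; [exact: hA.2|exists s].
have eD : e <= D by apply: lb_le_inf; [exact: hA.1|move=> _ [s Ss <-]; exact: hx].
have D0 : 0 < D by exact: lt_le_trans eD.
have hs n : exists s, S s /\ N (x - s) < D + 2^-1 ^+ n.
  have p : 0 < (2^-1 : R) ^+ n by rewrite exprn_gt0// invr_gt0.
  have [_ [s Ss <-] ?] := inf_adherent p hA.
  by exists s.
pose s n := sval (cid (hs n)).
have Ss n : S (s n) by rewrite /s; case: cid => ? [].
have xs n : N (x - s n) < D + 2^-1 ^+ n by rewrite /s; case: cid => ? [].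
have hexp (n k : nat) : (n <= k)%N -> (2^-1 : R) ^+ k <= 2^-1 ^+ n.
  by move=> nk; rewrite ler_wiXn2l ?invr_ge0// invf_le1// ler1n.
have exp1 n : (2^-1 : R) ^+ n <= 1 by exact: (hexp 0%N).
have expge0 n : 0 <= (2^-1 : R) ^+ n by rewrite exprn_ge0// invr_ge0.
have ss n k : (n <= k)%N -> N (s n - s k) ^+ 2 <= 4 * (2 * D + 1) * 2^-1 ^+ n.
  move=> nk; rewrite dnormr_distC.
  have -> : s k - s n = (x - s n) - (x - s k).
    by rewrite opprB [RHS]addrC subrKA.
  rewrite parallelogram.
  have -> : x - s n + (x - s k) = 2 *: (x - (2^-1 *: s n + 2^-1 *: s k)).
    rewrite scalerBr scalerDr !scalerA divff ?pnatr_eq0// !scale1r.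
    by rewrite scaler_nat mulr2n opprD addrACA.
  have mid : D <= N (x - (2^-1 *: s n + 2^-1 *: s k)).
    by apply: DS; apply: (SP) => //; rewrite -[_ *: _]addr0; apply: (SP).
  have {}mid : D ^+ 2 <= N (x - (2^-1 *: s n + 2^-1 *: s k)) ^+ 2.
    by rewrite ler_sqr ?nnegrE ?dnormr_ge0// ltW.
  rewrite dnormrZ (_ : normsq (2 : R[i]) = 4); last first.
    by rewrite (_ : 2 = 2%:C%C) ?normsqr ?rmorph_nat// -natrX.
  set p := 2^-1 ^+ n; have p0 := expge0 n; have p1 := exp1 n.
  have sq a : 0 <= a -> a < D + p -> a ^+ 2 <= (D + p) ^+ 2.
    by move=> a0 ap; rewrite ler_sqr ?nnegrE ?addr_ge0 ?(ltW D0)// ltW.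
  have h1 := sq _ (dnormr_ge0 _ _) (xs n).
  have h2 : N (x - s k) ^+ 2 <= (D + p) ^+ 2.
    by apply: sq; [exact: dnormr_ge0|apply: lt_le_trans (xs k) _; rewrite lerD2l hexp].
  have h3 : p ^+ 2 <= p by rewrite expr2 ler_piMr.
  move: h1 h2 mid h3; rewrite sqrrD -/p; clear; lra.
have cs : cauchy (s @ \oo).
  apply/cauchyP => _ /gt0_real[r r0 ->].
  have c0 : 0 < 4 * (2 * D + 1) by lra.
  have [n hn] : exists n, 2^-1 ^+ n < r ^+ 2 / (4 * (2 * D + 1)).
    by apply: exists_half_lt; rewrite divr_gt0// exprn_gt0.
  exists (s n); exists n => // k /= nk; apply/hballE.
  rewrite -(ltr_pXn2r (ltn0Sn 1)) ?nnegrE ?dnormr_ge0 ?(ltW r0)//.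
  by apply: le_lt_trans (ss n k nk) _; rewrite mulrC -ltr_pdivlMr.
have /cvg_ex[l /= sl] : cvg (s @ \oo) by exact: cauchy_cvg.
have near_l (r : R) : 0 < r -> exists n, N (l - s n) < r /\ 2^-1 ^+ n < r.
  move=> r0; have [n hn] := exists_half_lt r0.
  have : \forall k \near \oo, ball l r%:C%C (s k).
    by apply: (cvg_ball sl); rewrite ltcR.
  move=> [m _ hm]; exists (maxn m n); split.
    by apply/hballE/hm => /=; rewrite leq_maxl.
  by apply: le_lt_trans hn; apply: hexp; rewrite leq_maxr.
have lD w t : S w -> D <= N (x - l + t *: w).
  move=> Sw; apply/ler_addgt0Pl => r /near_l[n [ln _]].
  have : D <= N (x - (- t *: w + s n)) by apply: DS; exact: SP.
  move=> /le_trans; apply.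
  rewrite (_ : x - _ = (l - s n) + (x - l + t *: w)); last first.
    by rewrite scaleNr opprD opprK [RHS]addrCA [RHS]addrA subrKA addrA addrAC.
  by apply: le_trans (dnormrD _ _ _) _; rewrite lerD2r ltW.
have lx : N (x - l) <= D.
  apply/ler_addgt0Pr => r r0; have [n [ln pn]] : exists n, N (l - s n) < r / 2 /\ 2^-1 ^+ n < r / 2.
    by apply: near_l; rewrite divr_gt0.
  apply: le_trans (dnormr_triangle _ (s n) _) _.
  rewrite dnormr_distC in ln.
  rewrite [in leRHS](splitr r) addrA; apply: lerD; last exact: ltW.
  by apply: ltW; apply: lt_trans (xs n) _; rewrite ltrD2l.
have : x - l = 0.
  apply: Sorth => w Sw; apply: orth_shift_eq0 => t.
  rewrite ler_sqr ?nnegrE ?dnormr_ge0//.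
  exact: le_trans lx (lD _ _ Sw).
move=> xl; have := lD 0 0 S0; rewrite xl scaler0 addr0.
rewrite (_ : N 0 = 0); first by rewrite leNgt D0.
by rewrite /dnormr linear0r /= sqrtr0.
Qed.

(** The span of [b] is dense by [dense_orth], and combinations with rational
    coefficients approximate it. *)
Lemma separable_total (b : nat -> H) :
  (forall v, (forall n, hdot H v (b n) = 0) -> v = 0) -> separable H.
Proof.
move=> btot.
pose comb (l : seq (R[i] * nat)) : H := \sum_(p <- l) p.1 *: b p.2.
pose q2c (q : rat * rat) : R[i] := Complex (ratr q.1) (ratr q.2).
pose qcomb (l : seq (rat * rat * nat)) : H := \sum_(p <- l) q2c p.1 *: b p.2.
have dS : dense (range comb).
  apply: dense_orth.
  - by exists [::] => //; rewrite /comb big_nil.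
  - move=> a _ _ [l _ <-] [l' _ <-].
    exists ([seq (a * p.1, p.2) | p <- l] ++ l') => //.
    rewrite /comb big_cat big_map scaler_sumr /=; congr (_ + _).
    by apply: eq_bigr => p _; rewrite scalerA.
  - move=> v hv; apply: btot => n; apply: hv.
    by exists [:: (1, n)] => //; rewrite /comb big_seq1 scale1r.
have approxC (z : R[i]) (e : R) : 0 < e -> exists q, normsq (z - q2c q) < e ^+ 2.
  move=> e0; case: z => x y.
  have ap (t : R) : exists q : rat, (t - ratr q) ^+ 2 <= (e / 2) ^+ 2.
    have /rat_in_itvoo[q] : t - e / 2 < t + e / 2 by rewrite ltrBlDr -addrA ltrDl addr_gt0 ?divr_gt0.
    rewrite in_itv /= => /andP[h1 h2]; exists q.
    rewrite -real_normK ?num_real// ler_sqr ?nnegrE ?divr_ge0 ?(ltW e0)//.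
    by rewrite ler_norml; lra.
  have [p hp] := ap x; have [q hq] := ap y; exists (p, q).
  rewrite /normsq /=; have := exprn_gt0 2 e0; move: hp hq; rewrite expr_div_n; clear; lra.
have approx l (e : R) : 0 < e -> exists l', N (comb l - qcomb l') < e.
  elim: l e => [|[z n] l IH] e e0.
    exists [::]; rewrite /comb /qcomb !big_nil subrr.
    by rewrite /dnormr linear0r /= sqrtr0.
  have e20 : 0 < e / 2 by rewrite divr_gt0.
  have [l' hl'] := IH (e / 2) e20.
  have b0 : 0 < N (b n) + 1 by rewrite ltr_wpDl ?dnormr_ge0.
  have eb0 : 0 < e / 2 / (N (b n) + 1) by rewrite divr_gt0.
  have [q hq] := approxC z _ eb0.
  exists ((q, n) :: l'); rewrite /comb /qcomb !big_cons /= -/(comb l) -/(qcomb l').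
  rewrite opprD addrACA -scalerBl.
  apply: le_lt_trans (dnormrD _ _ _) _.
  rewrite [ltRHS]splitr ler_ltD//.
  rewrite -(ler_pXn2r (ltn0Sn 1)) ?nnegrE ?dnormr_ge0 ?divr_ge0 ?(ltW e0)//.
  rewrite dnormrZ; apply: (@le_trans _ _ ((e / 2 / (N (b n) + 1)) ^+ 2 * (N (b n) + 1) ^+ 2)).
    rewrite ler_pM ?normsq_ge0 ?sqr_ge0 ?(ltW hq)//.
    by rewrite ler_sqr ?nnegrE ?dnormr_ge0 ?(ltW b0)// lerDl.
  by rewrite -exprMn divfK// gt_eqF.
exists (range qcomb); split.
  by apply: (@sub_countable _ _ _ [set: seq (rat * rat * nat)]); [exact: card_image_le|exact: countableP].
apply: dense_approx => u e e0.
have e20 : 0 < e / 2 by rewrite divr_gt0.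
have [|v [/interior_subset/hballE uv [l _ lv]]] := dS _ _ (open_interior (ball u (e / 2)%:C%C)).
  by exists u; apply: nbhsx_ballx; rewrite ltcR.
have [l' hl'] := approx l _ e20.
exists (qcomb l'); first by exists l'.
apply: le_lt_trans (dnormr_triangle _ v _) _.
by rewrite [ltRHS]splitr ltrD// -lv.
Qed.

End hilbert_geometry.

(** * Unitary operators and support subspaces of L^2 *)

Section unitary_building.
Context {R : realType} (H : hilbert R).
Local Notation N := (dnormr (hdot H)).

(** Polarization: real parts of dot products are determined by norms, and
    imaginary parts are real parts after multiplication by the imaginary unit. *)
Lemma norm_isometry (f : H -> H) : linear f -> (forall u, N (f u) = N u) ->
  isometry (hdot H) (hdot H) f.
Proof.
move=> flin fN.
have fD u v : f (u + v) = f u + f v by rewrite -[u in LHS]scale1r flin scale1r.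
have f0 : f 0 = 0 by have := fD 0 0; rewrite addr0 => /eqP; rewrite -subr_eq subrr => /eqP.
have fZ a u : f (a *: u) = a *: f u.
  by have := flin a u 0; rewrite !addr0 f0 addr0.
have re u v : complex.Re (hdot H (f u) (f v)) = complex.Re (hdot H u v).
  have := fN (u + v) => /(congr1 (fun x => x ^+ 2)).
  rewrite fD !dnormrD_sqr !fN => /addrI /(congr1 (fun x => 2^-1 * x)).
  by rewrite !mulKf ?pnatr_eq0.
move=> u v; apply/eqP; rewrite eq_complex re eqxx /=; apply/eqP.
have := re u (Complex 0 1 *: v); rewrite fZ !linearZr_LR /= !conjCE.
case: (hdot H (f u) (f v)) => a b; case: (hdot H u v) => a' b' /=.
by rewrite !mul0r !mulN1r !sub0r !opprK.
Qed.

Definition mk_unitary (f g : H -> H) (flin : linear f) (fK : cancel f g)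
    (gK : cancel g f) (fN : forall u, N (f u) = N u) : unitary H :=
  @Unitary R H
    (HB.pack_for {linear H -> H} f (GRing.isLinear.Build R[i] H H *:%R f flin))
    g fK gK (norm_isometry flin fN).

End unitary_building.

Section l2_operators.
Context d (Y : measurableType d) {R : realType}.
Variable nu : {measure set Y -> \bar R}.
Local Notation H := (l2hilbert nu).
Local Notation N := (dnormr (hdot H)).
Implicit Types (u v : H) (A E : set Y).
Let S (u : H) : sqint nu (rp u) := rp_sqint u.

Lemma hdot_ip u v : hdot H u v = ip nu (rp u) (rp v). Proof. by []. Qed.

Lemma eq_dnormr u v : nsq nu (rp u) = nsq nu (rp v) -> N u = N v.
Proof.
move=> uv; apply/eqP; rewrite -(@eqrXn2 _ 2) ?dnormr_ge0//.
by apply/eqP; apply: EFin_inj; rewrite !dnormr_nsq.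
Qed.

Definition unimodular (g : Y -> R[i]) :=
  cmeasurable setT g /\ forall y, `|g y| = 1.

Definition mulop g (u : H) : H := lp nu (fun y => g y * rp u y).

Section mulop.
Variable g : Y -> R[i].
Hypothesis ug : unimodular g.

Lemma sqint_mulop u : sqint nu (fun y => g y * rp u y).
Proof.
by apply: (@sqintM_bounded _ _ _ _ 1) => //; [exact: ug.1|
  move=> y; rewrite normsq_unit// ug.2].
Qed.

Lemma rp_mulop u : {ae nu, forall y, rp (mulop g u) y = g y * rp u y}.
Proof. exact: lpK (sqint_mulop u). Qed.

Lemma mulop_linear : linear (mulop g).
Proof.
move=> a u v; apply/l2_eqP.
apply: filterS3 (rp_mulop (a *: u + v)) (rpP a u v)
  (filterI (rpP a (mulop g u) (mulop g v))
    (filterI (rp_mulop u) (rp_mulop v))).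
move=> y -> -> [-> [-> ->]].
by rewrite mulrDr mulrCA.
Qed.

Lemma mulop_norm u : N (mulop g u) = N u.
Proof.
apply: eq_dnormr; rewrite (@nsq_ae _ _ _ _ _ (fun y => g y * rp u y)); last first.
- exact: rp_mulop.
- by have [] := sqint_mulop u.
- by have [] := S (mulop g u).
by apply: eq_integral => y _; rewrite normsqM normsq_unit ?mul1r// ug.2.
Qed.

End mulop.

Lemma unimodularV g : unimodular g -> unimodular (fun y => Num.conj (g y)).
Proof.
move=> [mg g1]; split; first exact: cmeasurableJ.
by move=> y; rewrite norm_conjC.
Qed.

Lemma mulop_comp g h k : unimodular g -> unimodular h -> unimodular k ->
  (forall y, g y * h y = k y) -> forall u, mulop g (mulop h u) = mulop k u.
Proof.
move=> ug uh uk ghk u; apply/l2_eqP.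
apply: filterS3 (rp_mulop ug (mulop h u)) (rp_mulop uh u) (rp_mulop uk u).
by move=> y -> -> ->; rewrite mulrA ghk.
Qed.

Lemma mulop1 g : unimodular g -> (forall y, g y = 1) -> forall u, mulop g u = u.
Proof.
move=> ug g1 u; apply/l2_eqP; apply: filterS (rp_mulop ug u) => y ->.
by rewrite g1 mul1r.
Qed.

Lemma mulopK g : unimodular g -> cancel (mulop g) (mulop (fun y => Num.conj (g y))).
Proof.
move=> ug u; have uc : unimodular (fun=> 1 : R[i]).
  by split; [exact: cmeasurable_cst|move=> y; rewrite normr1].
rewrite (mulop_comp (unimodularV ug) ug uc) ?mulop1// => y.
by rewrite mulrC -normCK ug.2 expr1n.
Qed.

Lemma mulopVK g : unimodular g -> cancel (mulop (fun y => Num.conj (g y))) (mulop g).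
Proof.
move=> ug u; have := mulopK (unimodularV ug) u.
by congr (_ = _); congr mulop; apply/funext => y; rewrite conjCK.
Qed.

Definition mul_unitary g (ug : unimodular g) : unitary H :=
  @mk_unitary R H (mulop g) (mulop (fun y => Num.conj (g y)))
    (mulop_linear ug) (mulopK ug) (mulopVK ug) (mulop_norm ug).

Definition supp E : set H :=
  [set u : H | {ae nu, forall y, ~ E y -> rp u y = 0}].

(** The orthogonal projection onto [supp E]. *)
Definition cutoff E u : H := lp nu (fun y => cindic E y * rp u y).

Section cutoff.
Variables (E : set Y) (mE : measurable E).

Lemma sqint_cutoff u : sqint nu (fun y => cindic E y * rp u y).
Proof.
apply: (@sqintM_bounded _ _ _ _ 1) => //; first exact: cmeasurable_indic.
by move=> y; exact: normsq_cindic.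
Qed.

Lemma rp_cutoff u : {ae nu, forall y, rp (cutoff E u) y = cindic E y * rp u y}.
Proof. exact: lpK (sqint_cutoff u). Qed.

Lemma supp_cutoff u : supp E (cutoff E u).
Proof.
apply: filterS (rp_cutoff u) => y -> Ey.
by rewrite cindicF// mul0r.
Qed.

(** The dot product of a vector with its projection is the squared norm of the
    projection. *)
Lemma dot_cutoff u : hdot H u (cutoff E u) = 0 ->
  {ae nu, forall y, E y -> rp u y = 0}.
Proof.
move=> u0; have : ip nu (fun y => cindic E y * rp u y) (fun y => cindic E y * rp u y) = 0.
  rewrite -u0 hdot_ip; transitivity (ip nu (rp u) (fun y => cindic E y * rp u y)).
    rewrite /ip; congr cint; apply/funext => y.
    rewrite rmorphM /= mulrACA; case: (pselect (E y)) => Ey.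
      by rewrite cindicT// rmorph1 mulr1 !mul1r.
    by rewrite cindicF// rmorph0 !mul0r mulr0.
  apply: ip_ae => //; try exact: S; try exact: sqint_cutoff.
    exact: aeW.
  by apply: filterS (rp_cutoff u) => y ->.
rewrite ip_nsq; last exact: sqint_cutoff.
move=> /(congr1 (@complex.Re R)) /= h0.
have /nsq_eq0 : nsq nu (fun y => cindic E y * rp u y) = 0%E.
  by rewrite -[LHS]fineK ?h0//; exact: sqint_fin (sqint_cutoff u).
move=> /(_ (sqint_cutoff u).1); apply: filterS => y + Ey.
by rewrite cindicT// mul1r.
Qed.

Lemma supp_dot u v : supp E u -> {ae nu, forall y, E y -> rp v y = 0} ->
  hdot H v u = 0.
Proof.
move=> su sv; rewrite hdot_ip /ip (@cint_ae _ _ _ _ _ (fun=> 0)).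
- rewrite /cint; have z : \int[nu]_x (0 : R) = 0 by rewrite /Rintegral integral0.
  by congr Complex; exact: z.
- by apply: cmeasurableM; [have [] := S v|apply: cmeasurableJ; have [] := S u].
- exact: cmeasurable_cst.
apply: filterS2 su sv => y hu hv; case: (pselect (E y)) => Ey.
  by rewrite hv// mul0r.
by rewrite hu// rmorph0 mulr0.
Qed.

End cutoff.

(** Support subspaces are orthogonal complements, hence closed. *)
Lemma supp_orth E : measurable E ->
  supp E = [set u : H | forall w, supp (~` E) w -> hdot H u w = 0].
Proof.
move=> mE; apply/seteqP; split => u /=.
  by move=> su w sw; apply: (supp_dot sw).
move=> hu.
exact: (dot_cutoff (measurableC mE) (hu _ (supp_cutoff (measurableC mE) u))).
Qed.

Lemma supp_closed_subspace E : measurable E -> closed_subspace (supp E).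
Proof.
move=> mE; split.
- by rewrite supp_orth//; exact: closed_orth.
- by apply: filterS (rp0 nu) => y ->.
move=> a u v su sv; apply: filterS3 (rpP a u v) su sv => y -> hu hv Ey.
by rewrite hu// hv// mulr0 addr0.
Qed.

Lemma ominus_supp A E : measurable A -> measurable E -> E `<=` A ->
  ominus (supp A) (supp E) = supp (A `\` E).
Proof.
move=> mA mE EA; apply/seteqP; split => u /=.
  move=> [sA uE]; have := dot_cutoff mE (uE _ (supp_cutoff mE u)).
  move: sA; apply: filterS2 => y h1 h2 h3.
  case: (pselect (A y)) => Ay; last exact: h1.
  by apply: h2; apply: contrapT => Ey; apply: h3.
move=> su; split; first by apply: filterS su => y h Ay; apply: h => -[].
move=> w sw; apply: (supp_dot sw); apply: filterS su => y h Ey.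
by apply: h => -[].
Qed.

(** A function orthogonal to all these subspaces vanishes almost everywhere on
    every [E n]. *)
Lemma supp_bigcup_dense (E : nat -> set Y) : (forall n, measurable (E n)) ->
  (forall n k, (n <= k)%N -> E n `<=` E k) ->
  \bigcup_n E n = setT -> dense (\bigcup_n supp (E n)).
Proof.
move=> mE Ele ET; apply: dense_orth.
- by exists 0%N => //; have [] := supp_closed_subspace (mE 0%N).
- move=> a u v [n _ su] [k _ sv]; exists (maxn n k) => //.
  have [_ _ c] := supp_closed_subspace (mE (maxn n k)); apply: c.
    by apply: filterS su => y h hy; apply: h => /(Ele _ _ (leq_maxl n k)).
  by apply: filterS sv => y h hy; apply: h => /(Ele _ _ (leq_maxr n k)).
move=> v hv; apply/l2_eqP.
have : {ae nu, forall y, forall n, E n y -> rp v y = 0}.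
  apply: ae_foralln => n; apply: dot_cutoff => //.
  by apply: hv; exists n => //; exact: supp_cutoff.
apply: filterS2 (rp0 nu) => y -> h.
have [n _ En] : (\bigcup_n E n) y by rewrite ET.
exact: h En.
Qed.

Section composition.
Variables (tau rho : Y -> Y) (M : R).
Hypothesis M0 : 0 < M.
Hypothesis mtau : measurable_fun setT tau.
Hypothesis mrho : measurable_fun setT rho.
Hypothesis tau_int : forall F : Y -> \bar R, measurable_fun setT F ->
  (forall y, 0 <= F y)%E -> (\int[nu]_y F (tau y) = M^-1%:E * \int[nu]_y F y)%E.
Hypothesis rho_tau : {ae nu, forall y, rho (tau y) = y}.
Hypothesis tau_rho : {ae nu, forall y, tau (rho y) = y}.

Lemma rho_int (F : Y -> \bar R) : measurable_fun setT F ->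
  (forall y, 0 <= F y)%E -> (\int[nu]_y F (rho y) = M%:E * \int[nu]_y F y)%E.
Proof.
move=> mF F0.
have mFr : measurable_fun setT (F \o rho) by exact: measurableT_comp.
have := tau_int mFr (fun y => F0 (rho y)).
rewrite (@ge0_ae_eq_integral _ _ _ _ _ (fun y => F (rho (tau y))) F)//; last 2 first.
- exact: (@measurableT_comp _ _ _ _ _ _ (F \o rho) setT tau).
- by apply: filterS rho_tau => y -> _.
by move=> ->; rewrite muleA -EFinM divff ?mul1e// gt_eqF.
Qed.

Lemma ae_tau (P : Y -> Prop) : {ae nu, forall y, P y} -> {ae nu, forall y, P (tau y)}.
Proof.
move=> [A [mA A0 PA]]; exists (tau @^-1` A); split.
- by rewrite -[X in measurable X]setTI; exact: mtau.
- have mpre : measurable (tau @^-1` A).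
    by rewrite -[X in measurable X]setTI; exact: mtau.
  have mA1 : measurable_fun setT (EFin \o \1_A : Y -> \bar R).
    by apply/measurable_EFinP; exact: measurable_indic.
  have := tau_int mA1 (fun y => ler0n _ _).
  rewrite [RHS](_ : _ = 0)%E => [<-|]; last by rewrite integral_indic// setIT A0 mule0.
  by rewrite -[in LHS](setIT (tau @^-1` A)) -integral_indic.
by move=> y /= ny; apply: PA.
Qed.

Lemma ae_rho (P : Y -> Prop) : {ae nu, forall y, P y} -> {ae nu, forall y, P (rho y)}.
Proof.
move=> [A [mA A0 PA]]; exists (rho @^-1` A); split.
- by rewrite -[X in measurable X]setTI; exact: mrho.
- have mpre : measurable (rho @^-1` A).
    by rewrite -[X in measurable X]setTI; exact: mrho.
  have mA1 : measurable_fun setT (EFin \o \1_A : Y -> \bar R).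
    by apply/measurable_EFinP; exact: measurable_indic.
  have := rho_int mA1 (fun y => ler0n _ _).
  rewrite [RHS](_ : _ = 0)%E => [<-|]; last by rewrite integral_indic// setIT A0 mule0.
  by rewrite -[in LHS](setIT (rho @^-1` A)) -integral_indic.
by move=> y /= ny; apply: PA.
Qed.

(** Composition with [rho] multiplies squared norms by [M], and the constant
    compensates for it. *)
Definition dilation u : H := lp nu (fun y => (Num.sqrt M)^-1%:C%C * rp u (rho y)).
Definition dilationV u : H := lp nu (fun y => (Num.sqrt M)%:C%C * rp u (tau y)).

Lemma nsq_dilation u :
  nsq nu (fun y => (Num.sqrt M)^-1%:C%C * rp u (rho y)) = nsq nu (rp u).
Proof.
rewrite /nsq; under eq_integral do rewrite normsqM normsqr exprVn sqr_sqrtr ?(ltW M0)// EFinM.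
have mu : measurable_fun setT (fun y => (normsq (rp u y))%:E).
  by apply: measurable_enormsq; have [] := S u.
rewrite ge0_integralZl_EFin//.
- rewrite (rho_int mu); last by move=> y; rewrite lee_fin normsq_ge0.
  by rewrite muleA -EFinM mulVf ?mul1e// gt_eqF.
- by move=> y _; rewrite lee_fin normsq_ge0.
- exact: (@measurableT_comp _ _ _ _ _ _ (fun y => (normsq (rp u y))%:E) setT rho).
- by rewrite invr_ge0 ltW.
Qed.

Lemma nsq_dilationV u :
  nsq nu (fun y => (Num.sqrt M)%:C%C * rp u (tau y)) = nsq nu (rp u).
Proof.
rewrite /nsq; under eq_integral do rewrite normsqM normsqr sqr_sqrtr ?(ltW M0)// EFinM.
have mu : measurable_fun setT (fun y => (normsq (rp u y))%:E).
  by apply: measurable_enormsq; have [] := S u.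
rewrite ge0_integralZl_EFin//.
- rewrite (tau_int mu); last by move=> y; rewrite lee_fin normsq_ge0.
  by rewrite muleA -EFinM divff ?mul1e// gt_eqF.
- by move=> y _; rewrite lee_fin normsq_ge0.
- exact: (@measurableT_comp _ _ _ _ _ _ (fun y => (normsq (rp u y))%:E) setT tau).
- exact: ltW.
Qed.

Lemma sqint_dilation u : sqint nu (fun y => (Num.sqrt M)^-1%:C%C * rp u (rho y)).
Proof.
split; last by rewrite nsq_dilation; have [] := S u.
apply: cmeasurableM; first exact: cmeasurable_cst.
by apply: cmeasurable_comp => //; have [] := S u.
Qed.

Lemma sqint_dilationV u : sqint nu (fun y => (Num.sqrt M)%:C%C * rp u (tau y)).
Proof.
split; last by rewrite nsq_dilationV; have [] := S u.
apply: cmeasurableM; first exact: cmeasurable_cst.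
by apply: cmeasurable_comp => //; have [] := S u.
Qed.

Lemma rp_dilation u :
  {ae nu, forall y, rp (dilation u) y = (Num.sqrt M)^-1%:C%C * rp u (rho y)}.
Proof. exact: lpK (sqint_dilation u). Qed.

Lemma rp_dilationV u :
  {ae nu, forall y, rp (dilationV u) y = (Num.sqrt M)%:C%C * rp u (tau y)}.
Proof. exact: lpK (sqint_dilationV u). Qed.

Lemma sqrtM0 : Num.sqrt M != 0. Proof. by rewrite gt_eqF// sqrtr_gt0. Qed.

Lemma dilationK : cancel dilation dilationV.
Proof.
move=> u; apply/l2_eqP.
apply: filterS3 (rp_dilationV (dilation u)) (ae_tau (rp_dilation u)) rho_tau.
move=> y -> -> ->.
by rewrite mulrA -rmorphM /= divff ?sqrtM0// rmorph1 mul1r.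
Qed.

Lemma dilationVK : cancel dilationV dilation.
Proof.
move=> u; apply/l2_eqP.
apply: filterS3 (rp_dilation (dilationV u)) (ae_rho (rp_dilationV u)) tau_rho.
move=> y -> -> ->.
by rewrite mulrA -rmorphM /= mulVf ?sqrtM0// rmorph1 mul1r.
Qed.

Lemma dilation_linear : linear dilation.
Proof.
move=> a u v; apply/l2_eqP.
apply: filterS3 (rp_dilation (a *: u + v)) (ae_rho (rpP a u v))
  (filterI (rpP a (dilation u) (dilation v))
    (filterI (rp_dilation u) (rp_dilation v))).
move=> y -> -> [-> [-> ->]].
by rewrite mulrDr mulrCA.
Qed.

Lemma dilation_norm u : N (dilation u) = N u.
Proof.
apply: eq_dnormr; rewrite -[RHS]nsq_dilation; apply: nsq_ae.
- by have [] := S (dilation u).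
- by have [] := sqint_dilation u.
exact: rp_dilation.
Qed.

Definition dilation_unitary : unitary H :=
  @mk_unitary R H dilation dilationV dilation_linear dilationK dilationVK dilation_norm.

Lemma dilation_supp A E : (forall y, E y <-> A (tau y)) ->
  supp A = dilation_unitary @` supp E.
Proof.
move=> EA; apply/seteqP; split => [u su|_ [u su <-]] /=.
  exists (dilationV u); last exact: dilationVK.
  apply: filterS2 (rp_dilationV u) (ae_tau su) => y -> h hE.
  by rewrite h ?mulr0// => /EA.
apply: filterS3 (rp_dilation u) (ae_rho su) tau_rho => y -> h ty hA.
by rewrite h ?mulr0// => /EA; rewrite ty.
Qed.

Lemma dilation_mulop g h (ug : unimodular g) (uh : unimodular h) :
  (forall y, g (tau y) = h y) ->
  forall u, unitary_inv dilation_unitary (mul_unitary ug (dilation_unitary u)) =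
    mul_unitary uh u.
Proof.
move=> gh u; rewrite /=; apply/l2_eqP.
apply: filterS3 (rp_dilationV (mulop g (dilation u)))
  (ae_tau (rp_mulop ug (dilation u)))
  (filterI (ae_tau (rp_dilation u)) (filterI rho_tau (rp_mulop uh u))).
move=> y -> -> [-> [-> ->]].
by rewrite gh mulrCA mulrA mulrA -(mulrA (h y)) -rmorphM /= divff ?sqrtM0// rmorph1 mulr1.
Qed.

End composition.

End l2_operators.

(** * Extension of homomorphisms into divisible groups *)

Section divisible_extension.
Variables (Gam U : zmodType).
Implicit Types (G A B : set (Gam * U)) (g : Gam) (u v : U).

(** [G] is the graph of a homomorphism from a subgroup of [Gam] to [U]. Graphs
    make the union of a chain of partial homomorphisms an ordinary union. *)
Definition partial_hom G :=
  [/\ G 0, forall p q, G p -> G q -> G (p - q) & forall u, G (0, u) -> u = 0].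

Lemma partial_homD G p q : partial_hom G -> G p -> G q -> G (p + q).
Proof.
by move=> [G0 GB _] Gp Gq; rewrite -[q]opprK; apply: (GB) => //; rewrite -sub0r; apply: GB.
Qed.

Lemma partial_homZ G p (n : int) : partial_hom G -> G p -> G (p *~ n).
Proof.
move=> hG Gp; have [G0 GB _] := hG.
have Gn k : G (p *+ k).
  by elim: k => [|k IH]; rewrite ?mulr0n// mulrS; apply: partial_homD.
by case: n => k; [exact: Gn|rewrite NegzE mulrNz -sub0r; apply: GB => //; exact: Gn].
Qed.

Lemma partial_hom_fun G g u v : partial_hom G -> G (g, u) -> G (g, v) -> u = v.
Proof.
move=> [_ GB Gf] Gu Gv; apply/eqP; rewrite -subr_eq0; apply/eqP; apply: Gf.
by have := GB _ _ Gu Gv; rewrite (_ : _ - _ = (g - g, u - v))// subrr.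
Qed.

Lemma fst_mulrz (p : Gam * U) (n : int) : (p *~ n).1 = p.1 *~ n.
Proof. by rewrite (raddfMz (@fst Gam U)). Qed.

Lemma snd_mulrz (p : Gam * U) (n : int) : (p *~ n).2 = p.2 *~ n.
Proof. by rewrite (raddfMz (@snd Gam U)). Qed.

(** Adjoining the pair (g, u) generates the graph of a homomorphism as soon as
    [u] has the right multiples wherever a multiple of [g] is in the domain. *)
Lemma partial_hom_extend1 G g u : partial_hom G ->
  (forall (n : int) v, G (g *~ n, v) -> v = u *~ n) ->
  exists2 G', partial_hom G' & G `<=` G' /\ G' (g, u).
Proof.
move=> hG hu; have [G0 GB Gf] := hG.
exists [set q | exists p (n : int), G p /\ q = p + (g, u) *~ n]; last first.
  split=> [p Gp|]; first by exists p, 0; rewrite mulr0z addr0.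
  by exists 0, 1; rewrite add0r.
split.
- by exists 0, 0; rewrite mulr0z addr0.
- move=> _ _ [p [n [Gp ->]]] [q [k [Gq ->]]].
  exists (p - q), (n - k); split; first exact: GB.
  by rewrite mulrzBr opprD addrACA.
move=> w [[h v] [n [Gp]]] [].
rewrite -/((g, u) *~ n) => h1 h2.
have e1 : (h + g *~ n) = 0.
  by rewrite -[g *~ n]/((g, u).1 *~ n) -fst_mulrz -[LHS]h1.
have e2 : w = v + u *~ n.
  by rewrite -[u *~ n]/((g, u).2 *~ n) -snd_mulrz -[RHS]h2.
have hE : h = g *~ (- n) by rewrite mulrNz; apply/eqP; rewrite -addr_eq0 e1.
by rewrite e2 (hu (- n) v) -?hE// mulrNz addNr.
Qed.

Hypothesis divU : forall (n : nat) u, (0 < n)%N -> exists v, v *+ n = u.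

(** The multiples of [g] in the domain are those of a least positive one,
    n0 g, unless only 0 g is there; so dividing the value at n0 g by n0 gives an
    admissible value at [g]. *)
Lemma divisible_value G g : partial_hom G ->
  exists u, forall (n : int) v, G (g *~ n, v) -> v = u *~ n.
Proof.
move=> hG; have [G0 GB Gf] := hG.
pose P n := `[< (0 < n)%N /\ exists v, G (g *+ n, v) >].
case: (pselect (exists n, P n)) => [exP|nP]; last first.
  exists 0 => n v Gv; rewrite mul0rz.
  have Gn k w : G (g *+ k, w) -> w = 0.
    case: k => [|k] Gw; first by apply: Gf.
    by exfalso; apply: nP; exists k.+1; apply/asboolP; split=> //; exists w.
  case: n Gv => k; first exact: Gn.
  rewrite NegzE mulrNz => Gv.
  have : G (g *+ k.+1, - v).
    have := GB _ _ G0 Gv.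
    by rewrite (_ : _ - _ = (0 - - (g *~ k.+1%:Z), 0 - v))// !sub0r opprK.
  by move=> /Gn /eqP; rewrite oppr_eq0 => /eqP.
case: (ex_minnP exP) => n0 /asboolP[n0gt [v0 Gv0]] nmin.
have [u uE] := divU v0 n0gt; exists u => n v Gv.
have n00 : n0%:Z != 0 by rewrite eqz_nat -lt0n.
set q := (n %/ n0%:Z)%Z; set r := (n %% n0%:Z)%Z.
have nE : n = q * n0%:Z + r := divz_eq n n0%:Z.
have Gr : G (g *~ r, v - v0 *~ q).
  have := GB _ _ Gv (partial_homZ q hG Gv0).
  congr G; rewrite [LHS](surjective_pairing _) /=.
  congr pair; last by rewrite snd_mulrz.
  by rewrite fst_mulrz /= nE mulrzDr pmulrn -mulrzA [n0%:Z * q]mulrC addrC addKr.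
have r0 : r = 0.
  have rge : 0 <= r by exact: modz_ge0.
  have rlt : r < n0%:Z by apply: ltz_pmod; rewrite ltz_nat.
  case: (r) Gr rge rlt => [k|//] Gk _; rewrite ltz_nat => kn.
  case: k Gk kn => [//|k] Gk kn; exfalso.
  have := nmin k.+1; rewrite leqNgt kn => /(_ _)/negP; apply => //.
  by apply/asboolP; split=> //; exists (v - v0 *~ q).
move: Gr; rewrite r0 mulr0z => /Gf /eqP; rewrite subr_eq0 => /eqP ->.
by rewrite nE r0 addr0 -uE pmulrn -mulrzA mulrC.
Qed.

(** Divisible groups are injective: by Zorn's lemma there is a maximal partial
    extension, and by [divisible_value] it is total. *)
Lemma divisible_extension G : partial_hom G ->
  exists f : Gam -> U, (forall g h, f (g + h) = f g + f h) /\
    forall g u, G (g, u) -> f g = u.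
Proof.
move=> hG.
(* set0 is there as the union of the empty chain *)
pose P A := A = set0 \/ (partial_hom A /\ G `<=` A).
have [F FP Ftot|A [PA Amax]] := @Zorn_bigcup _ P.
  case: (pselect (exists2 A, F A & A !=set0)) => [[A FA A0]|F0]; last first.
    left; apply/seteqP; split=> // p [A FA Ap]; apply: F0.
    by exists A => //; exists p.
  have hF B : F B -> B !=set0 -> partial_hom B /\ G `<=` B.
    by move=> /FP[->|//] [].
  right; split; last by move=> p Gp; exists A => //; apply: (hF _ FA A0).2.
  split.
  - by exists A => //; have [[]] := hF _ FA A0.
  - move=> p q [B FB Bp] [C FC Cq].
    have [BC|CB] := Ftot _ _ FB FC.
      exists C => //; have [[_ CD _] _] := hF _ FC (ex_intro _ q Cq).
      by apply: CD => //; exact: BC.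
    exists B => //; have [[_ BD _] _] := hF _ FB (ex_intro _ p Bp).
    by apply: BD => //; exact: CB.
  - move=> u [B FB Bu]; have [[_ _ Bf] _] := hF _ FB (ex_intro _ _ Bu).
    exact: Bf.
have [hA GA] : partial_hom A /\ G `<=` A.
  case: PA => // A0; exfalso; apply: (Amax G); last by right; split.
  rewrite A0; split=> //.
  by move=> h; have [G0 _ _] := hG; apply: (h 0 G0).
have Atot g : exists u, A (g, u).
  have [u hu] := divisible_value g hA.
  have [A' hA' [AA' A'u]] := partial_hom_extend1 hA hu.
  exists u; apply: contrapT => nAu; apply: (Amax A').
    by split=> // A'A; apply: nAu; exact: A'A.
  by right; split=> //; exact: subset_trans AA'.
pose f g := sval (cid (Atot g)).
have Af g : A (g, f g) by rewrite /f; case: cid.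
exists f; split=> [g h|g u Gu]; last by apply: partial_hom_fun hA (Af g) (GA _ Gu).
exact: (partial_hom_fun hA (Af (g + h)) (partial_homD hA (Af g) (Af h))).
Qed.

End divisible_extension.

(** * Roots of complex numbers of modulus one *)

Section circle_root.
Context {R : realType}.
Implicit Types (z : R[i]) (t : R).

Definition expi t : R[i] := Complex (cos t) (sin t).

Lemma expiD s t : expi (s + t) = expi s * expi t.
Proof. by apply/eqP; rewrite eq_complex /= cosD sinD eqxx /= addrC. Qed.

Lemma expi0 : expi 0 = 1. Proof. by rewrite /expi cos0 sin0. Qed.

Lemma expiX t n : expi t ^+ n = expi (t *+ n).
Proof.
elim: n => [|n IH]; first by rewrite expr0 mulr0n expi0.
by rewrite exprS IH mulrS expiD.
Qed.

Lemma norm_expi t : `|expi t| = 1.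
Proof. by rewrite normc_def /= cos2Dsin2 sqrtr1. Qed.

(** Clamping the argument to the domain of [acos] makes the function monotone on
    the whole line, hence measurable. *)
Definition clamp_acos (x : R) : R := acos (Num.max (-1) (Num.min 1 x)).

Lemma clamp_in (x : R) : -1 <= Num.max (-1) (Num.min 1 x) <= 1.
Proof.
by rewrite le_max lexx /= ge_max ge_min lexx /= andbT -subr_ge0 opprK addr_ge0.
Qed.

Lemma clamp_acosE (x : R) : -1 <= x <= 1 -> clamp_acos x = acos x.
Proof.
by move=> /andP[h1 h2]; rewrite /clamp_acos min_r// max_r.
Qed.

Lemma measurable_clamp_acos : measurable_fun setT clamp_acos.
Proof.
apply: nonincreasing_measurable => // x y xy; rewrite leNgt; apply/negP.
have hx := clamp_in x; have hy := clamp_in y.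
rewrite -ltr_cos ?in_itv /= ?acos_ge0 ?acos_lepi// !acosK ?in_itv//= ltNge.
by move=> /negP; apply; rewrite le_max2// le_min2.
Qed.

(** The argument in ]-pi, pi] of a number of modulus one. It is
    discontinuous at -1 but measurable, as are the n-th roots made from it. *)
Definition carg z : R := if 0 <= complex.Im z then clamp_acos (complex.Re z)
  else - clamp_acos (complex.Re z).

Lemma Re_unit z : `|z| = 1 -> -1 <= complex.Re z <= 1.
Proof.
move=> /normsq_unit; rewrite /normsq => h.
have : complex.Re z ^+ 2 <= 1 by rewrite -h lerDl sqr_ge0.
by rewrite expr2 => h2; apply/andP; split; nra.
Qed.

Lemma expi_carg z : `|z| = 1 -> expi (carg z) = z.
Proof.
move=> z1; have hR := Re_unit z1; have hz := normsq_unit z1.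
have hs : Num.sqrt (1 - complex.Re z ^+ 2) = `|complex.Im z|.
  by rewrite -sqrtr_sqr -hz /normsq addrC addKr.
have hin : complex.Re z \in `[-1, 1] by rewrite in_itv.
rewrite /expi /carg clamp_acosE//; case: z hR hin hs {z1 hz} => a b /= hR hin hs.
case: ifPn => b0.
  by rewrite acosK// sin_acos// hs ger0_norm.
by rewrite cosN sinN acosK// sin_acos// hs ltr0_norm ?opprK// ltNge.
Qed.

Definition croot n z := expi (carg z / n%:R).

Lemma crootK n z : (0 < n)%N -> `|z| = 1 -> croot n z ^+ n = z.
Proof.
move=> n0 z1; rewrite expiX -[X in expi X]mulr_natr divfK ?expi_carg//.
by rewrite pnatr_eq0 -lt0n.
Qed.

Lemma nontrivial_root n : (1 < n)%N -> exists z : R[i], [/\ `|z| = 1, z != 1 & z ^+ n = 1].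
Proof.
move=> n1; exists (expi (pi *+ 2 / n%:R)).
have n0 : (n%:R : R) != 0 by rewrite pnatr_eq0 -lt0n ltnW.
split; first exact: norm_expi.
  apply/eqP => /(congr1 (@complex.Re R)) /= h.
  have p0 := @pi_gt0 R.
  have h0 : (0 : R) \in `[0, pi] by rewrite in_itv /= lexx ltW.
  have hin : (pi *+ 2 / n%:R : R) \in `[0, pi].
    have p20 : 0 <= pi *+ 2 / n%:R :> R by rewrite divr_ge0// mulrn_wge0// ltW.
    rewrite in_itv; apply/andP; split; first exact: p20.
    change (pi *+ 2 / n%:R <= pi :> R).
    rewrite ler_pdivrMr ?ltr0n 1?ltnW// -[pi *+ 2]mulr_natr ler_pM2l//.
    by rewrite ler_nat.
  have /eqP : pi *+ 2 / n%:R = 0 :> R by apply: cos_inj => //; rewrite cos0.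
  rewrite mulf_eq0 invr_eq0 (negbTE n0) orbF.
  by rewrite mulrn_eq0 orFb gt_eqF.
by rewrite expiX -[X in expi X]mulr_natr divfK// /expi cos2pi sin2pi.
Qed.

Lemma unimodular_croot d (T : measurableType d) n (g : T -> R[i]) :
  unimodular g -> unimodular (fun x => croot n (g x)).
Proof.
move=> [[g1 g2] _]; split; last by move=> x; exact: norm_expi.
have mc : measurable_fun setT (fun x => carg (g x) / n%:R).
  apply: measurable_funM; last exact: measurable_cst.
  have mac : measurable_fun setT (fun x => clamp_acos (complex.Re (g x))).
    exact: (measurableT_comp measurable_clamp_acos g1).
  rewrite /carg; apply: measurable_fun_ifT => //.
    by apply: measurable_fun_ler => //; exact: measurable_cst.
  exact: measurable_funN.
split => /=.
  apply: (measurableT_comp _ mc); apply: continuous_measurable_fun.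
  exact: continuous_cos.
apply: (measurableT_comp _ mc); apply: continuous_measurable_fun.
exact: continuous_sin.
Qed.

End circle_root.

(** * The Borel structure of the dual group *)

Lemma measurable_boolset d (T : measurableType d) (p : T -> bool) :
  measurable_fun setT p -> measurable [set x | p x].
Proof.
by move=> mp; have := mp measurableT [set true] I; rewrite setTI.
Qed.

Lemma bigcup_countType_measurable d (T : measurableType d) (I : countType)
  (P : set I) (F : I -> set T) : (forall i, measurable (F i)) ->
  measurable (\bigcup_(i in P) F i).
Proof.
move=> mF; rewrite (_ : \bigcup_(i in P) F i = \bigcup_(n : nat)
    (if unpickle n is Some i then if `[< P i >] then F i else set0 else set0)).
  apply: bigcupT_measurable => n; case: unpickle => // i.
  by case: ifP.
apply/seteqP; split => [x [i Pi Fx]|x [n _]].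
  by exists (pickle i) => //; rewrite pickleK (asboolT Pi).
case: (unpickle n) => [i|//]; case: ifPn => // /asboolP Pi Fx.
by exists i.
Qed.

Lemma countable_enum (G : Type) (x0 : G) : countable [set: G] ->
  exists e : nat -> G, forall g, exists n, e n = g.
Proof.
move=> /countable_injP[f finj].
pose e n := if pselect (exists g, f g = n) is left h then sval (cid h) else x0.
exists e => g; exists (f g); rewrite /e; case: pselect => [h|]; last by case; exists g.
by apply: finj; rewrite ?in_setT//; case: cid.
Qed.

Section dual_borel.
Context {R : realType} {Gam : zmodType}.
Local Notation D := (dual R Gam).
Local Notation BD := (borel_dual R Gam).
Variable e : nat -> Gam.
Hypothesis e_surj : forall g, exists n, e n = g.

Lemma eval_continuous g : continuous (fun w : D => w g).
Proof.
move=> w; have h : continuous (@dual_fun R Gam : D -> {ptws Gam -> R[i]}).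
  exact: initial_continuous.
apply: (@continuous_comp _ _ _ (@dual_fun R Gam : D -> {ptws Gam -> R[i]})
  (fun f : {ptws Gam -> R[i]} => f g)); first exact: h.
exact: (@proj_continuous Gam (fun=> R[i] : topologicalType) g).
Qed.

(** As [e] enumerates [Gam], the values at the first n elements for n = 0, 1,
    and so on determine a countable basis of neighbourhoods. *)
Lemma dual_open_basis (O : set D) (w : D) : open O -> O w ->
  exists n, forall w' : D, (forall k, (k < n)%N ->
    normsq (w' (e k) - w (e k)) < (2^-1 ^+ n) ^+ 2) -> O w'.
Proof.
move=> [C oC <-] /= Cw.
pose B n := [set f : Gam -> R[i] | forall k, (k < n)%N ->
  normsq (f (e k) - w (e k)) < (2^-1 ^+ n) ^+ 2].
have hexp (n k : nat) : (n <= k)%N -> (2^-1 : R) ^+ k <= 2^-1 ^+ n.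
  by move=> nk; rewrite ler_wiXn2l ?invr_ge0// invf_le1// ler1n.
have Bdec n k : (n <= k)%N -> B k `<=` B n.
  move=> nk f Bf i ik; apply: lt_le_trans (Bf i (leq_trans ik nk)) _.
  by rewrite ler_sqr ?nnegrE ?exprn_ge0 ?invr_ge0// hexp.
pose F : set_system {ptws Gam -> R[i]} := [set A | exists n, B n `<=` A].
have FF : Filter F.
  split; first by exists 0%N.
    move=> P Q [n nP] [k kQ]; exists (maxn n k) => f Bf; split.
      by apply: nP; apply: Bdec Bf; rewrite leq_maxl.
    by apply: kQ; apply: Bdec Bf; rewrite leq_maxr.
  by move=> P Q PQ [n nP]; exists n; exact: subset_trans PQ.
have Fw : F --> (w : {ptws Gam -> R[i]}).
  apply/cvg_sup => g; rewrite cvg_image; last first.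
    by rewrite eqEsubset; split=> v // _; exists (cst v).
  have [k gk] := e_surj g.
  move=> A /nbhs_ballP[r /= /gt0_real[r' r0 ->] rA].
  have [n hn] := exists_half_lt r0.
  exists ((fun f : {ptws Gam -> R[i]} => f g) @^-1` A); last first.
    by rewrite eqEsubset; split => [v [f /= ? <-]//|v Av]; exists (cst v).
  exists (maxn n k.+1) => f /(_ k); rewrite leq_maxr gk => /(_ isT) Bf.
  apply: rA; rewrite -ball_normE /ball_ /= distrC.
  rewrite -(@ltr_pXn2r _ 2)// ?nnegrE ?ler0c ?(ltW r0)//.
  rewrite -normsqC -rmorphXn ltcR; apply: lt_trans Bf _.
  rewrite ltr_pXn2r ?nnegrE ?exprn_ge0 ?invr_ge0 ?(ltW r0)//.
  by apply: le_lt_trans hn; rewrite hexp// leq_maxl.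
have [n nC] : F C by apply: Fw; exact: open_nbhs_nbhs.
by exists n => w' hw'; apply: nC.
Qed.

(** The radius is small enough for a box that contains a point w to lie in the
    basic neighbourhood of w that constrains the same number of values. *)
Definition dual_box (b : nat * seq (rat * rat)) : set D :=
  [set w | forall k, (k < b.1)%N ->
    `|complex.Re (w (e k)) - ratr (nth (0, 0) b.2 k).1| < 2^-1 ^+ b.1 / 4 /\
    `|complex.Im (w (e k)) - ratr (nth (0, 0) b.2 k).2| < 2^-1 ^+ b.1 / 4].

(** Second countability of the dual group: every open set is a union of boxes,
    and there are countably many boxes. *)
Lemma dual_openE (O : set D) : open O ->
  O = \bigcup_(b in [set b | dual_box b `<=` O]) dual_box b.
Proof.
move=> oO; apply/seteqP; split => [w Ow|w [b /= bO] /bO //].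
have [n hn] := dual_open_basis oO Ow.
have d0 : 0 < (2^-1 : R) ^+ n / 4 by rewrite divr_gt0// exprn_gt0// invr_gt0.
have ap (x : R) : exists q : rat, `|x - ratr q| < 2^-1 ^+ n / 4.
  have /rat_in_itvoo[q] : x - 2^-1 ^+ n / 4 < x + 2^-1 ^+ n / 4.
    by rewrite ltrBlDr -addrA ltrDl addr_gt0.
  rewrite in_itv /= => /andP[h1 h2]; exists q.
  by rewrite ltr_norml; apply/andP; split; [rewrite ltrBrDr addrC ltrBlDr|rewrite ltrBlDr addrC -ltrBlDr].
pose q k := (sval (cid (ap (complex.Re (w (e k))))), sval (cid (ap (complex.Im (w (e k)))))).
pose b := (n, mkseq q n).
have bw : dual_box b w.
  by move=> k /= kn; rewrite nth_mkseq//= /q /=; case: cid => ? /=; case: cid => ? /=.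
exists b => // w' bw'; apply: hn => k kn.
have [h1 h2] := bw k kn; have [h3 h4] := bw' k kn.
rewrite /normsq !ReD !ImD !ReN !ImN /=.
have tri (x y z : R) (d : R) : `|x - z| < d -> `|y - z| < d -> (y - x) ^+ 2 <= (2 * d) ^+ 2.
  move=> hx hy; have dp : 0 <= d by apply: ltW; apply: le_lt_trans hx.
  rewrite -real_normK ?num_real// ler_sqr ?nnegrE ?mulr_ge0//.
  rewrite (_ : y - x = (y - z) - (x - z)); last by rewrite opprB subrKA.
  by apply: le_trans (ler_normB _ _) _; lra.
apply: le_lt_trans (lerD (tri _ _ _ _ h1 h3) (tri _ _ _ _ h2 h4)) _.
have : 0 < ((2^-1 : R) ^+ n) ^+ 2 by rewrite exprn_gt0// exprn_gt0// invr_gt0.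
set t := 2^-1 ^+ n; rewrite !exprMn; lra.
Qed.

Lemma dual_box_comp_measurable d (T : measurableType d) (f : T -> D) b :
  (forall g, cmeasurable setT (fun x => f x g)) -> measurable (f @^-1` dual_box b).
Proof.
move=> mf.
rewrite (_ : _ @^-1` _ = \bigcap_(k in [set k | (k < b.1)%N])
    ([set x | `|complex.Re (f x (e k)) - ratr (nth (0, 0) b.2 k).1| < 2^-1 ^+ b.1 / 4] `&`
    [set x | `|complex.Im (f x (e k)) - ratr (nth (0, 0) b.2 k).2| < 2^-1 ^+ b.1 / 4])) //.
rewrite bigcap_mkcond; apply: bigcapT_measurable => k; case: ifP => // _.
have mlt (h : T -> R) (c r : R) : measurable_fun setT h ->
    measurable [set x | `|h x - c| < r].
  move=> mh; have mb : measurable_fun setT (fun x => `|h x - c| < r).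
    apply: measurable_fun_ltr; last exact: measurable_cst.
    by apply: measurableT_comp => //; apply: measurable_funB => //; exact: measurable_cst.
  exact: measurable_boolset.
have [m1 m2] := mf (e k).
by apply: measurableI; exact: mlt.
Qed.

(** By second countability the evaluations generate the Borel sigma-algebra. *)
Lemma measurable_to_dual d (T : measurableType d) (f : T -> BD) :
  (forall g, cmeasurable setT (fun x => (f x : D) g)) -> measurable_fun setT f.
Proof.
move=> mf.
have gen : @measurable _ BD = <<s @open D >> by [].
apply: (measurability _ gen) => // _ [Q oQ <-].
rewrite setTI (dual_openE oQ) preimage_bigcup.
by apply: bigcup_countType_measurable => b; exact: dual_box_comp_measurable.
Qed.

Lemma measurable_open (O : set D) : open O -> measurable (O : set BD).
Proof. by move=> oO; exact: sub_sigma_algebra. Qed.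

Lemma cmeasurable_eval g : cmeasurable setT (fun w : BD => (w : D) g).
Proof.
have key (p : R[i] -> R) : (forall z z', p z - p z' <= complex.Re `|z - z'|) ->
    measurable_fun setT (fun w : BD => p ((w : D) g)).
  move=> pL; apply: (measurability _ (RGenOInfty.measurableE R)).
  move=> _ [_ [x ->] <-]; rewrite setTI.
  have oS : open [set w : D | x < p (w g)].
    rewrite openE => w /= xw; have := @eval_continuous g w.
    move=> /cvg_ballP /(_ (p (w g) - x)%:C%C).
    rewrite ltcR subr_gt0 => /(_ xw); apply: filterS => w' /=.
    rewrite -ball_normE /ball_ /= ltcE /= => /andP[_ h].
    have := le_lt_trans (pL _ _) h; lra.
  rewrite (_ : _ @^-1` _ = [set w : BD | x < p ((w : D) g)]).
    exact: measurable_open.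
  by apply/seteqP; split => w /=; rewrite in_itv /= andbT.
split; apply: key => -[a b] [c d]; rewrite normc_def /=.
  apply: le_trans (ler_norm _) _; rewrite -sqrtr_sqr; apply: ler_wsqrtr.
  by rewrite lerDl sqr_ge0.
apply: le_trans (ler_norm _) _; rewrite -sqrtr_sqr; apply: ler_wsqrtr.
by rewrite lerDr sqr_ge0.
Qed.

(** Equality of characters amounts to countably many equalities of values. *)
Lemma measurable_dual_eq d (T : measurableType d) (f h : T -> BD) :
  measurable_fun setT f -> measurable_fun setT h -> measurable [set x | f x = h x].
Proof.
move=> mf mh.
have ev (k : T -> BD) g : measurable_fun setT k -> cmeasurable setT (fun x => (k x : D) g).
  by move=> mk; exact: (cmeasurable_comp (cmeasurable_eval g) mk).
rewrite (_ : [set x | _] = \bigcap_n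
  ([set x | complex.Re ((f x : D) (e n)) == complex.Re ((h x : D) (e n))] `&`
   [set x | complex.Im ((f x : D) (e n)) == complex.Im ((h x : D) (e n))])).
  apply: bigcapT_measurable => n; have [f1 f2] := ev f (e n) mf.
  have [h1 h2] := ev h (e n) mh.
  by apply: measurableI; apply: measurable_boolset; exact: measurable_fun_eqr.
apply/seteqP; split => [x /= fh n _|x /= fh]; first by rewrite /= fh.
apply: dual_eq => g; have [n <-] := e_surj g.
have [/eqP h1 /eqP h2] := fh n I.
by apply/eqP; rewrite eq_complex h1 h2 !eqxx.
Qed.

Lemma measurable_dual_mul d (T : measurableType d) (f h : T -> BD) :
  measurable_fun setT f -> measurable_fun setT h ->
  measurable_fun setT (fun x => ((f x : D) * (h x : D))%g : BD).
Proof.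
move=> mf mh; apply: measurable_to_dual => g /=.
by apply: cmeasurableM; exact: (cmeasurable_comp (cmeasurable_eval g)).
Qed.

Lemma measurable_adjoint (alpha : {additive Gam -> Gam}) :
  measurable_fun setT (adjoint alpha : BD -> BD).
Proof. by apply: measurable_to_dual => g /=; exact: cmeasurable_eval. Qed.

(** The finite intersections of boxes are a countable pi-system that generates
    the Borel sigma-algebra. *)
Definition dual_cell (l : seq (nat * seq (rat * rat))) : set BD :=
  [set w | forall b, b \in l -> dual_box b w].

Lemma measurable_dual_cell l : measurable (dual_cell l).
Proof.
rewrite (_ : dual_cell l = \bigcap_(b in [set b | b \in l]) dual_box b)//.
elim: l => [|b l IH].
  by rewrite (_ : \bigcap_(_ in _) _ = setT)//; apply/seteqP; split.
rewrite (_ : \bigcap_(_ in _) _ = dual_box b `&`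
    \bigcap_(b in [set b | b \in l]) dual_box b).
  apply: measurableI => //; apply: (@dual_box_comp_measurable _ BD id) => g.
  exact: cmeasurable_eval.
apply/seteqP; split => [w h|w [h1 h2] b' /=].
  by split=> [|b' /= b'l]; apply: h => /=; rewrite inE ?eqxx// b'l orbT.
by rewrite inE => /predU1P[->//|]; exact: h2.
Qed.

Lemma dual_cell_generate : @measurable _ BD = <<s range dual_cell >>.
Proof.
apply/seteqP; split; last first.
  apply: smallest_sub; first exact: sigma_algebra_measurable.
  by move=> _ [l _ <-]; exact: measurable_dual_cell.
apply: smallest_sub; first exact: smallest_sigma_algebra.
move=> O oO; rewrite (dual_openE oO).
have := @bigcup_countType_measurable _ (g_sigma_algebraType (range dual_cell)) _
  [set b | dual_box b `<=` O] dual_box; apply => b.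
apply: sub_sigma_algebra; exists [:: b] => //.
apply/seteqP; split => [w h|w h b' ]; first by apply: h; rewrite inE.
by rewrite inE => /eqP ->.
Qed.

Lemma dual_cellI : setI_closed (range dual_cell).
Proof.
move=> _ _ [l _ <-] [l' _ <-]; exists (l ++ l') => //.
apply/seteqP; split => [w h|w [h h'] b].
  by split=> b bl; apply: h; rewrite mem_cat bl ?orbT.
by rewrite mem_cat => /orP[/h|/h'].
Qed.

End dual_borel.

(** * Measurable families of characters *)

Section circle_group.
Context d (T : measurableType d) {R : realType}.

Record circle := Circle { circle_fun :> T -> R[i]; circleP : unimodular circle_fun }.

Lemma circle_eq (f g : circle) : f =1 g -> f = g.
Proof.
case: f g => [f hf] [g hg] /= /funext fg; case: _ / fg in hg *.
by congr Circle; exact: Prop_irrelevance.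
Qed.

Lemma unimodular1 : unimodular (fun=> 1 : R[i]) (Y := T).
Proof. by split; [exact: cmeasurable_cst|move=> x; rewrite normr1]. Qed.

Lemma unimodularM (f g : T -> R[i]) : unimodular f -> unimodular g ->
  unimodular (fun x => f x * g x).
Proof.
move=> [mf f1] [mg g1]; split; first exact: cmeasurableM.
by move=> x; rewrite normrM f1 g1 mulr1.
Qed.

Definition circle1 := Circle unimodular1.
Definition circleM (f g : circle) := Circle (unimodularM (circleP f) (circleP g)).
Definition circleV (f : circle) := Circle (unimodularV (circleP f)).

HB.instance Definition _ := gen_eqMixin circle.
HB.instance Definition _ := gen_choiceMixin circle.

Lemma circleMA : associative circleM.
Proof. by move=> f g h; apply: circle_eq => x /=; rewrite mulrA. Qed.
Lemma circleMC : commutative circleM.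
Proof. by move=> f g; apply: circle_eq => x /=; rewrite mulrC. Qed.
Lemma circle1M : left_id circle1 circleM.
Proof. by move=> f; apply: circle_eq => x /=; rewrite mul1r. Qed.
Lemma circleVM : left_inverse circle1 circleV circleM.
Proof.
move=> f; apply: circle_eq => x /=.
by rewrite mulrC -normCK (circleP f).2 expr1n.
Qed.

(* written additively, so that [divisible_extension] applies *)
HB.instance Definition _ := GRing.isZmodule.Build circle circleMA circleMC
  circle1M circleVM.

Lemma circleDE (f g : circle) x : (f + g) x = f x * g x. Proof. by []. Qed.
Lemma circleMnE (f : circle) n x : (f *+ n) x = f x ^+ n.
Proof.
elim: n => [|n IH]; first by rewrite mulr0n expr0.
by rewrite mulrS circleDE IH exprS.
Qed.

Lemma circle_divisible n (f : circle) : (0 < n)%N -> exists g : circle, g *+ n = f.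
Proof.
move=> n0; exists (Circle (unimodular_croot n (circleP f))).
apply: circle_eq => x; rewrite circleMnE /=.
by rewrite crootK// (circleP f).2.
Qed.

End circle_group.

Section character_extension.
Context {R : realType} {Gam : zmodType}.
Local Notation D := (dual R Gam).
Local Notation BD := (borel_dual R Gam).
Variable e : nat -> Gam.
Hypothesis e_surj : forall g, exists n, e n = g.

Lemma dual0 (w : D) : w 0 = 1.
Proof.
have := dualD w 0 0; rewrite addr0 => /(congr1 (fun z => z / w 0)).
by rewrite mulfK ?dual_neq0// divff ?dual_neq0.
Qed.

(** A homomorphism from [Gam] to the group of measurable maps from [T] to the
    circle is the same as a measurable map from [T] to the dual group. *)
Lemma measurable_character_extension d (T : measurableType d)
  (G : set (Gam * circle T (R:=R))) : partial_hom G ->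
  exists s : T -> BD, measurable_fun setT s /\
    forall g u, G (g, u) -> forall x, (s x : D) g = u x.
Proof.
move=> hG.
have [f [fD fG]] := divisible_extension (fun n u => @circle_divisible _ T R n u) hG.
have s1 x g : `|f g x| = 1 by exact: (circleP (f g)).2.
have s2 x g h : f (g + h) x = f g x * f h x by rewrite fD.
exists (fun x => Dual (s1 x) (s2 x)); split.
  by apply: (measurable_to_dual e_surj) => g /=; exact: (circleP (f g)).1.
by move=> g u /fG /= <-.
Qed.

(** Send [g] to some z <> 1 with z^n = 1 whenever n g = 0, and extend. *)
Lemma separating_character (g : Gam) : g != 0 -> exists w : D, w g != 1.
Proof.
move=> g0.
(* any pointed parameter space would do: the character is the value at a point *)
pose G0 : set (Gam * circle BD (R:=R)) := [set p | p = 0].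
have hG0 : partial_hom G0.
  split=> //; first by move=> p q -> ->; rewrite subrr.
  by move=> u [].
have cst (z : R[i]) : `|z| = 1 -> unimodular (fun=> z) (Y := BD).
  by move=> z1; split=> //; exact: cmeasurable_cst.
(* z is a root of 1 of the same order as g, or -1 if g has infinite order *)
have [z [z1 zn1 hz]] : exists z : R[i], [/\ `|z| = 1, z != 1 &
    forall n : nat, g *+ n = 0 -> z ^+ n = 1].
  case: (pselect (exists n, (0 < n)%N /\ g *+ n = 0)) => [exn|nex]; last first.
    exists (-1); split; first by rewrite normrN normr1.
      by rewrite eq_sym -addr_eq0 -[1 + 1]/(2%:R) pnatr_eq0.
    move=> [|n] gn; first by rewrite expr0.
    by exfalso; apply: nex; exists n.+1.
  have exb : exists n, (0 < n)%N && (g *+ n == 0).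
    by have [n [n0 /eqP gn]] := exn; exists n; rewrite n0 gn.
  case: (ex_minnP exb) => n /andP[n0 /eqP gn] nmin.
  have n1 : (1 < n)%N.
    by case: n n0 gn {nmin} => [//|[|//]] _; rewrite mulr1n => /eqP; rewrite (negbTE g0).
  have [z [z1 zn1 zn]] := @nontrivial_root R n n1.
  exists z; split=> // k gk.
  have : (n %| k)%N.
    rewrite /dvdn -leqn0 leqNgt; apply/negP => r0.
    have : (n <= k %% n)%N.
      apply: nmin; rewrite r0 /=; move: gk; rewrite {1}(divn_eq k n) mulrnDr mulnC mulrnA gn.
      by rewrite mul0rn add0r => ->.
    by rewrite leqNgt ltn_pmod.
  by move=> /dvdnP[q ->]; rewrite mulnC exprM zn expr1n.
pose u := Circle (cst z z1).
have hu (n : int) v : G0 (g *~ n, v) -> v = u *~ n.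
  move=> [+ ->]; case: n => n; rewrite ?NegzE ?mulrNz => gn.
    by apply/esym/circle_eq => x; rewrite circleMnE hz.
  apply/esym/eqP; rewrite oppr_eq0; apply/eqP/circle_eq => x.
  rewrite circleMnE hz//; move/eqP: gn; rewrite oppr_eq0 => /eqP.
  by [].
have [G hG [_ Gu]] := partial_hom_extend1 hG0 hu.
have [s [_ hs]] := measurable_character_extension hG.
by exists (s point); rewrite (hs _ _ Gu).
Qed.

Variable alpha : {additive Gam -> Gam}.
Hypothesis alpha_inj : injective alpha.

(** The map that sends [alpha h] to the function w |-> w h is a homomorphism on
    the range of [alpha], because [alpha] is injective. An extension to [Gam]
    chooses measurably, for every w, a character whose composition with [alpha]
    is w. *)
Lemma adjoint_section : exists s : BD -> BD, measurable_fun setT s /\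
  forall w, adjoint alpha (s w) = w.
Proof.
have ev g : unimodular (fun w : BD => (w : D) g).
  by split; [exact: cmeasurable_eval|move=> w; exact: dual_unit].
pose G : set (Gam * circle BD (R:=R)) :=
  [set p | exists2 h, p.1 = alpha h & p.2 = Circle (ev h)].
have hG : partial_hom G.
  split.
  - exists 0; first by rewrite raddf0.
    by apply: circle_eq => w /=; rewrite dual0.
  - move=> [p1 p2] [q1 q2] [h /= -> ->] [k /= -> ->]; exists (h - k).
      by rewrite /= raddfB.
    apply: circle_eq => w; rewrite -[LHS]/((w : D) h * Num.conj ((w : D) k)) /=.
    have := dualD w (h - k) k; rewrite subrK => ->.
    by rewrite -mulrA -normCK dual_unit expr1n mulr1.
  - move=> u [h /= ah ->]; have -> : h = 0 by apply: alpha_inj; rewrite -ah raddf0.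
    by apply: circle_eq => w /=; rewrite dual0.
have [s [ms hs]] := measurable_character_extension hG.
exists s; split=> // w; apply: dual_eq => g /=.
by rewrite (hs (alpha g) (Circle (ev g)))//; exists g.
Qed.

Lemma adjointM (w z : D) : adjoint alpha (w * z)%g = (adjoint alpha w * adjoint alpha z)%g.
Proof. exact: dual_eq. Qed.

Lemma dualC (w z : D) : (w * z)%g = (z * w)%g.
Proof. by apply: dual_eq => g /=; exact: mulrC. Qed.

Lemma dualX (w : D) g n : w (g *+ n) = w g ^+ n.
Proof.
elim: n => [|n IH]; last by rewrite mulrS dualD IH exprS.
by rewrite mulr0n expr0 dual0.
Qed.

(** A character in the kernel is determined by its values at N coset
    representatives of the range of [alpha], and these values are N!-th
    roots of 1, since N! annihilates the quotient of [Gam] by that range. *)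
Lemma kernel_finite N : range_index alpha N ->
  finite_set [set w : D | adjoint alpha w = 1%g].
Proof.
move=> /card_set_bijP[f [fI finj fsurj]].
pose C g : set Gam := [set g + alpha h | h in [set: Gam]].
have CN g : (f (C g) < N)%N by apply: (fI (C g)); exists g.
have CE g k : f (C g) = f (C k) -> exists h, g = k + alpha h.
  move=> fgk; have CC : C g = C k by apply: finj => //; rewrite inE; [exists g|exists k].
  have : C g g by exists 0 => //; rewrite raddf0 addr0.
  by rewrite CC => -[h _ <-]; exists h.
have expo g : exists h, g *+ N`! = alpha h.
  (* by the pigeonhole principle two of the multiples 0 g, ..., N g are in one coset *)
  pose F (i : 'I_N.+1) : 'I_N := Ordinal (CN (g *+ i)).
  have /injectivePn[i [j ij Fij]] : ~~ injectiveb F.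
    apply/negP => /injectiveP /leq_card; rewrite !card_ord.
    by rewrite ltnn.
  wlog ltij : i j ij Fij / (i < j)%N.
    move=> hw; have [|ji|/val_inj eij] := ltngtP i j; first exact: hw.
      by apply: hw ji; [rewrite eq_sym|].
    by rewrite eij eqxx in ij.
  have [h hE] : exists h, g *+ j = g *+ i + alpha h.
    by apply: CE; apply: esym; exact: (congr1 val Fij).
  have gh : g *+ (j - i) = alpha h.
    by rewrite mulrnBr 1?ltnW// hE addrC addKr.
  have /dvdnP[q ->] : (j - i %| N`!)%N.
    apply: dvdn_fact; rewrite subn_gt0 ltij /=.
    by rewrite (leq_trans (leq_subr _ _))// -ltnS.
  by exists (h *+ q); rewrite mulnC mulrnA gh raddfMn.
have reps : exists r : nat -> Gam, forall g, exists n h, (n < N)%N /\ g = r n + alpha h.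
  pose r n := if pselect (exists g, f (C g) = n) is left h then sval (cid h) else 0.
  exists r => g; have [h hE] : exists h, g = r (f (C g)) + alpha h.
    apply: CE; rewrite /r; case: pselect => [k|]; last by case; exists g.
    by case: cid.
  by exists (f (C g)), h.
have [r hr] := reps.
pose p : {poly R[i]} := 'X^(N`!) - 1.
have [rs hrs] := closed_field_poly_normal p.
have p0 : p != 0 by rewrite -size_poly_gt0 size_XnsubC// fact_gt0.
have rootrs z : z ^+ N`! = 1 -> z \in rs.
  move=> z1; have : root p z by rewrite /root /p !hornerE z1 subrr eqxx.
  by rewrite hrs rootZ ?lead_coef_eq0// root_prod_XsubC.
pose G (w : D) : {ffun 'I_N -> 'I_(size rs).+1} := [ffun i : 'I_N => inord (index (w (r i)) rs)].
set K := [set _ | _].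
have Ginj : {in K &, injective G}.
  move=> w z; rewrite !inE /K /= => wK zK GE; apply: dual_eq => g.
  have [n [h [nN ->]]] := hr g; rewrite !dualD.
  have ker (v : D) k : adjoint alpha v = 1%g -> v (alpha k) = 1.
    by move=> /(congr1 (fun v : D => v k)).
  have kerE (v : D) k : adjoint alpha v = 1%g -> v k \in rs.
    by move=> vK; apply: rootrs; rewrite -dualX; have [h' ->] := expo k; exact: ker.
  rewrite !ker// !mulr1.
  move: (congr1 (fun F : {ffun 'I_N -> 'I_(size rs).+1} => nat_of_ord (F (Ordinal nN))) GE).
  rewrite !ffunE !inordK ?ltnS ?index_size// => /(congr1 (nth 0 rs)).
  by rewrite !nth_index ?kerE.
have /card_eqPle[_ KG] := inj_card_eq Ginj.
exact: card_le_finite KG finite_finset.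
Qed.

End character_extension.

(** * Haar measure and the fibres of the adjoint *)

Section kernel_fibers.
Context {R : realType} {Gam : zmodType}.
Local Notation D := (dual R Gam).
Local Notation BD := (borel_dual R Gam).
Variables (alpha : {additive Gam -> Gam}) (ks : seq D).
Hypothesis ks_uniq : uniq ks.
Hypothesis ksP : forall w : D, (w \in ks) = (adjoint alpha w == 1%g).

Lemma adjoint_fiber (w z0 : D) : adjoint alpha z0 = w ->
  forall z, adjoint alpha z = w <-> exists2 k, k \in ks & z = (z0 * k)%g.
Proof.
move=> z0w z; split=> [zw|[k]].
  exists (z0^-1 * z)%g; last by rewrite mulVKg.
  rewrite ksP; apply/eqP; apply: dual_eq => g /=.
  have := congr1 (fun v : D => v g) zw; have := congr1 (fun v : D => v g) z0w.
  by move=> /= -> ->; rewrite mulVf// dual_neq0.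
by rewrite ksP => /eqP k1 ->; rewrite adjointM k1 mulg1.
Qed.

Lemma perm_fiber (z z' : D) : adjoint alpha z = adjoint alpha z' ->
  perm_eq [seq (z * k)%g | k <- ks] [seq (z' * k)%g | k <- ks].
Proof.
move=> zz'; apply: uniq_perm; try by rewrite map_inj_uniq//; exact: mulgI.
move=> x; apply/mapP/mapP.
  move=> h; apply/(adjoint_fiber (erefl (adjoint alpha z'))).
  by rewrite -zz'; apply/(adjoint_fiber (erefl (adjoint alpha z))).
move=> h; apply/(adjoint_fiber (erefl (adjoint alpha z))).
by rewrite zz'; apply/(adjoint_fiber (erefl (adjoint alpha z'))).
Qed.

Lemma fiber_sumE (m : D -> nat) (w z : D) : adjoint alpha z = w ->
  fiber_sum alpha m w = \sum_(k <- ks) m (z * k)%g.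
Proof.
move=> zw; rewrite /fiber_sum.
rewrite (_ : [set z | _] = [set` [seq (z * k)%g | k <- ks]]).
  by rewrite -fsbig_seq ?big_map// map_inj_uniq//; exact: mulgI.
apply/seteqP; split=> x /=.
  by move=> /(adjoint_fiber zw)[k kks ->]; exact: map_f.
by move=> /mapP h; apply/(adjoint_fiber zw).
Qed.

End kernel_fibers.

Section kernel_size.
Context {R : realType} {Gam : zmodType}.
Local Notation D := (dual R Gam).
Variable e : nat -> Gam.
Hypothesis e_surj : forall g, exists n, e n = g.
Variables (alpha : {additive Gam -> Gam}) (ks : seq D).
Hypothesis ks_uniq : uniq ks.
Hypothesis ksP : forall w : D, (w \in ks) = (adjoint alpha w == 1%g).

Lemma adjoint1 : adjoint alpha (1%g : D) = 1%g.
Proof. exact: dual_eq. Qed.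

(** If the kernel were trivial, so would be the kernels of the iterates; but the
    set of the characters that differ from 1 at some [g] is open, and nonempty
    by [separating_character]. *)
Lemma kernel_size_gt1 : (exists g : Gam, g != 0) ->
  dense (\bigcup_(n in [set n | (1 <= n)%N])
    [set w : D | iter n (adjoint alpha) w = 1%g]) -> (1 < size ks)%N.
Proof.
move=> [g g0] kd; rewrite ltnNge; apply/negP => ks1.
have k1 (w : D) : adjoint alpha w = 1%g -> w = 1%g.
  move=> w1; have : w \in ks by rewrite ksP w1.
  have : (1%g : D) \in ks by rewrite ksP adjoint1.
  case: ks ks1 => [//|k [|//]] _; rewrite !mem_seq1.
  by move=> /eqP k1 /eqP wk; rewrite wk k1.
have [w wg] := separating_character (R := R) e_surj g0.
have [||z [zg [n _ zn]]] := kd [set z : D | z g != 1].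
- by exists w.
- apply: (@open_comp _ _ (fun z : D => z g) [set t | t != 1]).
    by move=> z _; exact: eval_continuous.
  rewrite openE => t /= t1; apply/nbhs_ballP; exists `|t - 1| => /=.
    by rewrite normr_gt0 subr_eq0.
  move=> y; rewrite -ball_normE /ball_ /= => ty; apply/eqP => y1.
  by rewrite y1 ltxx in ty.
have it j (v : D) : iter j (adjoint alpha) v = 1%g -> v = 1%g.
  by elim: j v => [//|j IH] v; rewrite iterSr => /IH /k1.
have z1 : z = 1%g := it _ _ zn.
by move: zg; rewrite /= z1 /= eqxx.
Qed.

End kernel_size.

Section haar.
Context {R : realType} {Gam : zmodType}.
Local Notation D := (dual R Gam).
Local Notation BD := (borel_dual R Gam).
Variable e : nat -> Gam.
Hypothesis e_surj : forall g, exists n, e n = g.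
Variable lambda : probability BD R.
Hypothesis haar : normalized_haar lambda.
Variables (alpha : {additive Gam -> Gam}) (s : BD -> BD).
Hypothesis ms : measurable_fun setT s.
Hypothesis sK : forall w, adjoint alpha (s w) = w.
Local Open Scope ereal_scope.

Lemma measurable_translate (z : D) : measurable_fun setT (fun w : BD => (z * w)%g : BD).
Proof. by apply: (measurable_dual_mul e_surj); [exact: measurable_cst|exact: measurable_id]. Qed.

Lemma haar_preimage (z : D) (A : set BD) : measurable A ->
  lambda [set w | A (z * w)%g] = lambda A.
Proof.
move=> mA; rewrite -(haar z^-1%g mA); congr (lambda _).
apply/seteqP; split => [w Aw|_ [w Aw <-]] /=; last by rewrite mulVKg.
by exists (z * w)%g => //; rewrite mulKg.
Qed.

Lemma haar_integral (z : D) (F : BD -> \bar R) : measurable_fun setT F ->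
  (forall w, 0 <= F w) -> \int[lambda]_w F (z * w)%g = \int[lambda]_w F w.
Proof.
move=> mF F0.
rewrite -(@ge0_integral_pushforward _ _ BD BD R _ (measurable_translate z) lambda setT F)//.
apply: eq_measure_integral; first exact: (measurable_translate z).
by move=> /= _ A mA _; exact: (haar_preimage z mA).
Qed.

(** Uniqueness of Haar measure, applied to the image of [lambda] under the
    adjoint. Integrate the indicator of [x * adjoint y \in A] in both orders:
    since x = adjoint (s x), translation invariance evaluates the integral over
    y to the measure of the preimage of [A], and that over x to that of [A]. *)
Lemma haar_adjoint (A : set BD) : measurable A ->
  lambda (adjoint alpha @^-1` A) = lambda A.
Proof.
move=> mA.
have madj : measurable_fun setT (adjoint alpha : BD -> BD) by exact: measurable_adjoint.
pose P : set (BD * BD) := [set p | A ((p.1 : D) * (adjoint alpha p.2 : D))%g].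
have mP : measurable P.
  rewrite -[P]setTI; have : measurable_fun setT
    (fun p : BD * BD => ((p.1 : D) * (adjoint alpha p.2 : D))%g : BD).
    apply: (measurable_dual_mul e_surj); first exact: measurable_fst.
    by apply: (measurableT_comp madj); exact: measurable_snd.
  by move=> /(_ measurableT A mA).
have := @indic_fubini_tonelli _ _ BD BD R lambda lambda P mP.
have E1 x : \int[lambda]_y (\1_P (x, y))%:E = lambda (adjoint alpha @^-1` A).
  have mPx : measurable [set y : BD | A ((x : D) * (adjoint alpha y : D))%g].
    rewrite -[X in measurable X]setTI.
    have : measurable_fun setT (fun y : BD => ((x : D) * (adjoint alpha y : D))%g : BD).
      by apply: (measurableT_comp (measurable_translate x)).
    by move=> /(_ measurableT A mA).
  rewrite (_ : (fun y => (\1_P (x, y))%:E) =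
      EFin \o \1_[set y : BD | A ((x : D) * (adjoint alpha y : D))%g]); last first.
    by apply/funext => y; rewrite /= !indicE; congr (_%:R%:E).
  rewrite integral_indic// setIT.
  have mB : measurable (adjoint alpha @^-1` A : set BD).
    by rewrite -[X in measurable X]setTI; exact: madj.
  rewrite -(haar_preimage (s x) mB).
  congr (lambda _); apply/seteqP; split => y /=; by rewrite adjointM sK.
have E2 y : \int[lambda]_x (\1_P (x, y))%:E = lambda A.
  rewrite (_ : (fun x => (\1_P (x, y))%:E) =
      EFin \o \1_[set x : BD | A ((adjoint alpha y : D) * x)%g]); last first.
    apply/funext => x; rewrite /= !indicE; congr (_%:R%:E).
    by congr (nat_of_bool _); apply/idP/idP; rewrite !inE /P /= dualC.
  rewrite integral_indic//; first by rewrite setIT; exact: (haar_preimage (adjoint alpha y) mA).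
  by have := measurable_translate (adjoint alpha y) measurableT mA; rewrite setTI.
rewrite /fubini_F /fubini_G /=.
under eq_integral do rewrite E1.
under [RHS]eq_integral do rewrite E2.
rewrite !integral_cst// => h.
have pT : lambda setT = 1 := probability_setT lambda.
by rewrite -[LHS]mule1 -[RHS]mule1 -pT; exact: h.
Qed.

Variable ks : seq D.
Hypothesis ks_uniq : uniq ks.
Hypothesis ksP : forall w : D, (w \in ks) = (adjoint alpha w == 1%g).

(** By [haar_adjoint] the integrand may be composed with the adjoint; it becomes
    the sum of the values of [F] over the fibre through w, whose points are the
    translates of w by the kernel. *)
Lemma fiber_integral (F : BD -> \bar R) : measurable_fun setT F ->
  (forall w, 0 <= F w) ->
  \int[lambda]_w (\sum_(k <- ks) F ((s w : D) * k)%g) =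
  (size ks)%:R%:E * \int[lambda]_w F w.
Proof.
move=> mF F0.
pose G (w : BD) := \sum_(k <- ks) F ((s w : D) * k)%g.
have mG : measurable_fun setT G.
  apply: emeasurable_sum => k.
  apply: (measurableT_comp mF).
  by apply: (measurable_dual_mul e_surj); [exact: ms|exact: measurable_cst].
have G0 w : 0 <= G w by rewrite sume_ge0.
have madj : measurable_fun setT (adjoint alpha : BD -> BD) by exact: measurable_adjoint.
have GE : \int[lambda]_w G (adjoint alpha w) = \int[lambda]_w G w.
  rewrite -(@ge0_integral_pushforward _ _ BD BD R _ madj lambda setT G)//.
  apply: eq_measure_integral.
  by move=> A mA _; exact: haar_adjoint.
rewrite -[LHS]/(\int[lambda]_w G w) -GE.
transitivity (\int[lambda]_w (\sum_(k <- ks) F (k * (w : D))%g)).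
  apply: eq_integral => w _; rewrite /G.
  have pE := perm_fiber ks_uniq ksP (sK (adjoint alpha w)).
  transitivity (\sum_(z <- [seq ((s (adjoint alpha w) : D) * k)%g | k <- ks]) F z).
    by rewrite big_map.
  rewrite (perm_big _ pE) big_map; apply: eq_bigr => k _.
  by rewrite dualC.
rewrite ge0_integral_sum//; last first.
  by move=> k; exact: (measurableT_comp mF (measurable_translate k)).
rewrite (eq_bigr (fun=> \int[lambda]_w F w)); last first.
  by move=> k _; exact: haar_integral.
have I0 : 0 <= \int[lambda]_w F w by exact: integral_ge0.
elim: ks => [|k l IH]; first by rewrite big_nil mul0e.
by rewrite big_cons IH /= -[(size l).+1]add1n natrD EFinD ge0_muleDl ?mul1e.
Qed.

End haar.

(** * Discrete-valued maps and sums of layers *)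

Section discrete_measurability.
Context d (T : measurableType d).

(** Measurability of a map into a countable type on which no sigma-algebra has
    been chosen. *)
Definition dmeas (C : countType) (f : T -> C) :=
  forall c, measurable [set x | f x = c].

Lemma dmeas_set (C : countType) (f : T -> C) (P : set C) :
  dmeas f -> measurable [set x | P (f x)].
Proof.
move=> mf; rewrite (_ : [set x | _] = \bigcup_(c in P) [set x | f x = c]).
  exact: bigcup_countType_measurable.
by apply/seteqP; split => [x Px|x [c Pc /= ->]//]; exists (f x).
Qed.

Lemma dmeas_comp (C C' : countType) (f : T -> C) (h : C -> C') :
  dmeas f -> dmeas (fun x => h (f x)).
Proof. by move=> mf c; exact: (dmeas_set (fun c' => h c' = c)). Qed.

Lemma dmeas_pair (C C' : countType) (f : T -> C) (g : T -> C') :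
  dmeas f -> dmeas g -> dmeas (fun x => (f x, g x)).
Proof.
move=> mf mg [c c']; rewrite (_ : [set x | _] = [set x | f x = c] `&` [set x | g x = c']).
  exact: measurableI.
by apply/seteqP; split => x /= [-> ->].
Qed.

Lemma dmeas_nat (f : T -> nat) : measurable_fun setT f <-> dmeas f.
Proof.
split=> [mf c|mf _ A _].
  by have := mf measurableT [set c] I; rewrite setTI.
by rewrite setTI; exact: dmeas_set.
Qed.

Lemma dmeas_map (I : eqType) (s : seq I) (f : I -> T -> nat) :
  (forall i, dmeas (f i)) -> dmeas (fun x => [seq f i x | i <- s]).
Proof.
move=> mf; elim: s => [|i s IH] /=.
  by move=> c; case: (eqVneq [::] c) => [<-|/eqP h];
    [rewrite (_ : [set x | _] = setT)|rewrite (_ : [set x | _] = set0)] => //;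
    apply/seteqP; split.
exact: (dmeas_comp (fun p => p.1 :: p.2) (dmeas_pair (mf i) IH)).
Qed.

Lemma dmeas_measurable_fun d' (T' : measurableType d') (C : countType)
  (f : T -> C) (h : C -> T') : dmeas f -> measurable_fun setT (fun x => h (f x)).
Proof. by move=> mf _ A _; rewrite setTI; exact: (dmeas_set (fun c => A (h c))). Qed.

End discrete_measurability.

Lemma dmeas_precomp d (T : measurableType d) d' (T' : measurableType d')
  (C : countType) (f : T' -> C) (g : T -> T') :
  measurable_fun setT g -> dmeas f -> dmeas (fun x => f (g x)).
Proof. by move=> mg mf c; have := mg measurableT _ (mf c); rewrite setTI. Qed.

Lemma dmeas_ltn d (T : measurableType d) (f g : T -> nat) : dmeas f -> dmeas g ->
  dmeas (fun x => (f x < g x)%N).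
Proof. by move=> mf mg; exact: (dmeas_comp (fun p => p.1 < p.2)%N (dmeas_pair mf mg)). Qed.

(** [flatten_index] numbers consecutively the pairs (j, i) of a row and a
    position in that row. *)
Lemma sum_flatten_index (V : nmodType) (G : nat -> V) (sh : seq nat) :
  \sum_(0 <= j < size sh) \sum_(0 <= i < nth 0%N sh j) G (flatten_index sh j i) =
  \sum_(0 <= p < sumn sh) G p.
Proof.
elim: sh G => [|n sh IH] G; first by rewrite !big_geq.
rewrite [LHS]big_nat_recl//= [RHS](@big_cat_nat _ _ _ n)//= ?leq_addr//.
congr (_ + _).
rewrite -[in RHS](add0n n) big_addn addKn -(IH (fun p => G (p + n)%N)).
by apply: eq_bigr => j _; apply: eq_bigr => i _; congr G; rewrite /flatten_index /= -addnA addnC.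
Qed.

Section restricted_measure.
Context d (T : measurableType d) {R : realType}.
Variable mu : {measure set T -> \bar R}.
Local Open Scope ereal_scope.

Lemma ge0_integral_mrestr (D : set T) (mD : measurable D) (F : T -> \bar R) :
  measurable_fun setT F -> (forall x, 0 <= F x) ->
  \int[mrestr mu mD]_x F x = \int[mu]_(x in D) F x.
Proof.
move=> mF F0; rewrite -(setUv D) ge0_integral_setU//; last 3 first.
- exact: measurableC.
- by rewrite setUv.
- by apply/disj_setPCl.
rewrite [X in _ + X](_ : _ = 0) ?adde0.
  by apply: eq_measure_integral => A mA AD /=; rewrite /mrestr setIidl.
rewrite (@eq_measure_integral _ _ _ _ mzero)//=.
  by rewrite integral_measure_zero.
move=> A mA AD; rewrite /mrestr /mzero /=; rewrite (_ : A `&` D = set0) ?measure0//.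
by apply/seteqP; split => x // [/AD].
Qed.

End restricted_measure.

Lemma nneseries_finite {R : realType} (u : nat -> \bar R) n :
  (forall i, 0 <= u i)%E -> (forall i, (n <= i)%N -> u i = 0%E) ->
  (\sum_(i <oo) u i = \sum_(0 <= i < n) u i)%E.
Proof.
move=> u0 un; rewrite (nneseries_split 0 n)//= add0n.
by rewrite [X in (_ + X)%E](_ : _ = 0%E) ?adde0// eseries0// => i ni _; exact: un.
Qed.

Lemma nneseries_shift {R : realType} (u : nat -> \bar R) : (forall i, 0 <= u i)%E ->
  (\sum_(i <oo) u i = u 0%N + \sum_(i <oo) u i.+1)%E.
Proof.
move=> u0; rewrite (nneseries_split 0 1)//= add0n big_nat1; congr (_ + _)%E.
by rewrite -(nneseries_addn 1%N)//; apply: eq_eseriesr => i _; rewrite addn1.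
Qed.

Lemma nneseries_restrict (T : Type) {R : realType} (n : T -> nat)
  (G : nat -> T -> \bar R) x : (forall i, 0 <= G i x)%E ->
  (\sum_(i <oo) (G i \_ [set x | (i < n x)%N]) x = \sum_(0 <= i < n x) G i x)%E.
Proof.
move=> G0; rewrite (@nneseries_finite _ _ (n x)).
- apply: eq_big_nat => i /andP[_ ix]; rewrite patchE ifT//.
  exact: mem_set.
- by move=> i; rewrite patchE; case: ifP.
move=> i ni; rewrite patchE ifF//; apply/negbTE; rewrite notin_setE /=.
by apply/negP; rewrite -leqNgt.
Qed.

(** Both sides integrate over the region under the graph of [n], layer by layer
    on the left and point by point on the right. *)
Lemma sum_integral_finite d (T : measurableType d) {R : realType}
  (mu : {measure set T -> \bar R}) (n : T -> nat) (G : nat -> T -> \bar R) :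
  dmeas n -> (forall i, measurable_fun setT (G i)) -> (forall i x, 0 <= G i x)%E ->
  (\sum_(i <oo) \int[mu]_(x in [set x | (i < n x)%N]) G i x =
   \int[mu]_x \sum_(0 <= i < n x) G i x)%E.
Proof.
move=> mn mG G0.
have mS i : measurable [set x | (i < n x)%N] by exact: (dmeas_set (fun k => i < k)%N).
under eq_eseriesr do rewrite integral_mkcond.
rewrite -integral_nneseries//; last 2 first.
- by move=> i; apply/(measurable_restrictT _ (mS i)); exact: measurable_funTS.
- by move=> i x _; rewrite patchE; case: ifP.
by apply: eq_integral => x _; exact: nneseries_restrict.
Qed.

Lemma measurable_sum_finite d (T : measurableType d) {R : realType}
  (n : T -> nat) (G : nat -> T -> \bar R) :
  dmeas n -> (forall i, measurable_fun setT (G i)) -> (forall i x, 0 <= G i x)%E ->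
  measurable_fun setT (fun x => \sum_(0 <= i < n x) G i x)%E.
Proof.
move=> mn mG G0.
have mS i : measurable [set x | (i < n x)%N] by exact: (dmeas_set (fun k => i < k)%N).
rewrite (_ : (fun x => _) =
    (fun x => \sum_(i <oo) (G i \_ [set x | (i < n x)%N]) x)%E).
  apply: ge0_emeasurable_sum => [i x _ _|i _]; first by rewrite patchE; case: ifP.
  by apply/(measurable_restrictT _ (mS i)); exact: measurable_funTS.
by apply/funext => x; rewrite nneseries_restrict.
Qed.

Lemma dmeas_cst d (T : measurableType d) (C : countType) (c : C) :
  dmeas (fun _ : T => c).
Proof.
move=> c'; case: (eqVneq c c') => [->|/eqP h].
  by rewrite (_ : [set x | _] = setT)//; apply/seteqP; split.
by rewrite (_ : [set x | _] = set0)//; apply/seteqP; split.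
Qed.

Lemma nneseries_term_le {R : realType} (u : nat -> \bar R) k :
  (forall i, 0 <= u i)%E -> (u k <= \sum_(i <oo) u i)%E.
Proof.
move=> u0; apply: le_trans (nneseries_lim_ge k.+1 (fun i _ _ => u0 i)).
by rewrite big_nat_recr//= leeDr// sume_ge0.
Qed.

(** * Measures on towers of layers *)

Section push_measure.
Context d (T : measurableType d) d' (T' : measurableType d') {R : realType}.
Variables (mu : {measure set T -> \bar R}) (f : T -> T') (mf : measurable_fun setT f).

(** The pushforward, with its structure of measure fixed by [mf]. *)
Definition image_measure : {measure set T' -> \bar R}.
Proof. unshelve refine (pushforward mu f : {measure set T' -> \bar R}); exact: mf. Defined.

Local Open Scope ereal_scope.

Lemma image_measure_integral (D : set T') (F : T' -> \bar R) : measurable D ->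
  measurable_fun setT F -> (forall y, 0 <= F y) ->
  \int[image_measure]_(y in D) F y = \int[mu]_(x in f @^-1` D) F (f x).
Proof.
move=> mD mF F0; apply: (@ge0_integral_pushforward _ _ T T' R f mf mu D F) => //.
exact: measurable_funTS.
Qed.

End push_measure.

Section tower_space.
Context d (T : measurableType d) {R : realType}.
Variable lambda : {measure set T -> \bar R}.
Variables (mult : nat -> T -> nat) (wt : nat -> {nonneg R}).
Hypothesis mmult : forall n, dmeas (mult n).
Local Open Scope ereal_scope.

(** Slab [n] of the tower is the region under the graph of [mult n], cut into
    its unit layers; it carries [wt n] times the measure of the base. *)
Definition tower : set (nat * (nat * T)) := [set y | (y.2.1 < mult y.1 y.2.2)%N].

Definition layer n i (z : T) : nat * (nat * T) := (n, (i, z)).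

Lemma measurable_layer n i : measurable_fun setT (layer n i).
Proof.
apply: measurable_fun_pair; first exact: measurable_cst.
by apply: measurable_fun_pair; [exact: measurable_cst|exact: measurable_id].
Qed.

Lemma dmeas_slab : dmeas (fun y : nat * (nat * T) => y.1).
Proof. by apply/dmeas_nat; exact: measurable_fst. Qed.

Lemma dmeas_level : dmeas (fun y : nat * (nat * T) => y.2.1).
Proof. by apply/dmeas_nat; apply: (measurableT_comp measurable_fst); exact: measurable_snd. Qed.

Lemma measurable_base : measurable_fun setT (fun y : nat * (nat * T) => y.2.2).
Proof. by apply: (measurableT_comp measurable_snd); exact: measurable_snd. Qed.

Lemma dmeas_layers (C : countType) (f : nat * (nat * T) -> C) :
  (forall n i, dmeas (fun z => f (layer n i z))) -> dmeas f.
Proof.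
move=> mf c; rewrite (_ : [set y | _] = \bigcup_(q in [set: nat * nat])
  ([set y | (y.1, y.2.1) = q] `&`
   (fun y => y.2.2) @^-1` [set z | f (layer q.1 q.2 z) = c])).
  apply: bigcup_countType_measurable => q; apply: measurableI.
    exact: (dmeas_pair dmeas_slab dmeas_level).
  by have := measurable_base measurableT (mf q.1 q.2 c); rewrite setTI.
apply/seteqP; split => [[n [i z]] /= fy|[n [i z]] [[n' i'] _ [[-> ->]]]] //.
by exists (n, i).
Qed.

Lemma measurable_on_layers d' (T' : measurableType d') (f : nat * (nat * T) -> T') :
  (forall n i, measurable_fun setT (fun z => f (layer n i z))) -> measurable_fun setT f.
Proof.
move=> mf _ A mA; rewrite setTI.
have h : dmeas (fun y => `[< A (f y) >]).
  apply: dmeas_layers => n i b.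
  have mB : measurable [set z | A (f (layer n i z))].
    by have := mf n i measurableT A mA; rewrite setTI.
  case: b.
    rewrite (_ : [set x | _] = [set z | A (f (layer n i z))])//.
    by apply/seteqP; split => z /= h; apply/asboolP.
  rewrite (_ : [set x | _] = ~` [set z | A (f (layer n i z))]); first exact: measurableC.
  apply/seteqP; split => z /= h; first by apply/asboolPn; rewrite h.
  exact/negbTE/asboolPn.
rewrite (_ : f @^-1` A = [set y | `[< A (f y) >] ]).
  exact: (dmeas_set (fun b : bool => b) h).
by apply/seteqP; split => y /= hy; apply/asboolP.
Qed.

Lemma measurable_tower : measurable tower.
Proof.
apply: (@dmeas_set _ _ _ _ (fun b : bool => b)); apply: dmeas_layers => n i.
by apply: (@dmeas_ltn _ _ (fun=> i) (mult n)) => //; exact: dmeas_cst.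
Qed.

Definition full_tower_measure : {measure set (nat * (nat * T)) -> \bar R} :=
  mseries (fun n => mscale (wt n)
    (mseries (fun i => image_measure lambda (measurable_layer n i)) 0)) 0.

Definition tower_measure : {measure set (nat * (nat * T)) -> \bar R} :=
  mrestr full_tower_measure measurable_tower.

Lemma tower_integral (F : nat * (nat * T) -> \bar R) :
  measurable_fun setT F -> (forall y, 0 <= F y) ->
  \int[tower_measure]_y F y = \sum_(n <oo) ((wt n)%:num%:E *
    \int[lambda]_z \sum_(0 <= i < mult n z) F (layer n i z)).
Proof.
move=> mF F0; rewrite /tower_measure ge0_integral_mrestr//.
have mFD : measurable_fun tower F by exact: measurable_funTS.
have mt := measurable_tower.
rewrite ge0_integral_measure_series//; apply: eq_eseriesr => n _.
rewrite ge0_integral_mscale//; congr (_ * _).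
rewrite ge0_integral_measure_series// -sum_integral_finite//; last first.
  by move=> i; exact: (measurableT_comp mF (measurable_layer n i)).
by apply: eq_eseriesr => i _; rewrite image_measure_integral.
Qed.

Lemma tower_ae_slab (P : nat * (nat * T) -> Prop) n i : (0 < (wt n)%:num)%R ->
  {ae tower_measure, forall y, P y} ->
  {ae lambda, forall z, (i < mult n z)%N -> P (layer n i z)}.
Proof.
move=> wn [A [mA A0 PA]].
exists ((layer n i) @^-1` A `&` [set z | (i < mult n z)%N]); split.
- apply: measurableI; last exact: (dmeas_set (fun k => i < k)%N).
  by have := measurable_layer n i measurableT mA; rewrite setTI.
- have n0 (k j : nat) : 0 <= lambda (layer k j @^-1` (A `&` tower)) by [].
  have h1 := nneseries_term_le i (fun j => n0 n j).
  pose v k := (wt k)%:num%:E * \sum_(j <oo) lambda (layer k j @^-1` (A `&` tower)).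
  have v0 k : 0 <= v k by rewrite mule_ge0//; exact: nneseries_ge0.
  have h2 : v n <= 0 by rewrite -A0; exact: (nneseries_term_le n v0).
  have /eqP : v n = 0 by apply/eqP; rewrite eq_le h2 v0.
  rewrite mule_eq0 eqe gt_eqF//= => /eqP h3.
  by apply/eqP; rewrite eq_le measure_ge0 andbT -h3; exact: h1.
by move=> z /= hz; split; [apply: PA => /= Pz; apply: hz|apply: contrapT => hi; apply: hz].
Qed.

End tower_space.

(** * The shift of the tower *)

Section tower_map.
Context {R : realType} {Gam : zmodType}.
Local Notation D := (dual R Gam).
Local Notation BD := (borel_dual R Gam).
Local Notation Y := (nat * (nat * BD))%type.
Variable e : nat -> Gam.
Hypothesis e_surj : forall g, exists n, e n = g.
Variable lambda : probability BD R.
Hypothesis haar : normalized_haar lambda.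
Variables (alpha : {additive Gam -> Gam}) (s : BD -> BD).
Hypothesis ms : measurable_fun setT s.
Hypothesis sK : forall w, adjoint alpha (s w) = w.
Variable ks : seq D.
Hypothesis ks_uniq : uniq ks.
Hypothesis ksP : forall w : D, (w \in ks) = (adjoint alpha w == 1%g).
Hypothesis ks_gt0 : (0 < size ks)%N.
Variable m : BD -> nat.
Hypothesis mm : measurable_fun setT m.
Hypothesis m_consistent : forall w, (m w <= fiber_sum alpha m w)%N.
Local Notation adj := (adjoint alpha).
Local Notation mt := (complementary alpha m : BD -> nat).

(** The layers of slab 0 that lie over the fibre of [w] are numbered
    consecutively: [shape_at w] counts them over each point s w * k, [slot]
    gives the number of a layer, and [unslot] the point over which the layer of a
    given number lies. *)
Definition shape_at (w : BD) : seq nat := [seq m ((s w : D) * k)%g | k <- ks].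
Definition label (z : BD) : nat := index ((s (adj z) : D)^-1 * (z : D))%g ks.
Definition slot (i : nat) (z : BD) : nat := flatten_index (shape_at (adj z)) (label z) i.
Definition unslot (p : nat) (w : BD) : BD :=
  ((s w : D) * nth 1%g ks (reshape_index (shape_at w) p))%g.

Lemma sumn_shape w : sumn (shape_at w) = (m w + mt w)%N.
Proof.
rewrite /complementary subnKC// (fiber_sumE ks_uniq ksP m (sK w)).
by rewrite sumnE big_map.
Qed.

Lemma nth_shape w j : (j < size ks)%N ->
  nth 0%N (shape_at w) j = m ((s w : D) * nth 1%g ks j)%g.
Proof. by move=> jk; rewrite (nth_map 1%g). Qed.

Lemma label_lt z : (label z < size ks)%N.
Proof.
rewrite index_mem ksP; apply/eqP; apply: dual_eq => g /=.
have := congr1 (fun v : D => v g) (sK (adj z)) => /= ->.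
by rewrite mulVf// dual_neq0.
Qed.

Lemma labelE z : z = ((s (adj z) : D) * nth 1%g ks (label z))%g.
Proof. by rewrite nth_index ?mulVKg// -index_mem label_lt. Qed.

Lemma adj_fiber w j : (j < size ks)%N -> adj ((s w : D) * nth 1%g ks j)%g = w.
Proof.
move=> jk; apply/(adjoint_fiber ksP (sK w)); exists (nth 1%g ks j) => //.
exact: mem_nth.
Qed.

Lemma label_fiber w j : (j < size ks)%N -> label ((s w : D) * nth 1%g ks j)%g = j.
Proof. by move=> jk; rewrite /label adj_fiber// mulKg index_uniq. Qed.

Lemma slotK i z : (i < m z)%N ->
  reshape_offset (shape_at (adj z)) (slot i z) = i /\ unslot (slot i z) (adj z) = z.
Proof.
move=> im; have h : (i < nth 0%N (shape_at (adj z)) (label z))%N.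
  by rewrite nth_shape ?label_lt// -labelE.
by rewrite /unslot /slot flatten_indexKr// flatten_indexKl// -labelE.
Qed.

Lemma unslotK p w : (p < m w + mt w)%N ->
  [/\ adj (unslot p w) = w, slot (reshape_offset (shape_at w) p) (unslot p w) = p &
      (reshape_offset (shape_at w) p < m (unslot p w))%N].
Proof.
rewrite -sumn_shape => pl.
have ri : (reshape_index (shape_at w) p < size ks)%N.
  by have := reshape_indexP pl; rewrite size_map.
split; first exact: adj_fiber.
  by rewrite /slot adj_fiber// label_fiber// reshape_indexK.
by have := reshape_offsetP pl; rewrite nth_shape.
Qed.

Definition tower_mult (n : nat) : BD -> nat := if n is 0 then m else mt.
(** Over [w], the first [m w] numbers go to the layers of slab 0 and the
    remaining [mt w] to those of slab 1; by the consistency inequality there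
    is exactly enough room. The higher slabs are shifted. *)
Definition tower_up (y : Y) : Y :=
  if y.1 is n.+1 then (n.+2, y.2) else
  let p := slot y.2.1 y.2.2 in let w := adj y.2.2 in
  if (p < m w)%N then (0%N, (p, w)) else (1%N, (p - m w, w)%N).
Definition tower_down (y : Y) : Y :=
  if y.1 is n.+2 then (n.+1, y.2) else
  let w := y.2.2 in let p := (if y.1 is 0 then y.2.1 else m w + y.2.1)%N in
  (0%N, (reshape_offset (shape_at w) p, unslot p w)).

Local Notation TW := (tower tower_mult).

Lemma tower_upK y : TW y -> tower_down (tower_up y) = y.
Proof.
case: y => -[|n] [i z] //=; rewrite /tower /= => im.
have [h1 h2] := slotK im.
rewrite /tower_up /=; case: ifPn => pm; rewrite /tower_down /=.
  by rewrite h1 h2.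
by rewrite subnKC ?h1 ?h2// leqNgt.
Qed.

Lemma tower_downK y : TW y -> tower_up (tower_down y) = y.
Proof.
case: y => -[|[|n]] [i z] //=; rewrite /tower /= => im.
  have [h1 h2 _] := unslotK (ltn_addr (mt z) im).
  by rewrite /tower_down /tower_up /= h1 h2 im.
have im' : (m z + i < m z + mt z)%N by rewrite ltn_add2l.
have [h1 h2 _] := unslotK im'.
rewrite /tower_down /tower_up /= h1 h2 ltnNge leq_addr /=.
by rewrite addKn.
Qed.

Let madj : measurable_fun setT (adj : BD -> BD) := measurable_adjoint e_surj alpha.

Lemma dmeas_m : dmeas m. Proof. exact/dmeas_nat. Qed.

Lemma dmeas_shape : dmeas shape_at.
Proof.
apply: (@dmeas_map _ _ _ ks (fun k w => m ((s w : D) * k)%g)) => k.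
apply: (dmeas_precomp _ dmeas_m).
by apply: (measurable_dual_mul e_surj); [exact: ms|exact: measurable_cst].
Qed.

Lemma dmeas_mt : dmeas mt.
Proof.
have -> : mt = (fun w => (sumn (shape_at w) - m w)%N).
  by apply/funext => w; rewrite sumn_shape addKn.
exact: (dmeas_comp (fun q => sumn q.1 - q.2)%N (dmeas_pair dmeas_shape dmeas_m)).
Qed.

Lemma dmeas_tower_mult n : dmeas (tower_mult n).
Proof. by case: n => [|n]; [exact: dmeas_m|exact: dmeas_mt]. Qed.

Lemma dmeas_label : dmeas label.
Proof.
move=> j; have [jk|kj] := ltnP j (size ks); last first.
  rewrite (_ : [set x | _] = set0)//; apply/seteqP; split => z //= zj.
  by have := label_lt z; rewrite zj ltnNge kj.
rewrite (_ : [set x | _] = [set z : BD | z = ((s (adj z) : D) * nth 1%g ks j)%g]).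
  apply: (measurable_dual_eq e_surj); first exact: measurable_id.
  apply: (measurable_dual_mul e_surj); last exact: measurable_cst.
  exact: (measurableT_comp ms madj).
apply/seteqP; split => z /= h; first by rewrite -h -labelE.
by rewrite /label {2}h mulKg index_uniq.
Qed.

Lemma dmeas_slot i : dmeas (slot i).
Proof.
apply: (dmeas_comp (fun q => flatten_index q.1 q.2 i) (dmeas_pair _ dmeas_label)).
exact: (dmeas_precomp madj dmeas_shape).
Qed.

Lemma measurable_unslot (p : BD -> nat) : dmeas p ->
  measurable_fun setT (fun w => unslot (p w) w).
Proof.
move=> mp; apply: (measurable_dual_mul e_surj); first exact: ms.
apply: (@dmeas_measurable_fun _ _ _ BD _ (fun w => reshape_index (shape_at w) (p w))
  (fun j => nth 1%g ks j)).
exact: (dmeas_comp (fun q => reshape_index q.1 q.2) (dmeas_pair dmeas_shape mp)).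
Qed.

Lemma measurable_layer_map (n : BD -> nat) (i : BD -> nat) (f : BD -> BD) :
  dmeas n -> dmeas i -> measurable_fun setT f ->
  measurable_fun setT (fun z => (n z, (i z, f z)) : Y).
Proof.
move=> mn mi mf; apply: measurable_fun_pair; first exact/dmeas_nat.
by apply: measurable_fun_pair => //; exact/dmeas_nat.
Qed.

Lemma measurable_tower_up : measurable_fun setT tower_up.
Proof.
apply: measurable_on_layers => -[|n] i; last exact: measurable_layer.
have ma : dmeas (fun z : BD => m (adj z)) by exact: (dmeas_precomp madj dmeas_m).
have mlt : dmeas (fun z : BD => (slot i z < m (adj z))%N).
  by apply: dmeas_ltn => //; exact: dmeas_slot.
rewrite (_ : (fun z => _) = (fun z : BD => (if (slot i z < m (adj z))%N then 0%N else 1%N,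
    (if (slot i z < m (adj z))%N then slot i z else slot i z - m (adj z), adj z)%N) : Y)).
  apply: measurable_layer_map => //.
    exact: (dmeas_comp (fun b : bool => if b then 0 else 1)%N mlt).
  exact: (dmeas_comp (fun q : bool * (nat * nat) => if q.1 then q.2.1 else q.2.1 - q.2.2)%N
    (dmeas_pair mlt (dmeas_pair (dmeas_slot i) ma))).
by apply/funext => z; rewrite /tower_up /layer /=; case: ifP.
Qed.

Lemma measurable_tower_down : measurable_fun setT tower_down.
Proof.
have main (p : BD -> nat) : dmeas p -> measurable_fun setT
    (fun w => (0%N, (reshape_offset (shape_at w) (p w), unslot (p w) w)) : Y).
  move=> mp; apply: measurable_layer_map; first exact: dmeas_cst.
    exact: (dmeas_comp (fun q => reshape_offset q.1 q.2) (dmeas_pair dmeas_shape mp)).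
  exact: measurable_unslot.
apply: measurable_on_layers => -[|[|n]] i; last exact: measurable_layer.
  exact: (main (fun=> i) (@dmeas_cst _ BD _ i)).
by apply: (main (fun w => m w + i)%N); exact: (dmeas_comp (addn^~ i) dmeas_m).
Qed.

Local Open Scope ereal_scope.

(** Slab 0 and slab 1 have weight 1, as the normalised Haar measure is to be
    found on their layers; from there on the shift must divide measure by
    [size ks], which forces the other weights. *)
Definition tower_weight (n : nat) : {nonneg R} := (((size ks)%:R ^+ n.-1 : R)%:nng)%R.

Local Notation nu := (tower_measure lambda tower_weight dmeas_tower_mult).

(** On slab 0 this is [fiber_integral], since summing over the layers above a
    fibre of the adjoint is, after numbering, summing over the layers of slabs 0
    and 1. On the other slabs it is the choice of the weights. *)
Lemma tower_scale (F : Y -> \bar R) : measurable_fun setT F -> (forall y, 0 <= F y) ->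
  \int[nu]_y F (tower_up y) = (size ks)%:R^-1%:E * \int[nu]_y F y.
Proof.
move=> mF F0.
have mFu : measurable_fun setT (fun y => F (tower_up y)).
  exact: (measurableT_comp mF measurable_tower_up).
pose I n := \int[lambda]_z \sum_(0 <= i < tower_mult n z) F (layer n i z).
have I0 n : 0 <= I n by apply: integral_ge0 => z _; exact: sume_ge0.
have K0 : ((size ks)%:R : R) != 0%R by rewrite pnatr_eq0 -lt0n.
rewrite !tower_integral//.
pose u n := (tower_weight n)%:num%:E * I n.
have u0 n : 0 <= u n by rewrite mule_ge0.
rewrite [X in _ = _ * X](_ : _ = u 0%N + (u 1%N + \sum_(n <oo) u n.+2)); last first.
  by rewrite -(nneseries_shift (fun n => u0 n.+1)) -(nneseries_shift u0).
rewrite [LHS](_ : _ = \int[lambda]_z (\sum_(0 <= i < m z) F (tower_up (layer 0 i z))) +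
   (size ks)%:R^-1%:E * \sum_(n <oo) u n.+2); last first.
  rewrite nneseries_shift; last first.
    by move=> n; rewrite mule_ge0//; apply: integral_ge0 => z _; exact: sume_ge0.
  congr (_ + _); first by rewrite /= expr0 mul1e.
  rewrite -nneseriesZl//; apply: eq_eseriesr => n _.
  by rewrite /u muleA -EFinM /= exprS mulrA mulVf// mul1r.
rewrite addeA ge0_muleDr ?adde_ge0 ?nneseries_ge0//; congr (_ + _).
pose H (z : BD) := \sum_(0 <= i < m z) F (tower_up (layer 0 i z)).
have mH : measurable_fun setT H.
  apply: (measurable_sum_finite dmeas_m) => // i.
  exact: (measurableT_comp mFu (measurable_layer 0 i)).
have H0 z : 0 <= H z by exact: sume_ge0.
have -> : u 0%N + u 1%N = (size ks)%:R%:E * \int[lambda]_z H z.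
  rewrite -(fiber_integral e_surj haar ms sK ks_uniq ksP mH H0).
  rewrite /u /= !expr0 !mul1e -ge0_integralD//; last 4 first.
  - by move=> z _; exact: sume_ge0.
  - apply: (measurable_sum_finite dmeas_m) => // i.
    exact: (measurableT_comp mF (measurable_layer 0 i)).
  - by move=> z _; exact: sume_ge0.
  - apply: (measurable_sum_finite dmeas_mt) => // i.
    exact: (measurableT_comp mF (measurable_layer 1 i)).
  apply: eq_integral => w _.
  pose G p := F (if (p < m w)%N then (0%N, (p, w)) else (1%N, (p - m w, w)%N)).
  rewrite (big_nth 1%g); transitivity (\sum_(0 <= p < sumn (shape_at w)) G p).
    rewrite sumn_shape [RHS](@big_cat_nat _ _ _ (m w))//= ?leq_addr//; congr (_ + _).
      by apply: eq_big_nat => p /andP[_ pm]; rewrite /G pm.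
    rewrite -[in RHS](add0n (m w)) big_addn addKn; apply: eq_bigr => p _.
    by rewrite /G ltnNge leq_addl /= addnK.
  rewrite -sum_flatten_index size_map; apply: eq_big_nat => j /andP[_ jk].
  rewrite nth_shape//; apply: eq_bigr => i _.
  by rewrite /G /tower_up /= /slot adj_fiber// label_fiber.
by rewrite muleA -EFinM mulVf// mul1e.
Qed.

End tower_map.

(** * Separability of L^2 *)

Section cell_separability.
Context d (Y : measurableType d) d' (T : measurableType d') {R : realType}.
Variables (nu : {measure set Y -> \bar R}) (p : Y -> T).
Hypothesis mp : measurable_fun setT p.
Variables (L : countType) (C : L -> set T).
Hypothesis Cgen : @measurable _ T = <<s range C >>.
Hypothesis CI : setI_closed (range C).
Hypothesis CT : exists l, C l = setT.

Lemma measurable_preim A : measurable A -> measurable (p @^-1` A).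
Proof. by move=> mA; rewrite -[X in measurable X]setTI; exact: mp. Qed.

(** Dynkin's pi-lambda theorem. *)
Lemma integral_cells_eq0 (f : Y -> \bar R) : nu.-integrable setT f ->
  (forall l, \int[nu]_(y in p @^-1` C l) f y = 0)%E ->
  forall A, measurable A -> (\int[nu]_(y in p @^-1` A) f y = 0)%E.
Proof.
move=> fi f0 A; rewrite Cgen; move: A.
have sub S : measurable S -> nu.-integrable (p @^-1` S) f.
  by move=> mS; apply: (integrableS measurableT) => //; exact: measurable_preim.
have fT : (\int[nu]_(y in p @^-1` setT) f y = 0)%E.
  by have [l <-] := CT.
apply: (dynkin_induction Cgen CI) => //.
- by move=> _ [l _ <-].
- move=> S mS S0.
  have := fT; rewrite -(setUv S) preimage_setU integral_setU//.
  + by rewrite S0 add0e.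
  + exact: measurable_preim.
  + by apply: measurable_preim; exact: measurableC.
  + by rewrite -preimage_setU setUv; apply: measurable_int (sub _ measurableT).
  + by apply/disj_setPS => y [].
- move=> F mF tF F0; rewrite preimage_bigcup integral_bigcup//.
  + by apply: eseries0 => i _ _.
  + by move=> i j _ _ [y [Fi Fj]]; apply: tF => //; exists (p y).
  + by move=> k; exact: measurable_preim.
  + by rewrite -preimage_bigcup; apply: sub; exact: bigcupT_measurable.
Qed.

Variables (J : countType) (B : J -> set Y).
Hypothesis mB : forall i, measurable (B i).
Hypothesis finB : forall i, (nu (B i) < +oo)%E.
Hypothesis Bp : forall i S, measurable S ->
  exists2 A, measurable A & B i `&` S = B i `&` p @^-1` A.
Hypothesis Bcover : {ae nu, forall y, exists i, B i y}.

Lemma sqint_cindic A : measurable A -> (nu A < +oo)%E -> sqint nu (cindic A).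
Proof.
move=> mA fA; split; first exact: cmeasurable_indic.
rewrite /nsq [X in (X < _)%E](_ : _ = nu A)//.
rewrite -[in RHS](setIT A) -integral_indic//; apply: eq_integral => y _.
by rewrite normsqr indicE; case: (_ \in _); rewrite ?expr1n ?expr0n.
Qed.

(** A function orthogonal to the indicators of all the sets B j `&` p @^-1` C l
    has zero integral on every measurable subset of every [B j]. *)
Lemma l2_separable : separable (l2hilbert nu).
Proof.
pose Q i l := B i `&` p @^-1` C l.
have mC l : measurable (C l) by rewrite Cgen; apply: sub_sigma_algebra; exists l.
have mQ i l : measurable (Q i l) by apply: measurableI => //; exact: measurable_preim.
have sQ i l : sqint nu (cindic (Q i l)).
  apply: sqint_cindic => //; apply: le_lt_trans (finB i).
  by apply: le_measure; rewrite ?inE//; exact: subIsetl.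
have sB i : sqint nu (cindic (B i)) by exact: sqint_cindic.
pose b n : l2hilbert nu :=
  if unpickle n is Some q then lp nu (cindic (Q q.1 q.2)) else 0.
apply: (@separable_total _ _ b) => v hv.
have v0 i l : ip nu (rp v) (cindic (Q i l)) = 0.
  rewrite -(hv (pickle (i, l))) hdot_ip /b pickleK.
  apply: ip_ae; [exact: rp_sqint|exact: rp_sqint|exact: sQ|exact: rp_sqint|exact: aeW|].
  by apply: ae_eqC; exact: lpK (sQ i l).
apply/l2_eqP.
have key (P : R[i] -> R) i : P 0 = 0 ->
    nu.-integrable setT (EFin \o (fun y => P (rp v y * Num.conj (cindic (B i) y)))) ->
    (forall l, nu.-integrable setT
       (EFin \o (fun y => P (rp v y * Num.conj (cindic (Q i l) y))))) ->
    (forall l, \int[nu]_y P (rp v y * Num.conj (cindic (Q i l) y)) = 0) ->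
    {ae nu, forall y, B i y -> P (rp v y) = 0}.
  move=> P0 fi qi q0; set f := (X in nu.-integrable setT X) in fi.
  have fcell l : (\int[nu]_(y in p @^-1` C l) f y = 0)%E.
    rewrite integral_mkcond.
    have -> : f \_ (p @^-1` C l) = EFin \o (fun y => P (rp v y * Num.conj (cindic (Q i l) y))).
      apply/funext => y; rewrite patchE; case: ifPn => [/set_mem|/negP] Cy /=.
        congr (P (_ * Num.conj _))%:E; case: (pselect (B i y)) => By.
          by rewrite !cindicT.
        by rewrite !cindicF// => -[].
      rewrite [X in Num.conj X]cindicF ?rmorph0 ?mulr0 ?P0// => -[_ Cl].
      by apply: Cy; exact: mem_set.
    rewrite -[LHS]fineK; last exact: integrable_fin_num.
    by congr EFin; exact: q0.
  have f0 : ae_eq nu setT f (cst 0%E).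
    apply: (integral_ae_eq measurableT fi) => //.
    move=> S _ mS; rewrite integral0.
    have [A mA BA] := Bp i mS.
    rewrite -[RHS](integral_cells_eq0 fi fcell mA).
    rewrite integral_mkcond [RHS]integral_mkcond; apply: eq_integral => y _.
    rewrite !patchE; case: (pselect (B i y)) => By.
      suff -> : (y \in S) = (y \in p @^-1` A) by [].
      have h : (B i `&` S) y <-> (B i `&` p @^-1` A) y by rewrite BA.
      by apply/idP/idP => /set_mem h'; apply/mem_set; [have [_] := (h.1 (conj By h'))|
        have [_] := (h.2 (conj By h'))].
    rewrite (_ : f y = 0%E); first by case: ifP; case: ifP.
    by rewrite /f /= cindicF// rmorph0 mulr0 P0.
  move: f0; apply: filterS => y /(_ I)/= + By.
  by rewrite /f /= cindicT// rmorph1 mulr1 => -[].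
have int A : sqint nu (cindic A) ->
    cintegrable nu (fun y => rp v y * Num.conj (cindic A y)).
  by move=> sA; exact: cintegrable_mulJ (rp_sqint v) sA.
have re i : {ae nu, forall y, B i y -> complex.Re (rp v y) = 0}.
  apply: (key (@complex.Re R)) => //; first exact: (int _ (sB i)).1.
    by move=> l; exact: (int _ (sQ i l)).1.
  by move=> l; have := v0 i l => -[].
have im i : {ae nu, forall y, B i y -> complex.Im (rp v y) = 0}.
  apply: (key (@complex.Im R)) => //; first exact: (int _ (sB i)).2.
    by move=> l; exact: (int _ (sQ i l)).2.
  by move=> l; have := v0 i l => -[].
have all0 : {ae nu, forall y, forall n, if unpickle n is Some i then B i y -> rp v y = 0 else True}.
  apply: ae_foralln => n; case: unpickle => [i|]; last exact: aeW.
  apply: filterS2 (re i) (im i) => y h1 h2 By.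
  by apply/eqP; rewrite eq_complex h1// h2//= eqxx.
apply: filterS3 Bcover all0 (rp0 nu) => y [i By] /(_ (pickle i)).
by rewrite pickleK => /(_ By) -> ->.
Qed.

End cell_separability.

(** * Multiplicity functions of the slabs *)

Section tower_slabs.
Context d (T : measurableType d) {R : realType}.
Variable lambda : {measure set T -> \bar R}.
Variables (mult : nat -> T -> nat) (wt : nat -> {nonneg R}).
Hypothesis mmult : forall n, dmeas (mult n).
Local Notation Y := (nat * (nat * T))%type.
Local Notation nu := (tower_measure lambda wt mmult).
Local Notation H := (l2hilbert nu).

Definition slab n : set Y := [set y | y.1 = n].

Lemma measurable_slab n : measurable (slab n).
Proof. exact: (dmeas_set (fun k => k = n) (@dmeas_slab _ T)). Qed.

Lemma tower_ae : {ae nu, forall y, tower mult y}.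
Proof.
exists (~` tower mult); split=> //.
  by apply: measurableC; exact: measurable_tower.
change (full_tower_measure lambda wt (~` tower mult `&` tower mult) = 0)%E.
by rewrite setICl measure0.
Qed.

Local Open Scope ereal_scope.

Lemma tower_slab_integral n (F : Y -> \bar R) :
  measurable_fun setT F -> (forall y, 0 <= F y) -> (forall y, y.1 <> n -> F y = 0) ->
  \int[nu]_y F y =
  (wt n)%:num%:E * \int[lambda]_z \sum_(0 <= i < mult n z) F (layer n i z).
Proof.
move=> mF F0 Fn; rewrite tower_integral//.
pose u k := (wt k)%:num%:E * \int[lambda]_z \sum_(0 <= i < mult k z) F (layer k i z).
have u0 k : k != n -> u k = 0.
  move=> /eqP kn; rewrite /u integral0_eq ?mule0// => z _.
  by rewrite big1// => i _; exact: Fn.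
have up k : 0 <= u k.
  by rewrite mule_ge0//; apply: integral_ge0 => z _; exact: sume_ge0.
rewrite (nneseries_finite (n := n.+1) up); last first.
  by move=> i ni; apply: u0; rewrite gt_eqF.
rewrite big_nat_recr//= [X in X + _]big_nat big1 ?add0e// => i /andP[_ ni].
by apply: u0; rewrite lt_eqF.
Qed.

Lemma finite_layer n i : lambda setT < +oo -> nu [set y | y.1 = n /\ y.2.1 = i] < +oo.
Proof.
move=> lfin; set B := [set _ | _].
have mB : measurable B.
  apply: measurableI; first exact: measurable_slab.
  exact: (dmeas_set (fun k => k = i) (@dmeas_level _ T)).
rewrite -[B]setIT -integral_indic//.
rewrite (@tower_slab_integral n); last 3 first.
- by apply/measurable_EFinP; exact: measurable_indic.
- by move=> y; rewrite lee_fin.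
- by move=> y yn; rewrite indicE memNset// => -[].
rewrite lte_mul_pinfty//.
apply: (@le_lt_trans _ _ (\int[lambda]_z 1)); last by rewrite integral_cst// mul1e.
apply: ge0_le_integral => //.
- by move=> z _; apply: sume_ge0 => k _; rewrite lee_fin.
- apply: (measurable_sum_finite (mmult n)) => k; last by move=> x; rewrite lee_fin.
  have m1 : measurable_fun setT (EFin \o \1_B : Y -> \bar R).
    by apply/measurable_EFinP; exact: measurable_indic.
  exact: (measurableT_comp m1 (measurable_layer n k)).
move=> z _; rewrite (_ : \sum_(0 <= k < mult n z) _ =
    \sum_(0 <= k < mult n z | k == i) 1); last first.
  rewrite [RHS]big_mkcond/=; apply: eq_bigr => k _.
  rewrite indicE; case: eqP => ki; first by rewrite mem_set.
  by rewrite memNset// => -[_ /= ]; exact: ki.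
by rewrite big_nat1_eq; case: ifP.
Qed.

Local Open Scope ring_scope.

Let sigma n i : set T := [set w | (i.+1 <= mult n w)%N].
Definition slab_coord n (v : H) (i : nat) (z : T) : R[i] := rp v (layer n i z).

Lemma nsq_slab n (h : Y -> R[i]) : (wt n)%:num = 1 -> cmeasurable setT h ->
  (forall y, y.1 <> n -> h y = 0) ->
  nsq nu h = l2_norm_sq lambda (sigma n) (fun i z => h (layer n i z)).
Proof.
move=> wn mh hn; have mF := measurable_enormsq mh.
rewrite /nsq (@tower_slab_integral n)//; last 2 first.
- by move=> y; rewrite lee_fin normsq_ge0.
- by move=> y yn; rewrite hn// normsq0.
rewrite wn mul1e -sum_integral_finite//; last 2 first.
- by move=> i; exact: (measurableT_comp mF (measurable_layer n i)).
- by move=> i z; rewrite lee_fin normsq_ge0.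
apply: eq_eseriesr => i _; apply: eq_integral => z _.
by rewrite normsqE.
Qed.

Lemma slab_coord_norm n v : (wt n)%:num = 1 -> supp (nu := nu) (slab n) v ->
  l2_norm_sq lambda (sigma n) (slab_coord n v) = (complex.Re (hdot H v v))%:E.
Proof.
move=> wn sv; have [mv _] := rp_sqint v.
have mS := cmeasurable_indic (R:=R) setT (measurable_slab n).
pose h y := cindic (slab n) y * rp v y : R[i].
have mh : cmeasurable setT h by exact: cmeasurableM.
transitivity (nsq nu h).
  rewrite (nsq_slab wn mh); last first.
    by move=> y yn; rewrite /h cindicF ?mul0r.
  apply: eq_eseriesr => i _; apply: eq_integral => z _.
  by rewrite /h cindicT// mul1r.
rewrite (nsq_ae mh mv); last first.
  apply: filterS sv => y hy; rewrite /h; case: (pselect (slab n y)) => Sy.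
    by rewrite cindicT// mul1r.
  by rewrite hy// mulr0.
by rewrite hdot_ip ip_nsq ?fineK//; [apply: sqint_fin|]; exact: rp_sqint.
Qed.

(** The coordinates are the restrictions to the layers. Norms agree by
    [tower_slab_integral], and any square-summable family on the layers is glued
    into one function on the slab. *)
Lemma slab_unitary n : (wt n)%:num = 1 ->
  unitary_onto_l2 lambda (sigma n) (H := H) (supp (nu := nu) (slab n)) (slab_coord n).
Proof.
move=> wn; have wn0 : 0 < (wt n)%:num by rewrite wn.
split.
- move=> v sv; split; last by rewrite slab_coord_norm// ltry.
  move=> i; have [mv _] := rp_sqint v.
  have [h1 h2] := cmeasurable_comp mv (measurable_layer n i).
  by split; exact: measurable_funTS.
- move=> a u v _ _ i; exact: (tower_ae_slab i wn0 (rpP a u v)).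
- by move=> v sv; exact: slab_coord_norm.
move=> f [mf ff].
pose g (y : Y) : R[i] :=
  if (y.1 == n) && (y.2.1 < mult n y.2.2)%N then f y.2.1 y.2.2 else 0.
have mg : cmeasurable setT g.
  have key (P : R[i] -> R) : P 0 = 0 ->
      (forall i, measurable_fun (sigma n i) (fun z => P (f i z))) ->
      measurable_fun setT (fun y => P (g y)).
    move=> P0 mP; apply: measurable_on_layers => k i; rewrite /g /=.
    case: eqP => kn /=; last by rewrite P0; exact: measurable_cst.
    have mS : measurable (sigma n i) by exact: (dmeas_set (fun k => i < k)%N (mmult n)).
    have := (measurable_restrictT _ mS).1 (mP i).
    congr measurable_fun; apply/funext => z; rewrite patchE.
    case: ifPn => [/set_mem|/negP] h; first by rewrite ifT.
    by rewrite ifN ?P0//; apply/negP => h'; apply: h; exact: mem_set.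
  by split; apply: key => // i; have [] := mf i.
have gn y : y.1 <> n -> g y = 0 by move=> /eqP/negPf yn; rewrite /g yn.
have gE i z : sigma n i z -> g (layer n i z) = f i z.
  by rewrite /sigma /g /= eqxx => ->.
have sg : sqint nu g.
  split=> //; rewrite (nsq_slab wn mg gn).
  rewrite [X in (X < _)%E](_ : _ = l2_norm_sq lambda (sigma n) f)//.
  apply: eq_eseriesr => i _; apply: eq_integral => z /set_mem zi.
  by rewrite gE.
exists (lp nu g); first by apply: filterS (lpK sg) => y -> /gn.
move=> i; have := tower_ae_slab i wn0 (lpK sg); apply: filterS => z h zi.
by rewrite /slab_coord h// gE.
Qed.

Lemma slab_coord_mulop n (g : Y -> R[i]) (c : T -> R[i]) v : (wt n)%:num = 1 ->
  unimodular g -> (forall i z, g (layer n i z) = c z) ->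
  eq_l2 lambda (sigma n) (slab_coord n (mulop g v : H))
    (fun i z => c z * slab_coord n v i z).
Proof.
move=> wn ug gc i; have wn0 : 0 < (wt n)%:num by rewrite wn.
have := tower_ae_slab i wn0 (rp_mulop ug v); apply: filterS => z h zi.
by rewrite /slab_coord h// gc.
Qed.

Lemma tower_l2_separable (L : countType) (C : L -> set T) :
  @measurable _ T = <<s range C >> -> setI_closed (range C) ->
  (exists l, C l = setT) -> (lambda setT < +oo)%E -> separable H.
Proof.
move=> Cgen CI CT lfin.
pose B (q : nat * nat) : set Y := [set y | y.1 = q.1 /\ y.2.1 = q.2].
apply: (@l2_separable _ _ _ _ _ _ _ (@measurable_base _ T) L C Cgen CI CT _ B).
- move=> [n i]; apply: measurableI; first exact: measurable_slab.
  exact: (dmeas_set (fun k => k = i) (@dmeas_level _ T)).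
- by move=> [n i]; exact: finite_layer.
- move=> [n i] S mS; exists (layer n i @^-1` S).
    by rewrite -[X in measurable X]setTI; exact: (measurable_layer n i).
  by apply/seteqP; split => -[k [j z]] [[/= -> ->]].
- by apply: aeW => y; exists (y.1, y.2.1).
Qed.

End tower_slabs.

(** * The multiresolution analysis of the tower *)

Section tower_gmra.
Context {R : realType} {Gam : zmodType}.
Local Notation D := (dual R Gam).
Local Notation BD := (borel_dual R Gam).
Local Notation Y := (nat * (nat * BD))%type.
Variable e : nat -> Gam.
Hypothesis e_surj : forall g, exists n, e n = g.
Variable lambda : probability BD R.
Hypothesis haar : normalized_haar lambda.
Variables (alpha : {additive Gam -> Gam}) (s : BD -> BD).
Hypothesis ms : measurable_fun setT s.
Hypothesis sK : forall w, adjoint alpha (s w) = w.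
Variable ks : seq D.
Hypothesis ks_uniq : uniq ks.
Hypothesis ksP : forall w : D, (w \in ks) = (adjoint alpha w == 1%g).
Hypothesis ks_gt1 : (1 < size ks)%N.
Variables (m : BD -> nat) (c : nat).
Hypothesis mm : measurable_fun setT m.
Hypothesis m_le : forall w, (m w <= c)%N.
Hypothesis m_consistent : forall w, (m w <= fiber_sum alpha m w)%N.
Local Notation adj := (adjoint alpha : BD -> BD).
Local Notation mt := (complementary alpha m : BD -> nat).
Local Notation tau := (tower_up alpha s ks m).
Local Notation rho := (tower_down s ks m).
Let mmult := dmeas_tower_mult e_surj ms sK ks_uniq ksP mm m_consistent.
Local Notation nu := (tower_measure lambda (tower_weight ks) mmult).
Local Notation H := (l2hilbert nu).
Let ks_gt0 : (0 < size ks)%N. Proof. exact: ltn_trans ks_gt1. Qed.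
Let mtau : measurable_fun setT tau.
Proof. exact: (measurable_tower_up e_surj ms sK ks_uniq ksP mm). Qed.
Let mrho : measurable_fun setT rho.
Proof. exact: (measurable_tower_down e_surj ms ks mm). Qed.

Let rho_tau : {ae nu, forall y, rho (tau y) = y}.
Proof.
apply: filterS (tower_ae lambda (tower_weight ks) mmult) => y.
exact: (tower_upK sK ksP).
Qed.

Let tau_rho : {ae nu, forall y, tau (rho y) = y}.
Proof.
apply: filterS (tower_ae lambda (tower_weight ks) mmult) => y.
exact: (tower_downK sK ks_uniq ksP m_consistent).
Qed.

Let tau_int (F : Y -> \bar R) : measurable_fun setT F -> (forall y, 0 <= F y)%E ->
  (\int[nu]_y F (tau y) = (size ks)%:R^-1%:E * \int[nu]_y F y)%E.
Proof. exact: tower_scale. Qed.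

Let M0 : 0 < (size ks)%:R :> R. Proof. by rewrite ltr0n. Qed.

Definition tower_dilation : unitary H :=
  dilation_unitary M0 mtau mrho tau_int rho_tau tau_rho.

(** The number of iterations makes [tower_char g] at [tau y] equal to
    [tower_char (alpha g)] at [y]: [tau] applies [adj] to the base point in slab
    0, and on the other slabs changes only the slab. *)
Definition tower_char (g : Gam) (y : Y) : R[i] := (iter y.1.-1 adj y.2.2 : D) g.

Lemma measurable_iter_adj n : measurable_fun setT (iter n adj).
Proof.
elim: n => [|n IH]; first exact: measurable_id.
exact: (measurableT_comp (measurable_adjoint e_surj alpha) IH).
Qed.

Lemma unimodular_tower_char g : unimodular (tower_char g).
Proof.
split; last by move=> y; exact: dual_unit.
have key n := cmeasurable_comp (cmeasurable_eval g) (measurable_iter_adj n).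
by split; apply: measurable_on_layers => n i; [have [] := key n.-1|have [] := key n.-1].
Qed.

Lemma tower_char_up g y : tower_char g (tau y) = tower_char (alpha g) y.
Proof.
case: y => -[|n] [i z]; last by rewrite /tower_char /tower_up /=.
by rewrite /tower_char /tower_up /=; case: ifP.
Qed.

Definition tower_rep (g : Gam) : unitary H := mul_unitary nu (unimodular_tower_char g).

Lemma tower_rep_unitary : unitary_representation tower_rep.
Proof.
split=> [v|g h v].
  by apply: mulop1; [exact: unimodular_tower_char|move=> y; exact: dual0].
apply/esym/mulop_comp; try exact: unimodular_tower_char.
by move=> y; rewrite /tower_char -dualD.
Qed.

Lemma tower_dilation_rep g v :
  unitary_inv tower_dilation (tower_rep g (tower_dilation v)) = tower_rep (alpha g) v.
Proof. by apply: dilation_mulop => y; exact: tower_char_up. Qed.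

(** The sequence with [level 0 = slab 0] in which every term is the preimage of
    the next one under [tau]; on the nonnegative side this preimage condition
    makes it a union of slabs. *)
Definition level (n : int) : set Y :=
  match n with
  | Posz k => [set y | (y.1 <= k)%N]
  | Negz k => [set y | (iter k.+1 tau y).1 = 0%N]
  end.

Lemma tau_slab0 y : (tau y).1 = 0%N -> y.1 = 0%N.
Proof. by case: y => -[]. Qed.

Lemma tau_slabS y k : ((tau y).1 <= k.+1)%N = (y.1 <= k)%N.
Proof. by case: y => -[|n] [i z]//=; rewrite /tower_up /=; case: ifP. Qed.

Lemma NegzD1 k : Negz k.+1 + 1 = Negz k.
Proof. by rewrite !NegzE; lia. Qed.

Lemma level_up n y : level n y <-> level (n + 1) (tau y).
Proof.
case: n => [k|[|k]].
- by rewrite (_ : Posz k + 1 = Posz k.+1)/= ?tau_slabS//; lia.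
- by rewrite (_ : Negz 0 + 1 = Posz 0)//= leqn0; split => [->|/eqP].
- rewrite NegzD1.
  change ((iter k.+2 tau y).1 = 0%N <-> (iter k.+1 tau (tau y)).1 = 0%N).
  by rewrite -(iterSr k.+1).
Qed.

Lemma level_sub n : level n `<=` level (n + 1).
Proof.
case: n => [k|[|k]] y.
- rewrite (_ : Posz k + 1 = Posz k.+1)/=; last by lia.
  exact: leqW.
- by rewrite (_ : Negz 0 + 1 = Posz 0)//= leqn0 => /tau_slab0 ->.
- by rewrite NegzD1 => /tau_slab0.
Qed.

Lemma measurable_iter_tau k : measurable_fun setT (iter k tau).
Proof.
elim: k => [|k IH]; first exact: measurable_id.
exact: (measurableT_comp mtau IH).
Qed.

Lemma measurable_level n : measurable (level n).
Proof.
case: n => k; first exact: (dmeas_set (fun j => j <= k)%N (@dmeas_slab _ BD)).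
have := measurable_iter_tau k.+1 measurableT (@measurable_slab _ BD 0%N).
by rewrite setTI.
Qed.

Local Open Scope ereal_scope.

Lemma slab0_le : nu (slab 0) <= c%:R%:E.
Proof.
rewrite -[slab 0]setIT -integral_indic//; last exact: measurable_slab.
have m1 : measurable_fun setT (EFin \o \1_(slab 0) : Y -> \bar R).
  by apply/measurable_EFinP; apply: measurable_indic; exact: measurable_slab.
rewrite (@tower_slab_integral _ _ _ _ _ _ _ 0%N)//; last first.
  by move=> y y0; rewrite indicE memNset.
rewrite mul1e; apply: (@le_trans _ _ (\int[lambda]_z c%:R%:E)); last first.
  rewrite integral_cst// [X in _ * X](_ : _ = 1) ?mule1//.
  exact: (probability_setT lambda).
apply: ge0_le_integral => //.
- by move=> z _; apply: sume_ge0 => i _; rewrite lee_fin.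
- apply: (measurable_sum_finite (mmult 0)) => i; last by move=> z; rewrite lee_fin.
  exact: (measurableT_comp m1 (measurable_layer 0 i)).
move=> z _; under eq_bigr do rewrite indicE mem_set//.
by rewrite sumEFin lee_fin big_mkord sumr_const card_ord ler_nat m_le.
Qed.

Lemma level_Negz k : nu (level (Negz k)) = ((size ks)%:R^-1 ^+ k.+1)%:E * nu (slab 0).
Proof.
have m1 : measurable_fun setT (EFin \o \1_(slab 0) : Y -> \bar R).
  by apply/measurable_EFinP; apply: measurable_indic; exact: measurable_slab.
rewrite -[slab 0]setIT -integral_indic//; last exact: measurable_slab.
rewrite -[level _]setIT -integral_indic//; last exact: measurable_level.
have key j : \int[nu]_y (EFin \o \1_(slab 0)) (iter j tau y) =
    ((size ks)%:R^-1 ^+ j)%:E * \int[nu]_y (EFin \o \1_(slab 0)) y.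
  elim: j => [|j IH]; first by rewrite expr0 mul1e.
  rewrite exprS EFinM -muleA -IH -(tau_int (measurableT_comp m1 (measurable_iter_tau j))).
    by apply: eq_integral => y _; rewrite iterSr.
  by move=> y; rewrite lee_fin.
exact: key k.+1.
Qed.

(** The measures of the negative levels are bounded by c / M^(k+1), and M >= 2. *)
Lemma level_cap : nu.-negligible (\bigcap_k level (Negz k)).
Proof.
set N := \bigcap_k _.
have mN : measurable N by apply: bigcapT_measurable => k; exact: measurable_level.
exists N; split=> //; apply/eqP; rewrite eq_le measure_ge0 andbT.
apply/lee_addgt0Pr => r r0; rewrite add0e.
have [k hk] : exists k, (2^-1 ^+ k < r / c.+1%:R :> R)%R.
  by apply: exists_half_lt; rewrite divr_gt0.
apply: (@le_trans _ _ (nu (level (Negz k)))).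
  apply: le_measure; rewrite ?inE//; first exact: measurable_level.
  by move=> y; apply.
rewrite level_Negz; apply: (@le_trans _ _ ((2^-1 ^+ k)%:E * c.+1%:R%:E)).
  apply: lee_pmul => //.
    rewrite lee_fin exprS; apply: (@le_trans _ _ ((size ks)%:R^-1 ^+ k)%R).
      by rewrite ler_piMl ?exprn_ge0 ?invr_ge0// invf_le1// ler1n.
    rewrite lerXn2r ?nnegrE ?invr_ge0//.
    by rewrite lef_pV2 ?posrE// ler_nat.
  by apply: le_trans slab0_le _; rewrite lee_fin ler_nat.
by rewrite -EFinM lee_fin -ler_pdivlMr// ltW.
Qed.

Local Open Scope ring_scope.

Definition tower_space (n : int) : set H := supp (nu := nu) (level n).

Lemma tower_gmra : gmra tower_rep tower_dilation tower_space.
Proof.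
split.
- by move=> n; apply: supp_closed_subspace; exact: measurable_level.
- by move=> n u; apply: filterS => y h hy; apply: h => /level_sub.
- by move=> n; apply: dilation_supp => y; exact: level_up.
- rewrite (_ : \bigcup_(n in _) _ = \bigcup_k tower_space (Posz k)); last first.
    apply/seteqP; split => [u [[k|k]//= _ hk]|u [k _ hk]]; first by exists k.
    by exists (Posz k).
  apply: supp_bigcup_dense; first by move=> k; exact: measurable_level.
    by move=> n k nk y /= yn; exact: leq_trans nk.
  by apply/seteqP; split => // y _; exists y.1 => /=.
- apply/seteqP; split => [v hv|_ ->] /=; last first.
    by move=> n _; have [] := supp_closed_subspace nu (measurable_level n).
  apply/l2_eqP; have : {ae nu, forall y, forall k, ~ level (Negz k) y -> rp v y = 0}.
    by apply: ae_foralln => k; exact: hv.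
  have cap : {ae nu, forall y, ~ (\bigcap_k level (Negz k)) y}.
    by have := level_cap; apply: negligibleS => y /= /contrapT.
  apply: filterS3 (rp0 nu) cap => y -> hy h.
  apply: contrapT => vy; apply: hy => k _; apply: contrapT => /h.
  exact: vy.
- move=> g v; have ug := unimodular_tower_char g.
  by apply: filterS2 (rp_mulop ug v) => y -> h /h ->; rewrite mulr0.
Qed.

Lemma tower_space0 : tower_space 0 = supp (nu := nu) (slab 0).
Proof.
rewrite /tower_space; congr supp; apply/seteqP; split => y /=; rewrite /slab /=.
  by rewrite leqn0 => /eqP.
by move=> ->.
Qed.

Lemma tower_space_ominus :
  ominus (tower_space 1) (tower_space 0) = supp (nu := nu) (slab 1).
Proof.
rewrite /tower_space ominus_supp; try exact: measurable_level.
  congr supp; apply/seteqP; split => y; rewrite /slab /=.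
    by move=> [y1 y0]; apply/eqP; rewrite eqn_leq y1 ltnNge; apply/negP.
  by move=> ->.
exact: (@level_sub 0).
Qed.

Let weight0 : (tower_weight (R := R) ks 0)%:num = 1. Proof. by rewrite /= expr0. Qed.
Let weight1 : (tower_weight (R := R) ks 1)%:num = 1. Proof. by rewrite /= expr0. Qed.

Lemma tower_multiplicity : multiplicity_function lambda tower_rep (tower_space 0) m.
Proof.
split=> //; exists (@slab_coord _ _ _ lambda _ _ mmult 0).
  by rewrite tower_space0; exact: (slab_unitary lambda mmult weight0).
by move=> g v _; exact: (slab_coord_mulop v weight0 (unimodular_tower_char g)).
Qed.

Lemma tower_complementary_multiplicity :
  multiplicity_function lambda tower_rep (ominus (tower_space 1) (tower_space 0)) mt.
Proof.
split; first by apply/dmeas_nat; exact: (mmult 1).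
exists (@slab_coord _ _ _ lambda _ _ mmult 1).
  by rewrite tower_space_ominus; exact: (slab_unitary lambda mmult weight1).
by move=> g v _; exact: (slab_coord_mulop v weight1 (unimodular_tower_char g)).
Qed.

Lemma tower_separable : separable H.
Proof.
apply: (@tower_l2_separable _ _ _ lambda _ (tower_weight ks) mmult _ (dual_cell e) (dual_cell_generate e_surj) (@dual_cellI _ _ e)).
  by exists [::]; apply/seteqP; split.
by rewrite [X in (X < _)%E](_ : _ = 1%E) ?ltry//; exact: (probability_setT lambda).
Qed.

End tower_gmra.

Theorem theorem3 (R : realType) (Gamma : zmodType)
    (Gamma_countable : countable [set: Gamma])
    (Gamma_nontrivial : exists g : Gamma, g != 0)
    (alpha : {additive Gamma -> Gamma}) (alpha_inj : injective alpha)
    (N : nat) (alpha_index : range_index alpha N)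
    (ker_dense : dense (\bigcup_(n in [set n | (1 <= n)%N])
       [set w : dual R Gamma | iter n (adjoint alpha) w = 1%g]))
    (lambda : probability (borel_dual R Gamma) R)
    (lambda_haar : normalized_haar lambda)
    (c : nat) (m : borel_dual R Gamma -> nat)
    (m_borel : measurable_fun [set: borel_dual R Gamma] m)
    (m_le : forall w, (m w <= c)%N)
    (m_consistent : forall w, (m w <= fiber_sum alpha m w)%N)
    (a : nat) (a_gt0 : (0 < a)%N)
    (m_near1 : \forall w \near (1%g : dual R Gamma),
       (m w)%:Z - (complementary alpha m w)%:Z <= a%:Z /\ (a <= m w)%N) :
  exists H : hilbert R, separable H /\
  exists (pi : Gamma -> unitary H) (delta : unitary H) (V : int -> set H),
    [/\ unitary_representation pi,
        forall g v, unitary_inv delta (pi g (delta v)) = pi (alpha g) v,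
        gmra pi delta V,
        multiplicity_function lambda pi (V 0) m &
        multiplicity_function lambda pi (ominus (V 1) (V 0))
          (complementary alpha m)].
Proof.
have [e e_surj] := countable_enum 0 Gamma_countable.
have [ks0 ks0E] := (finite_seqP _).1 (kernel_finite (R := R) alpha_index).
pose ks := undup ks0.
have ksP (w : dual R Gamma) : (w \in ks) = (adjoint alpha w == 1%g).
  have h : [set w : dual R Gamma | adjoint alpha w = 1%g] w <-> [set` ks0] w by rewrite ks0E.
  by rewrite mem_undup; apply/idP/eqP => /h.
have ks_gt1 := kernel_size_gt1 e_surj ksP Gamma_nontrivial ker_dense.
have [s [ms sK]] := adjoint_section (R := R) e_surj alpha_inj.
have ks_uniq : uniq ks := undup_uniq ks0.
exists (l2hilbert (tower_measure lambda (tower_weight ks)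
  (dmeas_tower_mult e_surj ms sK ks_uniq ksP m_borel m_consistent))).
split; first exact: tower_separable.
exists (tower_rep e_surj lambda ms sK ks_uniq ksP m_borel m_consistent).
exists (tower_dilation e_surj lambda_haar ms sK ks_uniq ksP ks_gt1 m_borel m_consistent).
exists (@tower_space _ _ _ _ _ _ _ _ _ _ _ _ _ _ _).
split.
- exact: tower_rep_unitary.
- exact: tower_dilation_rep.
- exact: tower_gmra m_le m_consistent.
- exact: tower_multiplicity.
- exact: tower_complementary_multiplicity.
Qed.
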